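(* Let $(a,b)$ satisfy $0<a,b<1$, $a+b\le1$ and, with $\lambda=1-b$, $a<1+\lambda-\lambda^3-\lambda^4$. Let $P$ be the convex quadrilateral with vertices $A=(0,1)$, $B=(a,1)$, $C=(1,b)$, $D=(0,0)$ and let $T$ be the outer billiards map with contraction $\lambda=1-b$ outside $P$. Then there is a unique $T$-invariant Borel probability measure $\mu_{(a,b)}$ supported on the set $K_{(a,b)}$, and it has the property that for each continuous function $\phi$ on $\mathbb R^2\setminus P$, $$\lim_{n\to\infty}\frac{1}{n}\sum_{i=0}^{n-1}\phi(T^ix)=\int\phi|_{K_{(a,b)}}\,d\mu_{(a,b)}$$ holds for all $x\in X\cap(R_1\cup R_2)$, and, for parameters in the range $a\in[0.4,0.5]$, $b=0.4$, for all $x\in X$.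
   Context: Outer billiards with contraction: for a convex polygon $P$ and $0<\lambda<1$, given a generic $x\in\mathbb R^2\setminus P$ there is a unique vertex $v$ of $P$ such that $P$ lies on the left of the ray from $x$ through $v$; set $Tx=(1+\lambda)v-\lambda x$. If $A_1,\dots,A_n$ are the vertices of $P$ in clockwise order, let $S$ be the union of the singular rays $\overrightarrow{A_1A_2},\dots,\overrightarrow{A_{n-1}A_n},\overrightarrow{A_nA_1}$, where $T$ is not well-defined. Let $X=\mathbb R^2\setminus\big(P\cup\bigcup_{i\ge0}T^{-i}S\big)$, the set of points whose whole forward orbit is defined. At singular points the convention is that the dynamics is defined to be the one that makes $T$ continuous in the region under consideration (one-sided values). Rectangles: let $\mu=1/\lambda$ and $l=\mu+(1-a)\mu^2$. For sufficiently small $\epsilon>0$, $R_1=[-l+\epsilon,0]\times[1,1+\epsilon^2]$ and $R_2=[-l+\epsilon,0]\times[1-\epsilon^2,1]$ is the reflection of $R_1$ in the line $y=1$. $K_{(a,b)}$ denotes the unique attractor for points in $X\cap(R_1\cup R_2)$, that is, the set (a periodic orbit, possibly with points on $S$, or a Cantor set) to which every point of $X\cap(R_1\cup R_2)$ is asymptotic under $T$. *)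

(* Defs.v *)
From HB Require Import structures.
From mathcomp Require Import all_boot all_order all_algebra.
From mathcomp Require Import all_classical all_reals all_analysis.

Set Implicit Arguments.
Unset Strict Implicit.
Unset Printing Implicit Defensive.
Import Order.TTheory GRing.Theory Num.Theory.
Import numFieldNormedType.Exports.
Local Open Scope classical_set_scope.
Local Open Scope ring_scope.

Section OuterBilliard.
Context {R : realType}.
Local Notation plane := (R * R)%type.
Implicit Types (lam eps a b : R) (x p q : plane) (K W : set plane).

(* cross u w >= 0 iff w lies weakly on the left of the direction u. *)
Definition cross (u w : plane) : R := u.1 * w.2 - u.2 * w.1.

Definition ray p q : set plane :=
  [set y | exists2 t : R, 0 <= t &
     y = (p.1 + t * (q.1 - p.1), p.2 + t * (q.2 - p.2))].

(* A polygon is given by its vertices V 0, ..., V (n-1), listed clockwise. *)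
Section Polygon.
Variables (n : nat) (lam : R) (V : 'I_n -> plane).

Definition polygon : set plane :=
  [set p | exists w : 'I_n -> R, [/\ forall i, 0 <= w i,
     \sum_(i < n) w i = 1 &
     p = (\sum_(i < n) w i * (V i).1, \sum_(i < n) w i * (V i).2)]].

Definition polygon_on_left x (v : plane) : Prop :=
  forall p, polygon p -> 0 <= cross (v - x) (p - x).

Definition singular_rays : set plane :=
  \bigcup_(i in [set: 'I_n]) ray (V i) (V (ordS i)).

(* Off the polygon and the singular rays exactly one vertex qualifies; *)
(* elsewhere the value is arbitrary and is never used below.           *)
Definition outer_billiard x : plane :=
  xget x [set y | exists i, polygon_on_left x (V i) /\
    y = ((1 + lam) * (V i).1 - lam * x.1, (1 + lam) * (V i).2 - lam * x.2)].

Definition orbit x : nat -> plane := fun k => iter k outer_billiard x.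

(* The set X of points whose whole forward orbit is defined. *)
Definition regular_points : set plane :=
  ~` (polygon `|`
      \bigcup_(k in [set: nat]) (iter k outer_billiard @^-1` singular_rays)).

(* One-sided dynamics at singular points.  The attractor may meet the         *)
(* singular rays, where the two one-sided continuations of T differ, and the  *)
(* same planar point may have to be continued in different ways at different  *)
(* passages.  A one-sided orbit is a limit, at all times simultaneously, of   *)
(* genuine orbits; for a point of X it is just its orbit.                     *)
Definition orbit_space := {ptws nat -> plane}.

Definition one_sided_orbits : set orbit_space :=
  closure ((orbit : plane -> orbit_space) @` regular_points).

Definition shift (s : orbit_space) : orbit_space := fun k => s k.+1.

Definition borel_orbit_space := g_sigma_algebraType (@open orbit_space).

(* A T-invariant law is the law of the starting point of a stationary random  *)
(* one-sided orbit.  When mu X = 1 this says mu (T @^-1` B) = mu B for all    *)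
(* Borel sets B, the orbit being then a function of its starting point.       *)
Definition invariant_law (mu : probability plane R) : Prop :=
  exists Q : probability borel_orbit_space R,
    [/\ Q one_sided_orbits = 1%E,
        forall A : set borel_orbit_space,
          measurable A -> Q (shift @^-1` A) = Q A &
        forall B : set plane, measurable B ->
          Q [set s : orbit_space | B (s 0%N)] = mu B].

Definition asymptotic_to x K : Prop :=
  forall e : R, 0 < e ->
    \forall k \near \oo, exists2 p, K p & ball p e (orbit x k).

Definition omega_limit x : set plane := cluster (orbit x @ \oo).

(* Every orbit starting in W tends to K and accumulates at every point of K, *)
(* so that K is unique as soon as W is nonempty.                             *)
Definition is_attractor W K : Prop :=
  [/\ compact K,
      forall x, W x -> asymptotic_to x K &
      forall x, W x -> omega_limit x = K].

Definition attractor W : set plane := xget set0 [set K | is_attractor W K].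

Definition time_averages_to x (mu : probability plane R) K
    (phi : plane -> R) : Prop :=
  ((\sum_(0 <= i < m) phi (orbit x i)) / m%:R)%:E @[m --> \oo]
    --> (\int[mu]_(p in K) (phi p)%:E)%E.

End Polygon.

Definition quad a b (i : 'I_4) : plane :=
  tnth [tuple (0, 1); (a, 1); (1, b); (0, 0)] i.

Definition rect_length a b : R :=
  let mu := (1 - b)^-1 in mu + (1 - a) * mu ^+ 2.

Definition rect1 a b eps : set plane :=
  `[- rect_length a b + eps, 0]%classic `*` `[1, 1 + eps ^+ 2]%classic.

Definition rect2 a b eps : set plane :=
  `[- rect_length a b + eps, 0]%classic `*` `[1 - eps ^+ 2, 1]%classic.

Definition rect_points a b eps : set plane :=
  regular_points (1 - b) (quad a b) `&` (rect1 a b eps `|` rect2 a b eps).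

(* K_(a,b), for a small eps. *)
Definition K_ab a b eps : set plane :=
  attractor (1 - b) (quad a b) (rect_points a b eps).

(* Continuity up to the boundary: K_(a,b) meets the sides of the polygon, so  *)
(* the test functions must be defined there.                                  *)
Definition continuous_outside n (V : 'I_n -> plane) (phi : plane -> R) : Prop :=
  {within ~` (polygon V)°, continuous phi}.

End OuterBilliard.

(* Main.v *)
From HB Require Import structures.
From mathcomp Require Import all_boot all_order all_algebra.
From mathcomp Require Import all_classical all_reals all_analysis.
From mathcomp Require Import measurable_realfun ring lra zify.
Require Import Defs.

(** Close to the line [y = 1], which carries the side [AB], the map multiplies the distance
to the line by a power of [lam] and is piecewise affine in the abscissa. Orbits that start
there stay in three thin boxes ([zone_step]) and keep coming back to a segment on the left
of [A]. The return map of this segment is a contraction with one discontinuity; it is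
increasing on each side and injective, the hypothesis on [a] being what separates the two
images, so it preserves the cyclic order like a rotation. Record which side of the
discontinuity an orbit visits: the numbers of visits of two orbits to one side, up to the
same time, differ by at most one ([trapped_visits]), as in Sturmian sequences.

This balance replaces the study of rotation numbers. An observable that reads finitely many
symbols is affine in visit counts, because a visit count takes two consecutive values and
the counts of two orbits are ordered, so that products of counts are affine in counts.
Hence the Birkhoff sums of such an observable along two trapped orbits differ by a bounded
amount ([balanced_bounded_discrepancy], [induced_bounded_discrepancy]). The map contracts
the distance of two points with the same tangent vertex, so a continuous function is
uniformly close to such observables: its time averages converge to the same constant along
all trapped orbits, uniformly ([uniform_time_mean]), and all trapped orbits have the same
limit set, which is the attractor ([cluster_orbit_eq], [attractorE]).

The frequencies of finite words of tangent vertices define a law on two-sided sequences of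
vertices ([word_law]). By contraction a two-sided sequence determines an orbit in the
attractor ([coded_orbits]), and the law of its starting point is invariant
([coded_stationary_law]). It is constructed on the space of one-sided orbits, since the
attractor can meet the singular rays. Conversely an invariant law carried by the attractor
lives on limits of regular orbits that start close to the attractor; these are trapped, so
the integral of a continuous function is its common time average ([stationary_integral]),
which determines the law ([probability_eq_integral]).

The attractor is well defined because some regular orbit is trapped: the abscissas whose
orbit meets a singular ray are countable in number ([regular_base_ex]). For [b = 4 / 10]
and [a] in the given range every regular orbit is trapped in the end: it enters a square in
which a step around [C] always comes just after a step around [D], and then the distance to
the line [y = 1] tends to zero ([regular_captured]). *)

Set Implicit Arguments.
Unset Strict Implicit.
Unset Printing Implicit Defensive.
Import Order.TTheory GRing.Theory Num.Theory.
Import numFieldNormedType.Exports.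
Local Open Scope classical_set_scope.
Local Open Scope ring_scope.


(** * Birkhoff sums of bounded discrepancy *)

Lemma natr_above (R : realType) (x : R) : exists n : nat, x <= n%:R.
Proof.
exists `|Num.ceil x|%N; apply: le_trans (ceil_ge x) _.
by rewrite natr_absz ler_int ler_norm.
Qed.

Definition birkhoff_sum (R : realType) (X : choiceType) (T : X -> X) (f : X -> R) n x : R :=
  \sum_(i < n) f (iter i T x).

Definition bounded_discrepancy (R : realType) (X : choiceType) (T : X -> X) (Z : set X)
    (f : X -> R) : Prop :=
  exists C : R, forall x y n, Z x -> Z y ->
    `|birkhoff_sum T f n x - birkhoff_sum T f n y| <= C.

Definition same_codes (X : choiceType) (A : eqType) (T : X -> X) (c : X -> A) k x y : Prop :=
  forall i, (i < k)%N -> c (iter i T x) = c (iter i T y).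

Definition code_determined (R : realType) (X : choiceType) (A : eqType) (T : X -> X)
    (c : X -> A) (Z : set X) k (f : X -> R) : Prop :=
  forall x y, Z x -> Z y -> same_codes T c k x y -> f x = f y.

Section BirkhoffSums.
Context {R : realType} {X : choiceType}.
Variable T : X -> X.
Implicit Types (f : X -> R) (x : X) (Z : set X).

Lemma iter_invariant Z : (forall x, Z x -> Z (T x)) ->
  forall n x, Z x -> Z (iter n T x).
Proof. by move=> ZT; elim=> [|n IH] x Zx //=; apply/ZT/IH. Qed.

Lemma birkhoff_sum0 f x : birkhoff_sum T f 0 x = 0.
Proof. by rewrite /birkhoff_sum big_ord0. Qed.

Lemma birkhoff_sumD f n m x :
  birkhoff_sum T f (n + m) x = birkhoff_sum T f n x + birkhoff_sum T f m (iter n T x).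
Proof.
rewrite /birkhoff_sum big_split_ord; congr (_ + _).
by apply: eq_bigr => i _ /=; rewrite addnC iterD.
Qed.

Lemma birkhoff_sumS f n x :
  birkhoff_sum T f n.+1 x = f x + birkhoff_sum T f n (T x).
Proof. by rewrite -add1n birkhoff_sumD {1}/birkhoff_sum big_ord1. Qed.

Lemma birkhoff_sum_le Z f (M : R) n x : (forall y, Z y -> Z (T y)) ->
  (forall y, Z y -> `|f y| <= M) -> Z x -> `|birkhoff_sum T f n x| <= M * n%:R.
Proof.
move=> ZT fM Zx; rewrite /birkhoff_sum (le_trans (ler_norm_sum _ _ _)) //.
rewrite (le_trans (y := \sum_(i < n) M)) //.
  by apply: ler_sum => i _; apply: fM; exact: (iter_invariant ZT).
by rewrite sumr_const card_ord mulr_natr.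
Qed.

Lemma same_codes_sub (A : eqType) (c : X -> A) k m x y : (m <= k)%N ->
  same_codes T c k x y -> same_codes T c m x y.
Proof. by move=> mk H i im; apply: H; apply: leq_trans mk. Qed.

Lemma same_codes_iter (A : eqType) (c : X -> A) j k x y :
  same_codes T c (j + k) x y -> same_codes T c k (iter j T x) (iter j T y).
Proof. by move=> H i ik; rewrite -!iterD; apply: H; rewrite addnC ltn_add2l. Qed.

Lemma same_codes_sym (A : eqType) (c : X -> A) k x y :
  same_codes T c k x y -> same_codes T c k y x.
Proof. by move=> H i ik; rewrite H. Qed.

Lemma same_codes_trans (A : eqType) (c : X -> A) k x y z :
  same_codes T c k x y -> same_codes T c k y z -> same_codes T c k x z.
Proof. by move=> H K i ik; rewrite H ?K. Qed.

Lemma same_codesS (A : eqType) (c : X -> A) k x y :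
  same_codes T c k x y -> c (iter k T x) = c (iter k T y) ->
  same_codes T c k.+1 x y.
Proof.
by move=> H e i; rewrite ltnS leq_eqVlt => /predU1P[->//|]; exact: H.
Qed.

End BirkhoffSums.

Section Balanced.
Context {R : realType} {X : choiceType}.
Variables (g : X -> X) (s : X -> bool) (Y : set X).

Definition visits n x : nat := \sum_(i < n) s (iter i g x).

Hypothesis Yg : forall x, Y x -> Y (g x).
Hypothesis Yvisits : forall x y, Y x -> Y y ->
  (forall n, visits n x <= visits n y <= (visits n x).+1)%N \/
  (forall n, visits n y <= visits n x <= (visits n y).+1)%N.

(** By exchange of summations, the sum over [N] steps of the visit count of length [n] is the
sum over [n] steps of the visit count of length [N], and the counts of two points differ
by at most one. So it is enough to write an observable with visit counts. *)
Let visit_affine (f : X -> R) := exists c, exists l : seq (R * nat), forall x, Y x ->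
  f x = c + \sum_(e <- l) e.1 * (visits e.2 x)%:R.

Let visit_affine_ext f h : (forall x, Y x -> f x = h x) -> visit_affine h -> visit_affine f.
Proof. by move=> fh [c [l H]]; exists c, l => x Yx; rewrite fh // H. Qed.

Let visit_affine_cst c : visit_affine (fun=> c).
Proof. by exists c, [::] => x _; rewrite big_nil addr0. Qed.

Let visit_affine_visits n : visit_affine (fun x => (visits n x)%:R).
Proof. by exists 0, [:: (1, n)] => x _; rewrite big_seq1 /= mul1r add0r. Qed.

Let visit_affineD f h : visit_affine f -> visit_affine h -> visit_affine (fun x => f x + h x).
Proof.
move=> [c [l H]] [c' [l' H']]; exists (c + c'), (l ++ l') => x Yx.
by rewrite H // H' // big_cat /= addrACA.
Qed.

Let visit_affineZ a f : visit_affine f -> visit_affine (fun x => a * f x).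
Proof.
move=> [c [l H]]; exists (a * c), [seq (a * e.1, e.2) | e <- l] => x Yx.
rewrite H // mulrDr mulr_sumr big_map; congr (_ + _).
by apply: eq_bigr => e _; rewrite mulrA.
Qed.

Let visit_affineB f h : visit_affine f -> visit_affine h -> visit_affine (fun x => f x - h x).
Proof.
move=> nf nh; apply: (@visit_affine_ext _ (fun x => f x + -1 * h x)).
  by move=> x _; rewrite mulN1r.
by apply: visit_affineD => //; apply: visit_affineZ.
Qed.

Let visits_le1 n x y : Y x -> Y y -> (visits n x <= (visits n y).+1)%N.
Proof.
move=> Yx Yy; case: (Yvisits Yx Yy) => /(_ n) /andP[h1 h2] //.
exact: leq_trans h1 _.
Qed.

Let visits_min n : exists c, forall x, Y x -> visits n x = c \/ visits n x = c.+1.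
Proof.
case: (pselect (exists x, Y x)) => [[x0 Yx0]|noY]; last first.
  by exists 0 => x Yx; exfalso; apply: noY; exists x.
have ex : exists m, `[< exists2 x, Y x & visits n x = m >].
  by exists (visits n x0); apply/asboolP; exists x0.
have [m /asboolP[x Yx xm] min] := ex_minnP ex.
exists m => y Yy; have mle : (m <= visits n y)%N.
  by apply: min; apply/asboolP; exists y.
have := visits_le1 n Yy Yx; rewrite xm leq_eqVlt ltnS.
case/orP => [/eqP ->|yle]; first by right.
by left; apply/eqP; rewrite eqn_leq yle.
Qed.

(** A visit count takes two consecutive values only, so it is 0/1-valued up to a constant;
over a totally ordered family of 0/1-valued functions, a product is one of its factors. *)
Let visit_affine_mul_visits n k : visit_affine (fun x => (visits n x)%:R * (visits k x)%:R).
Proof.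
have [c cP] := visits_min n; have [d dP] := visits_min k.
have [nk|/existsNP[x /not_implyP[Yx xnk]]] :=
    pselect (forall x, Y x -> visits n x = c.+1 -> visits k x = d.+1).
  apply: (@visit_affine_ext _ (fun x => d%:R * (visits n x)%:R +
    (c%:R * ((visits k x)%:R - d%:R) + 1 * ((visits n x)%:R - c%:R)))).
    move=> x Yx; case: (cP _ Yx) => h; last by rewrite h (nk _ Yx h); lra.
    by case: (dP _ Yx) => h'; rewrite h h'; lra.
  by do 2?[apply: visit_affineD|apply: visit_affineZ|apply: visit_affineB
      |apply: visit_affine_visits|apply: visit_affine_cst];
     do ?[apply: visit_affineD|apply: visit_affineZ|apply: visit_affineB
      |apply: visit_affine_visits|apply: visit_affine_cst].
have kn y : Y y -> visits k y = d.+1 -> visits n y = c.+1.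
  move=> Yy yk; case: (cP _ Yy) => // yn; exfalso.
  have /not_implyP[xn xk] := xnk.
  have {}xk : visits k x = d by case: (dP _ Yx).
  case: (Yvisits Yx Yy) => H; [have := H n|have := H k].
    by rewrite xn yn ltnn.
  by rewrite xk yk ltnn.
apply: (@visit_affine_ext _ (fun x => d%:R * (visits n x)%:R +
  (c%:R * ((visits k x)%:R - d%:R) + 1 * ((visits k x)%:R - d%:R)))).
  move=> y Yy; case: (dP _ Yy) => h; last by rewrite h (kn _ Yy h); lra.
  by case: (cP _ Yy) => h'; rewrite h h'; lra.
by do ?[apply: visit_affineD|apply: visit_affineZ|apply: visit_affineB
      |apply: visit_affine_visits|apply: visit_affine_cst].
Qed.

Let visit_affineM f k : visit_affine f -> visit_affine (fun x => f x * (visits k x)%:R).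
Proof.
move=> [c [l H]]; apply: (@visit_affine_ext _ (fun x => c * (visits k x)%:R +
   \sum_(e <- l) e.1 * ((visits e.2 x)%:R * (visits k x)%:R))).
  move=> x Yx; rewrite H // mulrDl mulr_suml; congr (_ + _).
  by apply: eq_bigr => e _; rewrite mulrA.
apply: visit_affineD; first exact/visit_affineZ/visit_affine_visits.
elim: l {H} => [|e l IH].
  by apply: (@visit_affine_ext _ (fun=> 0)) => // x _; rewrite big_nil.
apply: (@visit_affine_ext _ (fun x => e.1 * ((visits e.2 x)%:R * (visits k x)%:R) +
   \sum_(e <- l) e.1 * ((visits e.2 x)%:R * (visits k x)%:R))).
  by move=> x _; rewrite big_cons.
by apply: visit_affineD => //; apply: visit_affineZ.
Qed.

Let visitsS k x : (s (iter k g x))%:R = (visits k.+1 x)%:R - (visits k x)%:R :> R.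
Proof. by rewrite /visits big_ord_recr /= natrD addrC addKr. Qed.

(** Induction on the number of symbols read: the last symbol enters affinely and is the
difference of two consecutive visit counts. *)
Let visit_affine_code_determined k f : code_determined g s Y k f -> visit_affine f.
Proof.
elim: k f => [|k IH] f fk.
  case: (pselect (exists x, Y x)) => [[x0 Yx0]|noY].
    by apply: (@visit_affine_ext _ (fun=> f x0)) => // x Yx; apply: fk.
  by apply: (@visit_affine_ext _ (fun=> 0)) => // x Yx; exfalso; apply: noY; exists x.
pose E b x := [set y | [/\ Y y, same_codes g s k x y & s (iter k g y) = b]].
pose h b x := f (xget x (E b x)).
have visit_affine_h b : code_determined g s Y k (fun x => if `[< E b x !=set0 >] then h b x else 0).
  move=> x y Yx Yy xy; have Exy : E b x = E b y.
    apply/seteqP; split => z [Yz zk zb]; split => //.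
      exact: same_codes_trans (same_codes_sym xy) zk.
    exact: same_codes_trans xy zk.
  rewrite Exy; case: asboolP => // -[z Ez]; rewrite /h Exy.
  case: (xgetPex x (ex_intro _ z Ez)) => Y1 c1 s1.
  case: (xgetPex y (ex_intro _ z Ez)) => Y2 c2 s2.
  apply: fk => //; apply: same_codesS; last by rewrite s1 s2.
  exact: same_codes_trans (same_codes_sym c1) c2.
have := IH _ (visit_affine_h true); have := IH _ (visit_affine_h false).
set h0 := (X in visit_affine X -> _); move=> n0; set h1 := (X in visit_affine X -> _); move=> n1.
apply: (@visit_affine_ext _ (fun x => h0 x + ((h1 x - h0 x) * (visits k.+1 x)%:R -
                                    (h1 x - h0 x) * (visits k x)%:R))).
  move=> x Yx; rewrite -mulrBr -visitsS.
  have Ex : E (s (iter k g x)) x x by split.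
  have fE : f x = h (s (iter k g x)) x.
    case: (xgetPex x (ex_intro _ x Ex)) => Y1 c1 s1.
    by apply: fk => //; apply: same_codesS.
  rewrite fE /h0 /h1; case sx: (s (iter k g x)) Ex => Ex.
    have -> : `[< E true x !=set0 >] by apply/asboolP; exists x.
    by rewrite /=; ring.
  have -> : `[< E false x !=set0 >] by apply/asboolP; exists x.
  by rewrite /=; ring.
by apply: visit_affineD => //; apply: visit_affineB; apply: visit_affineM; apply: visit_affineB.
Qed.

Lemma visits_sum n m x :
  (\sum_(i < m) visits n (iter i g x) = \sum_(j < n) visits m (iter j g x))%N.
Proof.
rewrite exchange_big; apply: eq_bigr => i _; apply: eq_bigr => j _.
by rewrite -!iterD addnC.
Qed.

(** The hypothesis on visits is the balance property of Sturmian sequences, together with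
the fact that one of the two points is ahead at all times. The latter makes products of
visit counts affine in visit counts, so that every finite-range observable reduces to
them. *)
Lemma balanced_bounded_discrepancy k (f : X -> R) :
  code_determined g s Y k f -> bounded_discrepancy g Y f.
Proof.
move=> /visit_affine_code_determined[c [l H]].
exists (\sum_(e <- l) `|e.1| * e.2%:R) => x y n Yx Yy.
have sumE z : Y z -> birkhoff_sum g f n z = c *+ n +
    \sum_(e <- l) e.1 * (\sum_(j < e.2) visits n (iter j g z))%:R.
  move=> Yz; rewrite /birkhoff_sum (eq_bigr _ (fun (i : 'I_n) _ => H _ (iter_invariant Yg i Yz))).
  rewrite big_split /= sumr_const card_ord; congr (_ + _).
  rewrite exchange_big /=; apply: eq_bigr => e _.
  by rewrite -mulr_sumr -natr_sum visits_sum.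
rewrite !sumE // opprD addrACA subrr add0r -sumrB (le_trans (ler_norm_sum _ _ _)) //.
apply: ler_sum => e _; rewrite -mulrBr normrM ler_wpM2l //.
rewrite !natr_sum -sumrB (le_trans (ler_norm_sum _ _ _)) //.
have -> : e.2%:R = \sum_(i < e.2) 1 :> R by rewrite sumr_const card_ord.
apply: ler_sum => j _; have Yj := iter_invariant Yg j.
have h1 := visits_le1 n (Yj _ Yx) (Yj _ Yy).
have h2 := visits_le1 n (Yj _ Yy) (Yj _ Yx).
by rewrite ler_norml; move: h1 h2; rewrite -!(ler_nat R) -!natr1 => h1 h2; lra.
Qed.

End Balanced.

Section InducedMap.
Context {R : realType} {X : choiceType} {A : eqType}.
Variables (T : X -> X) (code : X -> A) (Z Y : set X) (s : X -> bool)
  (tau : bool -> nat) (J : nat).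

Definition induced_map x := iter (tau (s x)) T x.
Local Notation g := induced_map.

Hypothesis ZT : forall x, Z x -> Z (T x).
Hypothesis YZ : Y `<=` Z.
Hypothesis Yg : forall x, Y x -> Y (g x).
Hypothesis tauJ : forall b, (0 < tau b <= J)%N.
Hypothesis Zenter : forall x, Z x -> exists2 j, (j <= J)%N & Y (iter j T x).
Hypothesis Ycode : forall x y, Y x -> Y y -> s x = s y ->
  same_codes T code (tau (s x)) x y.
Hypothesis Yvisits : forall x y, Y x -> Y y ->
  (forall n, visits g s n x <= visits g s n y <= (visits g s n x).+1)%N \/
  (forall n, visits g s n y <= visits g s n x <= (visits g s n y).+1)%N.

Let time n x : nat := \sum_(i < n) tau (s (iter i g x)).

Let timeS n x : time n.+1 x = (tau (s x) + time n (g x))%N.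
Proof.
rewrite /time big_ord_recl /=; congr (_ + _)%N.
by apply: eq_bigr => i _; rewrite -iterSr.
Qed.

Let time_ge n x : (n <= time n x)%N.
Proof.
elim: n x => [|n IH] x //; rewrite timeS -add1n leq_add //.
by have /andP[] := tauJ (s x).
Qed.

Let time_codes n x y : Y x -> Y y -> same_codes g s n x y ->
  same_codes T code (time n x) x y.
Proof.
elim: n x y => [|n IH] x y Yx Yy xy; first by rewrite /time big_ord0 => i.
have sxy : s x = s y by apply: (xy 0).
rewrite timeS => i; case: (ltnP i (tau (s x))) => [lt _|le lt].
  exact: (Ycode Yx Yy).
have -> : i = (i - tau (s x) + tau (s x))%N by rewrite subnK.
rewrite !iterD [X in _ = code (iter _ T (iter (tau X) T y))]sxy.
apply: (IH (g x) (g y)); [exact: Yg|exact: Yg| |].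
  by move=> j jn; rewrite -!iterSr; apply: xy.
by rewrite ltn_subLR.
Qed.

Let birkhoff_time (f : X -> R) n x :
  birkhoff_sum T f (time n x) x =
  birkhoff_sum g (fun y => birkhoff_sum T f (tau (s y)) y) n x.
Proof.
elim: n x => [|n IH] x; first by rewrite /time big_ord0 !birkhoff_sum0.
by rewrite timeS birkhoff_sumD birkhoff_sumS IH.
Qed.

Let birkhoff_dist (f : X -> R) (M : R) x n m : (forall y, Z y -> `|f y| <= M) -> Z x ->
  `|birkhoff_sum T f n x - birkhoff_sum T f m x| <= M * `|n%:R - m%:R|.
Proof.
move=> fM Zx; wlog nm : n m / (n <= m)%N.
  move=> H; case: (leqP n m) => [|/ltnW] /H //.
  by rewrite distrC [X in M * X]distrC.
rewrite -{1}(subnKC nm) birkhoff_sumD opprD addNKr normrN.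
rewrite [X in M * X]distrC -natrB // [`|_%:R|]ger0_norm ?ler0n //.
by apply: (birkhoff_sum_le _ ZT fM); apply: iter_invariant.
Qed.

(** The return time depends on the symbol only, so it has bounded discrepancy itself: after
the same number of returns the clocks of two points differ by a bounded amount, and sums
over whole excursions can be compared. *)
Lemma induced_bounded_discrepancy k (M : R) (f : X -> R) :
  (forall x, Z x -> `|f x| <= M) -> code_determined T code Z k f ->
  bounded_discrepancy T Z f.
Proof.
move=> fM fk.
have BDg := @balanced_bounded_discrepancy R X g s Y Yg Yvisits.
pose Phi y : R := birkhoff_sum T f (tau (s y)) y.
have PhiP : code_determined g s Y k.+1 Phi.
  move=> x y Yx Yy xy; have sxy : s x = s y by apply: (xy 0).
  rewrite /Phi -sxy /birkhoff_sum; apply: eq_bigr => i _.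
  apply: fk; [exact/(iter_invariant ZT)/YZ|exact/(iter_invariant ZT)/YZ|].
  apply: same_codes_iter; apply: same_codes_sub (time_codes Yx Yy xy).
  rewrite timeS leq_add //; first exact: ltnW.
have [CPhi HPhi] := BDg _ _ PhiP.
have tauP : code_determined g s Y 1 (fun y => (tau (s y))%:R : R).
  by move=> x y _ _ xy; have -> : s x = s y by apply: (xy 0).
have [Ct Ht] := BDg _ _ tauP.
have M0 z : Z z -> 0 <= M by move=> Zz; apply: le_trans (fM _ Zz).
have timeE n z : (time n z)%:R = birkhoff_sum g (fun y => (tau (s y))%:R : R) n z.
  by rewrite /time natr_sum.
have HY x y n : Y x -> Y y ->
    `|birkhoff_sum T f n x - birkhoff_sum T f n y| <= CPhi + M * (J%:R + (J%:R + Ct)).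
  move=> Yx Yy.
  have [m m1 m2] : exists2 m, (time m x <= n)%N & (n <= time m x + J)%N.
    elim: n => [|n [m m1 m2]]; first by exists 0; rewrite /time big_ord0.
    have tm1 : time m.+1 x = (time m x + tau (s (iter m g x)))%N.
      by rewrite /time big_ord_recr.
    have /andP[t0 tJ] := tauJ (s (iter m g x)).
    case: (leqP (time m.+1 x) n.+1) => h; [exists m.+1 => //; lia|exists m; lia].
  have d1 := birkhoff_dist n (time m x) fM (YZ Yx).
  have d2 := birkhoff_dist (time m y) n fM (YZ Yy).
  have d3 := HPhi _ _ m Yx Yy; rewrite -!birkhoff_time in d3.
  have d4 := Ht _ _ m Yx Yy; rewrite -!timeE in d4.
  have e1 : `|n%:R - (time m x)%:R| <= J%:R :> R.
    by rewrite -natrB // ger0_norm ?ler0n // ler_nat leq_subLR.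
  have e2 : `|(time m y)%:R - n%:R| <= J%:R + Ct.
    rewrite -(subrKA (time m x)%:R) addrC (le_trans (ler_normD _ _)) //.
    by rewrite lerD // distrC.
  have {}M0 := M0 _ (YZ Yx).
  have {}d1 := le_trans d1 (ler_wpM2l M0 e1).
  have {}d2 := le_trans d2 (ler_wpM2l M0 e2).
  move: d1 d2 d3; rewrite mulrDr !ler_norml; lra.
exists (CPhi + M * (J%:R + (J%:R + Ct)) + 4 * (M * J%:R)) => x y n Zx Zy.
have {}M0 := M0 _ Zx.
have key z : Z z -> exists2 z', Y z' &
    `|birkhoff_sum T f n z - birkhoff_sum T f n z'| <= 2 * (M * J%:R).
  move=> Zz; have [j jJ Yj] := Zenter Zz; exists (iter j T z) => //.
  have Sj u : Z u -> `|birkhoff_sum T f j u| <= M * J%:R.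
    move=> Zu; apply: le_trans (birkhoff_sum_le _ ZT fM Zu) _.
    by rewrite ler_wpM2l // ler_nat.
  have e1 : birkhoff_sum T f n (iter j T z) =
      birkhoff_sum T f (n + j) z - birkhoff_sum T f j z.
    by rewrite addnC birkhoff_sumD; ring.
  rewrite e1 birkhoff_sumD; have := Sj _ Zz.
  have := Sj _ (iter_invariant ZT n Zz); rewrite !ler_norml; lra.
have [x' Yx' dx] := key _ Zx; have [y' Yy' dy] := key _ Zy.
by have := HY _ _ n Yx' Yy'; move: dx dy; rewrite !ler_norml; lra.
Qed.

End InducedMap.

(** * A random infinite word with prescribed frequencies *)

Section UnitInterval.
Context {R : realType}.

Definition unit_lebesgue : set (measurableTypeR R) -> \bar R :=
  mrestr lebesgue_measure (measurable_itv `[0%R, 1%R[).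

HB.instance Definition _ := Measure.copy unit_lebesgue
  (mrestr lebesgue_measure (measurable_itv `[0%R, 1%R[)).

Let unit_lebesgueT : unit_lebesgue setT = 1%E.
Proof.
rewrite /unit_lebesgue /mrestr setTI lebesgue_measure_itv /= lte_fin ltr01.
by rewrite oppr0 adde0.
Qed.

HB.instance Definition _ :=
  Measure_isProbability.Build _ _ _ unit_lebesgue unit_lebesgueT.

Lemma unit_lebesgue_itv (x y : R) : 0 <= x -> x <= y -> y <= 1 ->
  unit_lebesgue `[x, y[ = (y - x)%:E.
Proof.
move=> x0 xy y1; rewrite /unit_lebesgue /mrestr setIidl; last first.
  by move=> z /=; rewrite !in_itv /= => /andP[h1 h2]; apply/andP; split; lra.
rewrite lebesgue_measure_itv /= lte_fin; case: ltP => [//|yx].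
by have -> : x = y by [lra]; rewrite subrr.
Qed.

End UnitInterval.

Section TreeMeasure.
Context {R : realType} {m : nat}.
Variable F : seq 'I_m.+1 -> R.
Hypothesis F_ge0 : forall u, 0 <= F u.
Hypothesis F_nil : F [::] = 1.
Hypothesis F_split : forall u, F u = \sum_e F (rcons u e).

(** The left ends of the children of a cell, relative to the cell. They are locked because
simplification would otherwise expand the sums. *)
Let C_def u (j : nat) : R := \sum_(e < m.+1 | (e < j)%N) F (rcons u e).
Let C := locked C_def.
Let CE u j : C u j = C_def u j. Proof. by rewrite /C -lock. Qed.

Let C0 u : C u 0 = 0.
Proof. by rewrite CE /C_def big_pred0. Qed.

Let CS u (e : 'I_m.+1) : C u e.+1 = C u e + F (rcons u e).
Proof.
rewrite !CE /C_def (bigD1 e) ?ltnSn //= addrC; congr (_ + _).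
by apply: eq_bigl => i; rewrite ltnS [in RHS]ltn_neqAle andbC.
Qed.

Let C_last u : C u m.+1 = F u.
Proof. by rewrite F_split CE; apply: eq_bigl => e; rewrite ltn_ord. Qed.

Let C_ge0 u j : 0 <= C u j.
Proof. by rewrite CE; exact: sumr_ge0. Qed.

Let C_le u i j : (i <= j)%N -> C u i <= C u j.
Proof.
move=> ij; rewrite !CE /C_def [leRHS](bigID (fun e : 'I__ => (e < i)%N)) /=.
rewrite [X in _ <= X + _](eq_bigl (fun e : 'I__ => (e < i)%N)).
  by rewrite lerDl; apply: sumr_ge0.
by move=> e; rewrite andbC; case: ltnP => //= ei; apply: leq_trans ij.
Qed.

Let in_child u r (e : 'I_m.+1) := C u e <= r < C u e + F (rcons u e).

Let child u r : 'I_m.+1 := odflt ord0 [pick e | in_child u r e].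

Let in_child_ex u r : 0 <= r < F u -> exists e, in_child u r e.
Proof.
move=> /andP[r0 rF].
have ex : exists j, r < C u j by exists m.+1; rewrite C_last.
have [[|j] rj min] := ex_minnP ex; first by move: rj; rewrite C0 ltNge r0.
have jm : (j < m.+1)%N by apply: min; rewrite C_last.
exists (Ordinal jm); rewrite /in_child -CS rj andbT leNgt.
by apply/negP => /min; rewrite ltnn.
Qed.

Let in_child_uniq u r e e' : in_child u r e -> in_child u r e' -> e = e'.
Proof.
move=> /andP[h1 h2] /andP[h1' h2']; apply/val_inj/eqP => /=.
have lt_false i j : r < C u i.+1 -> C u j <= r -> (i < j)%N -> False.
  move=> h3 h4 /(C_le u) h5.
  by have := lt_le_trans h3 (le_trans h5 h4); rewrite ltxx.
rewrite -CS in h2; rewrite -CS in h2'.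
rewrite eqn_leq; apply/andP; split; rewrite leqNgt; apply/negP.
  exact: lt_false h2' h1.
exact: lt_false h2 h1'.
Qed.

Let childP u r : 0 <= r < F u -> in_child u r (child u r).
Proof.
move=> /in_child_ex[e He]; rewrite /child; case: pickP => //= H.
by have := H e; rewrite He.
Qed.

(** The parameters outside the unit interval form a null set; they follow the word of 0. *)
Let clamp (t : R) := if 0 <= t < 1 then t else 0.

Let step (st : seq 'I_m.+1 * R) :=
  let e := child st.1 st.2 in (rcons st.1 e, st.2 - C st.1 e).

Let state k t := iter k step ([::], clamp t).

Let path t k := child (state k t).1 (state k t).2.

Let stateE k t : (state k t).1 = mkseq (path t) k.
Proof.
by elim: k => [//|k IH]; rewrite mkseqS -IH.
Qed.

Let residue k t : 0 <= (state k t).2 < F (state k t).1.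
Proof.
elim: k => [|k IH].
  by rewrite /= F_nil /clamp; case: ifP => // _; rewrite lexx ltr01.
by have := childP IH; rewrite /in_child => /andP[h1 h2] /=; apply/andP; split; lra.
Qed.

Let left_end_def u : R := \sum_(j < size u) C (take j u) (nth ord0 u j).
Let left_end := locked left_end_def.
Let left_endE u : left_end u = left_end_def u. Proof. by rewrite /left_end -lock. Qed.

Let left_end_rcons u e : left_end (rcons u e) = left_end u + C u e.
Proof.
rewrite !left_endE /left_end_def size_rcons big_ord_recr /= nth_rcons ltnn eqxx.
rewrite -cats1 take_size_cat //; congr (_ + _); apply: eq_bigr => j _.
by rewrite nth_cat ltn_ord take_cat ltn_ord.
Qed.

Let state_eq k t u : size u = k ->
  ((state k t).1 == u) = (left_end u <= clamp t < left_end u + F u) /\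
  ((state k t).1 = u -> (state k t).2 = clamp t - left_end u).
Proof.
elim: k u => [|k IH] u.
  move/size0nil => ->; rewrite /= eqxx left_endE /left_end_def big_ord0 add0r F_nil subr0.
  split => //; rewrite /clamp; case: ifP => //.
  by rewrite lexx ltr01.
case/lastP: u => [//|u e]; rewrite size_rcons => -[sz].
have [eqI val] := IH u sz; rewrite left_end_rcons /= eqseq_rcons.
have /andP[FL1 FL2] : (0 <= C u e) && (C u e + F (rcons u e) <= F u).
  by rewrite C_ge0 -CS -C_last C_le.
case: eqP eqI => [Eu|nEu] eqI; last first.
  split; last by move=> /rcons_inj[/nEu].
  by apply/esym/negbTE; apply/negP => /andP[h1 h2]; move/negbT/negP: (esym eqI);
    apply; apply/andP; split; lra.
have vE := val Eu; rewrite /= Eu vE; split; last by move=> /rcons_inj[<-]; lra.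
have r := residue k t; rewrite Eu vE in r; have ch := childP r.
apply/idP/idP => [/eqP <-|h]; first by move: ch => /andP[h1 h2]; apply/andP; split; lra.
apply/eqP; apply: (in_child_uniq ch); move: h => /andP[h1 h2].
by apply/andP; split; lra.
Qed.

Let left_end_bound u : 0 <= left_end u /\ left_end u + F u <= 1.
Proof.
elim/last_ind: u => [|u e [IH1 IH2]]; first by rewrite left_endE /left_end_def big_ord0 F_nil add0r.
rewrite left_end_rcons; split; first by rewrite addr_ge0.
by rewrite -addrA -CS; apply: le_trans IH2; rewrite lerD2l -C_last C_le.
Qed.

(** The unit interval is cut into cells of lengths [F [:: e]], each of them again into
cells of lengths [F [:: e; e']], and so on; a parameter follows the cells that contain it.
Cells are half-open, so an empty cell is never entered and all the prefixes that occur
have positive weight. *)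
Lemma tree_measure : exists path : measurableTypeR R -> nat -> 'I_m.+1,
  [/\ forall u, measurable [set t | mkseq (path t) (size u) = u],
      forall u, unit_lebesgue [set t | mkseq (path t) (size u) = u] = (F u)%:E &
      forall t k, 0 < F (mkseq (path t) k)].
Proof.
pose J u : set (measurableTypeR R) := `[left_end u, left_end u + F u[%classic.
pose D : set (measurableTypeR R) := `[0%R, 1%R[%classic.
have setE u : [set t | mkseq (path t) (size u) = u] = clamp @^-1` J u.
  apply/seteqP; split => t; rewrite /J /= -stateE in_itv /=.
    by move/eqP; rewrite (state_eq t (erefl (size u))).1.
  by rewrite -(state_eq t (erefl (size u))).1 => /eqP.
have JD u : J u `<=` D.
  move=> t; rewrite /J /D /= !in_itv /= => /andP[h1 h2].
  by have [h3 h4] := left_end_bound u; apply/andP; split; lra.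
have clampJ u : clamp @^-1` J u `&` D = J u.
  apply/seteqP; split => t; rewrite /D /= /clamp.
    by move=> [h]; rewrite in_itv /= => t01; rewrite t01 in h.
  by move=> tJ; have := JD _ _ tJ; rewrite /D /= in_itv /= => t01; rewrite t01.
have mJ u : measurable (J u) by exact: measurable_itv.
have mD : measurable D by exact: measurable_itv.
exists path; split.
- move=> u; rewrite setE -(setIT (_ @^-1` _)) -(setUv D) setIUr clampJ.
  apply: measurableU => //; have [h|h] := pselect (J u 0).
    rewrite setIidr; first exact: measurableC.
    by move=> t; rewrite /D /= in_itv /= /clamp => /negP/negbTE ->.
  rewrite [X in measurable X](_ : _ = set0) //; apply/seteqP; split => t //=.
  by move=> [+ /negP/negbTE]; rewrite /D /= in_itv /= /clamp => + t0; rewrite t0.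
- move=> u; rewrite setE; have [h1 h2] := left_end_bound u.
  rewrite [LHS](_ : _ = unit_lebesgue (J u)).
    rewrite unit_lebesgue_itv ?lerDl //.
    by rewrite addrAC subrr add0r.
  rewrite /unit_lebesgue /mrestr; congr lebesgue_measure.
  by rewrite clampJ setIidl //; exact: JD.
- by move=> t k; rewrite -stateE; have /andP[h1 h2] := residue k t; lra.
Qed.

End TreeMeasure.

(** * Means, and words read from their centre *)

Lemma between_sequences (R : realType) (u v : nat -> R) :
  (forall n m, u n <= v m) -> exists L, forall n, u n <= L <= v n.
Proof.
move=> uv; exists (sup (range u)) => n; apply/andP; split.
  apply: ub_le_sup; last by exists n.
  by exists (v 0) => _ [m _ <-].
by apply: ge_sup => [|_ [m _ <-] //]; exists (u 0), 0.
Qed.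

Definition is_mean (R : realType) (X : choiceType) (T : X -> X) (Z : set X)
    (f : X -> R) (L : R) : Prop :=
  exists C : R, forall x n, Z x -> `|birkhoff_sum T f n x - n%:R * L| <= C.

Section Means.
Context {R : realType} {X : choiceType}.
Variables (T : X -> X) (Z : set X).
Implicit Types (f h : X -> R).
Hypothesis ZT : forall x, Z x -> Z (T x).
Hypothesis Z_neq0 : Z !=set0.
Local Notation is_mean := (is_mean T Z).

Lemma is_mean_ext f h L : (forall x, Z x -> f x = h x) -> is_mean f L -> is_mean h L.
Proof.
move=> fh [C HC]; exists C => x n Zx; have := HC x n Zx.
rewrite /birkhoff_sum (eq_bigr (fun i : 'I_n => h (iter i T x))) // => i _.
by rewrite fh //; exact: (iter_invariant ZT).
Qed.

Lemma is_meanD f h L M : is_mean f L -> is_mean h M ->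
  is_mean (fun x => f x + h x) (L + M).
Proof.
move=> [C HC] [D HD]; exists (C + D) => x n Zx.
rewrite /birkhoff_sum big_split /= mulrDr opprD addrACA (le_trans (ler_normD _ _)) //.
by apply: lerD; [exact: HC|exact: HD].
Qed.

Lemma is_mean_sum (I : Type) (r : seq I) (P : pred I) (f : I -> X -> R) (L : I -> R) :
  (forall i, P i -> is_mean (f i) (L i)) ->
  is_mean (fun x => \sum_(i <- r | P i) f i x) (\sum_(i <- r | P i) L i).
Proof.
move=> fL; elim: r => [|i r IH].
  exists 0 => x n _; rewrite !big_nil mulr0 subr0 /birkhoff_sum big1 ?normr0 // => j _.
  by rewrite big_nil.
rewrite big_cons; case: ifP => Pi.
  apply: is_mean_ext (is_meanD (fL i Pi) IH) => x _.
  by rewrite big_cons Pi.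
by apply: is_mean_ext IH => x _; rewrite big_cons Pi.
Qed.

Lemma is_mean_shift f L : is_mean f L -> is_mean (f \o T) L.
Proof.
move=> [C HC]; exists C => x n Zx; have := HC (T x) n (ZT Zx).
rewrite /birkhoff_sum (eq_bigr (fun i : 'I_n => (f \o T) (iter i T x))) // => i _.
by rewrite /= -iterS iterSr.
Qed.

Lemma is_mean_cst (c : R) : is_mean (fun=> c) c.
Proof.
exists 0 => x n _; rewrite /birkhoff_sum sumr_const card_ord.
by rewrite mulr_natl subrr normr0.
Qed.

Lemma is_mean_le f h L M : (forall x, Z x -> f x <= h x) ->
  is_mean f L -> is_mean h M -> L <= M.
Proof.
move=> fh [C HC] [D HD]; have [x Zx] := Z_neq0; rewrite leNgt; apply/negP => ML.
have d0 : 0 < L - M by rewrite subr_gt0.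
have [n] := natr_above ((C + D + 1) / (L - M)); rewrite ler_pdivrMr // => nC.
have Sfh : birkhoff_sum T f n x <= birkhoff_sum T h n x.
  by apply: ler_sum => i _; apply: fh; exact: (iter_invariant ZT).
by have := HC x n Zx; have := HD x n Zx; rewrite !ler_norml; lra.
Qed.

Lemma is_mean_uniq f L M : is_mean f L -> is_mean f M -> L = M.
Proof.
by move=> fL fM; apply/le_anti/andP; split; apply: (is_mean_le (f := f) (h := f)).
Qed.

(** Up to a bounded error, Birkhoff sums of a function of bounded discrepancy are
additive in the number of steps, hence proportional to it. *)
Lemma bounded_discrepancy_mean f : bounded_discrepancy T Z f -> exists L, is_mean f L.
Proof.
move=> [C HC]; have [x0 Zx0] := Z_neq0.
pose a n := birkhoff_sum T f n x0.
have C0 : 0 <= C by apply: le_trans (HC x0 x0 0 Zx0 Zx0); rewrite normr_ge0.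
have aM n m : `|a (n * m)%N - n%:R * a m| <= n%:R * C.
  elim: n => [|n IH]; first by rewrite mul0n !mul0r subr0 /a birkhoff_sum0 normr0.
  rewrite mulSn addnC /a birkhoff_sumD -natr1 !mulrDl !mul1r addrC opprD addrACA addrC.
  rewrite -!/(a _) [X in X <= _](_ : _ = `|(a (n * m)%N - n%:R * a m) +
     (birkhoff_sum T f m (iter (n * m) T x0) - a m)|); last by congr `|_|; ring.
  apply: le_trans (ler_normD _ _) _; apply: lerD => //.
  by apply: HC => //; exact: (iter_invariant ZT).
have [L HL] : exists L, forall n, (a n.+1 - C) / n.+1%:R <= L <= (a n.+1 + C) / n.+1%:R.
  apply: between_sequences => n m.
  rewrite ler_pdivrMr ?ltr0n // mulrAC ler_pdivlMr ?ltr0n //.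
  have := aM m.+1 n.+1; have := aM n.+1 m.+1; rewrite mulnC !ler_norml.
  by move=> /andP[h1 h2] /andP[h3 h4]; lra.
exists L, (C + C) => x n Zx.
have aL : `|a n - n%:R * L| <= C.
  case: n => [|n]; first by rewrite /a birkhoff_sum0 mul0r subr0 normr0.
  have := HL n; rewrite ler_pdivrMr ?ltr0n // ler_pdivlMr ?ltr0n // => /andP[h1 h2].
  by rewrite ler_norml; apply/andP; split; lra.
have := HC x x0 n Zx Zx0; rewrite -/(a n); move: aL; rewrite !ler_norml; lra.
Qed.

Lemma is_mean_gt0 f L N x : is_mean f L -> 0 < L -> Z x ->
  exists2 n, (N <= n)%N & f (iter n T x) != 0.
Proof.
move=> fL L0 Zx; apply: contrapT => H.
have Hf n : (N <= n)%N -> f (iter n T x) = 0.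
  by move=> Nn; apply/eqP/negPn/negP => fn; apply: H; exists n.
have [C HC] := fL.
have [n] := natr_above ((C + 1) / L); rewrite ler_pdivrMr // => nC.
have := HC (iter N T x) n (iter_invariant ZT N Zx).
rewrite /birkhoff_sum big1 ?sub0r ?normrN; last first.
  by move=> i _; rewrite -iterD Hf // leq_addl.
by rewrite ler_norml; lra.
Qed.

End Means.

Section Words.
Context {X : choiceType} {m : nat}.
Variables (T : X -> X) (code : X -> 'I_m.+1).

(** The codes of the times [0, ..., n - 1], listed from the middle outwards, with new
letters put alternately before and after the block. With this order an infinite word
describes a two-sided sequence of codes. *)
Fixpoint central_word n x : seq 'I_m.+1 :=
  if n is n'.+1 then
    if odd n' then rcons (central_word n' (T x)) (code x)
    else rcons (central_word n' x) (code (iter n' T x))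
  else [::].

Lemma size_central_word n x : size (central_word n x) = n.
Proof. by elim: n x => //= n IH x; case: ifP => _; rewrite size_rcons IH. Qed.

Lemma central_word_same_codes n x y :
  central_word n x = central_word n y <-> same_codes T code n x y.
Proof.
elim: n x y => [|n IH] x y /=; first by split => // _ i.
case: ifP => _; split.
- move=> /rcons_inj[/IH h c] [|i] //; rewrite ltnS => lt.
  by rewrite !iterSr; exact: h.
- move=> h; congr rcons; last exact: (h 0).
  by apply/IH => i ilt; rewrite -!iterSr; apply: h.
- by move=> /rcons_inj[/IH h c]; exact: same_codesS.
- move=> h; congr rcons; last exact: (h n).
  by apply/IH; apply: same_codes_sub h.
Qed.

(** A prefix is the same reading for a later point of the orbit. Means do not see this
delay, so the frequencies of words are consistent under prolongation. *)
Lemma take_central_word n k x :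
  take n (central_word (n + k) x) =
  central_word n (iter ((n + k)./2 - n./2) T x).
Proof.
elim: k x => [|k IH] x.
  by rewrite addn0 subnn take_oversize // size_central_word.
rewrite addnS /= uphalf_half.
have nk : (n./2 <= (n + k)./2)%N by apply: half_leq; rewrite leq_addr.
have k0 : (n < n + k)%N = false -> k = 0%N by lia.
case: ifP => h; rewrite -cats1 take_cat size_central_word; case: ltnP => nk0.
- by rewrite IH -iterSr -addnBA.
- rewrite k0 ?ltnNge ?nk0 // addn0 subnn take0 cats0 -addnBA // subnn.
  by [].
- by rewrite IH.
- by rewrite k0 ?ltnNge ?nk0 // addn0 subnn take0 cats0 subnn.
Qed.

End Words.

Section WordLaw.
Context {R : realType} {X : choiceType} {m : nat}.
Variables (T : X -> X) (Z : set X) (code : X -> 'I_m.+1).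
Hypothesis ZT : forall x, Z x -> Z (T x).
Hypothesis Z_neq0 : Z !=set0.
Hypothesis BD : forall k (M : R) (f : X -> R), (forall x, Z x -> `|f x| <= M) ->
  code_determined T code Z k f -> bounded_discrepancy T Z f.
Local Notation word := (central_word T code).

Let is_word u x : R := (word (size u) x == u)%:R.

Let word_freq u := xget 0 [set L | is_mean T Z (is_word u) L].

Lemma code_determined_mean k (M : R) (f : X -> R) : (forall x, Z x -> `|f x| <= M) ->
  code_determined T code Z k f -> exists L, is_mean T Z f L.
Proof. by move=> fM fk; apply: bounded_discrepancy_mean (BD fM fk). Qed.

Let word_freqP u : is_mean T Z (is_word u) (word_freq u).
Proof.
apply: (@xgetPex _ 0 [set L | is_mean T Z (is_word u) L]).
apply: (@code_determined_mean (size u) 1).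
  by move=> x _; rewrite /is_word normr_nat lern1 leq_b1.
by move=> x y Zx Zy xy; rewrite /is_word; have /central_word_same_codes -> := xy.
Qed.

Let word_freq_ge0 u : 0 <= word_freq u.
Proof.
apply: (is_mean_le ZT Z_neq0 (f := fun=> 0)) (is_mean_cst T Z 0) (word_freqP u).
by move=> x _; exact: ler0n.
Qed.

Let word_freq_nil : word_freq [::] = 1.
Proof.
apply: (is_mean_uniq ZT Z_neq0 (word_freqP [::])).
by apply: (is_mean_ext ZT (f := fun=> 1)) => //; exact: is_mean_cst.
Qed.

Let word_freq_split u : word_freq u = \sum_e word_freq (rcons u e).
Proof.
have sumE x : \sum_e is_word (rcons u e) x =
    is_word u (if odd (size u) then T x else x).
  rewrite /is_word (eq_bigr (fun e => (word (size u).+1 x == rcons u e)%:R)) /=;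
    last by move=> e _; rewrite size_rcons.
  set w := word _ (if _ then _ else _).
  have [c wE] : exists c, (if odd (size u) then rcons (word (size u) (T x)) (code x)
      else rcons (word (size u) x) (code (iter (size u) T x))) = rcons w c.
    by rewrite /w; case: ifP => _; eexists.
  rewrite wE (bigD1 c) //= eqseq_rcons eqxx andbT big1 ?addr0 // => e ec.
  by rewrite eqseq_rcons [c == e]eq_sym (negbTE ec) andbF.
have meanS : is_mean T Z (fun x => \sum_e is_word (rcons u e) x)
    (\sum_e word_freq (rcons u e)).
  by apply: is_mean_sum => // e _; exact: word_freqP.
apply: (is_mean_uniq ZT Z_neq0 _ meanS).
have [ou|eu] := boolP (odd (size u)).
  apply: (is_mean_ext ZT _ (is_mean_shift ZT (word_freqP u))) => x _.
  by rewrite sumE ou.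
by apply: (is_mean_ext ZT _ (word_freqP u)) => x _; rewrite sumE (negbTE eu).
Qed.

(** The frequencies of central words do not depend on the orbit; the word drawn from them
has, at each length, the law of the words seen along every orbit. A word of positive
frequency recurs, hence the last property. *)
Lemma word_law : exists path : measurableTypeR R -> nat -> 'I_m.+1,
  [/\ forall n (S : seq 'I_m.+1 -> Prop), measurable [set t | S (mkseq (path t) n)],
      forall n (S S' : seq 'I_m.+1 -> Prop) n' j,
        (forall x, Z x -> S (word n x) <-> S' (word n' (iter j T x))) ->
        unit_lebesgue [set t | S (mkseq (path t) n)] =
        unit_lebesgue [set t | S' (mkseq (path t) n')] &
      forall t n N x, Z x -> exists2 i, (N <= i)%N & word n (iter i T x) = mkseq (path t) n].
Proof.
have [path [mpath lpath ppath]] := tree_measure word_freq_ge0 word_freq_nil word_freq_split.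
pose words n (S : seq 'I_m.+1 -> Prop) :=
  [seq u : n.-tuple _ <- index_enum (n.-tuple 'I_m.+1) | `[< S (tval u) >]].
have setE n S : [set t | S (mkseq (path t) n)] =
    \bigcup_(u in [set` words n S]) [set t | mkseq (path t) (size u) = u].
  apply/seteqP; split => t /=.
    move=> St; have sz : size (mkseq (path t) n) == n by rewrite size_mkseq.
    exists (Tuple sz); last by rewrite /= size_mkseq.
    by rewrite /= mem_filter mem_index_enum andbT; apply/asboolP.
  move=> [u]; rewrite /= mem_filter => /andP[/asboolP Su _].
  by rewrite size_tuple => ->.
have mset n S : measurable [set t | S (mkseq (path t) n)].
  rewrite setE; apply: fin_bigcup_measurable; first exact: finite_seq.
  by move=> u _; exact: mpath.
have mean_law n S : is_mean T Z (fun x => `[< S (word n x) >]%:R)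
    (fine (unit_lebesgue [set t | S (mkseq (path t) n)])).
  have -> : unit_lebesgue [set t | S (mkseq (path t) n)] =
      (\sum_(u : n.-tuple 'I_m.+1 | `[< S u >]) word_freq u)%:E.
    rewrite setE measure_fin_bigcup //=; last first.
    - move=> u v Du Dv [t [/= hu hv]]; apply/val_inj => /=.
      by rewrite -hu -hv !size_tuple.
    rewrite -fsbig_seq ?filter_uniq ?index_enum_uniq // big_filter.
    by rewrite -sumEFin; apply: eq_bigr => u _; exact: lpath.
  rewrite [fine _]/=; apply: (is_mean_ext ZT _ (is_mean_sum ZT (index_enum (n.-tuple 'I_m.+1))
    (P := fun u => `[< S (tval u) >]) (fun u _ => word_freqP u))).
  move=> x Zx; have sz : size (word n x) == n by rewrite size_central_word.
  pose w := Tuple sz; have isw (u : n.-tuple _) : is_word u x = (w == u)%:R.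
    by rewrite /is_word size_tuple.
  case: asboolP => Sw.
    rewrite (bigD1 w); last exact/asboolP.
    rewrite isw eqxx big1 => [|u /andP[_ uw]]; first exact: addr0.
    by rewrite isw eq_sym (negbTE uw).
  rewrite big1 // => u /asboolP Su; rewrite isw; case: eqP => // wu.
  by exfalso; apply: Sw; rewrite -[word n x]/(val w) wu.
exists path; split => //.
- move=> n S S' n' j SS'.
  have fin A : measurable A -> unit_lebesgue A \is a fin_num.
    by move=> mA; exact: fin_num_measure.
  rewrite -[LHS]fineK ?fin // -[RHS]fineK ?fin //; congr (_%:E).
  apply: (is_mean_uniq ZT Z_neq0 (mean_law n S)).
  have mj : is_mean T Z ((fun x => `[< S' (word n' x) >]%:R) \o iter j T)
      (fine (unit_lebesgue [set t | S' (mkseq (path t) n')])).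
    elim: j {SS'} => [|j IH]; first exact: mean_law.
    apply: (is_mean_ext ZT _ (is_mean_shift ZT IH)) => x _ /=.
    by rewrite -iterSr.
  apply: (is_mean_ext ZT _ mj) => x Zx /=.
  by rewrite (asbool_equiv_eq (SS' x Zx)).
- move=> t n N x Zx.
  have [i Ni ne0] := is_mean_gt0 ZT N (word_freqP _) (ppath t n) Zx.
  exists i => //; move: ne0; rewrite /is_word size_mkseq.
  by case: (word n _ =P _) => // _; rewrite eqxx.
Qed.

End WordLaw.

(** * From codes to orbits *)

Lemma plane_norm_le (R : realType) (p : R * R) (e : R) :
  (`|p| <= e) = (`|p.1| <= e) && (`|p.2| <= e).
Proof. by rewrite prod_normE ge_max. Qed.

Lemma plane_norm_lt (R : realType) (p : R * R) (e : R) :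
  (`|p| < e) = (`|p.1| < e) && (`|p.2| < e).
Proof. by rewrite prod_normE gt_max. Qed.

Lemma plane_ballE (R : realType) (p : R * R) (e : R) q :
  ball p e q <-> `|p - q| < e.
Proof. by rewrite -ball_normE. Qed.

Lemma expr_lt_eventually (R : realType) (kappa C e : R) : 0 <= kappa < 1 -> 0 < e ->
  exists N, forall n, (N <= n)%N -> kappa ^+ n * C < e.
Proof.
move=> /andP[k0 k1] e0; have : (fun n => kappa ^+ n * C) @ \oo --> 0 * C.
  by apply: cvgMl; apply: cvg_expr; rewrite ger0_norm.
rewrite mul0r => /cvgrPdist_lt/(_ e e0)[N _ HN]; exists N => n Nn.
by have := HN n Nn; rewrite sub0r normrN => /(le_lt_trans (ler_norm _)).
Qed.

Section OrbitSpace.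
Context {R : realType}.
Local Notation orbit_space := (@orbit_space R).

Lemma orbit_space_eval_continuous i : continuous (fun s : orbit_space => s i).
Proof. by move=> s; exact: (@proj_continuous nat (fun=> (R * R)%type) i s). Qed.

Lemma orbit_space_nbhs (s : orbit_space) k (e : R) : 0 < e ->
  nbhs s [set s' : orbit_space | forall i, (i <= k)%N -> `|s i - s' i| < e].
Proof.
move=> e0; have near_i i : nbhs s [set s' : orbit_space | `|s i - s' i| < e].
  have := @orbit_space_eval_continuous i s _ (nbhsx_ballx (s i) e e0).
  move=> h; apply: (@filterS _ (nbhs s) _ _ _ _ h) => s'.
  by move/plane_ballE.
elim: k => [|k IH].
  by apply: filterS (near_i 0%N) => s' h i; rewrite leqn0 => /eqP ->.
apply: filterS (filterI IH (near_i k.+1)) => s' [h h'] i.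
by rewrite leq_eqVlt => /predU1P[->//|]; rewrite ltnS; exact: h.
Qed.

(** The topology of pointwise convergence only sees finitely many times. *)
Lemma orbit_space_openP (s : orbit_space) (U : set orbit_space) : open U -> U s ->
  exists k, exists2 e : R, 0 < e &
    forall s', (forall i, (i <= k)%N -> `|s i - s' i| <= e) -> U s'.
Proof.
move=> oU Us; apply: contrapT => H.
have {}H (k : nat) : exists s', (forall i, (i <= k)%N -> `|s i - s' i| <= k.+1%:R^-1) /\ ~ U s'.
  apply: contrapT => H'; apply: H; exists k, k.+1%:R^-1; first by rewrite invr_gt0.
  by move=> s' hs'; apply: contrapT => nU; apply: H'; exists s'.
have [a Ha] := choice H.
have : {ptws, a @ \oo --> s}.
  apply/pointwise_cvgP => i; suff : a k i @[k --> \oo] --> s i by [].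
  apply/(@cvgrPdist_lt _ (R * R)%type) => e e0.
  near=> k; have ik : (i <= k)%N by near: k; exists i.
  apply: le_lt_trans ((Ha k).1 i ik) _; near: k.
  exact: near_infty_natSinv_lt (PosNum e0).
move=> /(_ U); case; first exact: open_nbhs_nbhs.
by move=> N _ HN; apply: (Ha N).2; apply: HN => /=.
Unshelve. all: by end_near.
Qed.

Lemma shift_continuous : continuous (@shift R).
Proof.
move=> s U; rewrite nbhsE => -[V [oV Vs] VU].
have [k [e e0 H]] := orbit_space_openP oV Vs.
apply: filterS (orbit_space_nbhs s k.+1 e0) => s' h /=; apply/VU/H => i ik.
by apply/ltW/h; rewrite ltnS.
Qed.

Definition orbit_of (T : R * R -> R * R) x : orbit_space := fun k => iter k T x.

End OrbitSpace.

Section StationaryLaw.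
Context {R : realType} {m : nat}.
Local Notation plane := (R * R)%type.
Variables (T : plane -> plane) (Z : set plane) (code : plane -> 'I_m.+1) (kappa D : R).
Variable (x0 : plane).
Hypothesis ZT : forall x, Z x -> Z (T x).
Hypothesis Zx0 : Z x0.
Hypothesis BD : forall k (M : R) (f : plane -> R), (forall x, Z x -> `|f x| <= M) ->
  code_determined T code Z k f -> bounded_discrepancy T Z f.
Hypothesis kappa01 : 0 <= kappa < 1.
Hypothesis Z_bounded : forall x y, Z x -> Z y -> `|x - y| <= D.
Hypothesis contract : forall x y, Z x -> Z y -> code x = code y ->
  `|T x - T y| <= kappa * `|x - y|.
Local Notation word := (central_word T code).

Lemma same_codes_contract n x y : Z x -> Z y -> same_codes T code n x y ->
  `|iter n T x - iter n T y| <= kappa ^+ n * D.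
Proof.
move=> Zx Zy; elim: n => [|n IH] xy; first by rewrite expr0 mul1r; exact: Z_bounded.
rewrite /= exprS -mulrA; apply: le_trans (contract _ _ _) _.
- exact: (iter_invariant ZT).
- exact: (iter_invariant ZT).
- exact: xy.
- rewrite ler_wpM2l //; first by case/andP: kappa01.
  by apply: IH; apply: same_codes_sub xy.
Qed.

Let D_ge0 : 0 <= D.
Proof. by apply: le_trans (Z_bounded Zx0 Zx0); exact: normr_ge0. Qed.

Let kappa_le n k : (n <= k)%N -> kappa ^+ k * D <= kappa ^+ n * D.
Proof.
move=> nk; rewrite ler_wpM2r // ler_wiXn2l //; first by case/andP: kappa01.
by case/andP: kappa01 => _ /ltW.
Qed.

Let word_contract k i x y : Z x -> Z y -> (i <= k)%N ->
  word k.*2 x = word k.*2 y ->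
  `|iter (k + i) T x - iter (k + i) T y| <= kappa ^+ k * D.
Proof.
move=> Zx Zy ik /central_word_same_codes xy.
apply: le_trans (kappa_le (leq_addr i k)); apply: same_codes_contract => //.
by apply: same_codes_sub xy; rewrite -addnn leq_add2l.
Qed.

Let take_word k j x : take k.*2 (word (k + j).*2 x) = word k.*2 (iter j T x).
Proof. by rewrite doubleD take_central_word -doubleD !doubleK addKn. Qed.

(** A parameter of the unit interval prescribes a two-sided sequence of codes, all
of whose words occur along the orbit of [x0]; the points of that orbit at which longer and
longer central words are read converge, because [T] contracts. *)
Lemma coded_orbits : exists Psi : measurableTypeR R -> orbit_space,
  [/\ forall U, open U -> measurable (Psi @^-1` U),
      forall U, open U -> unit_lebesgue (Psi @^-1` U) =
        unit_lebesgue ((@shift R \o Psi) @^-1` U),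
      forall t, closure (orbit_of T @` Z) (Psi t) &
      forall t, cluster (orbit_of T x0 @ \oo) (Psi t 0)].
Proof.
have Z_neq0 : Z !=set0 by exists x0.
have [path [mpath path_eq path_occ]] := word_law ZT Z_neq0 BD.
pose w t k := mkseq (path t) k.*2.
have /choice[ctr Hctr] : forall tk, exists z,
    [/\ Z z, exists2 n, (tk.2 <= n)%N & z = iter n T x0 & word tk.2.*2 z = w tk.1 tk.2].
  move=> [t k]; have [n kn wE] := path_occ t k.*2 k x0 Zx0.
  exists (iter n T x0); split => //; first exact: (iter_invariant ZT).
  by exists n.
(* The orbit of [z t k] reads [k] letters before the centre of the two-sided sequence and
[k] letters after it: its point at time [k] approximates the start of the coded orbit. *)
pose z t k := ctr (t, k).
have Zz t k : Z (z t k) by have [] := Hctr (t, k).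
have zw t k : word k.*2 (z t k) = w t k by have [] := Hctr (t, k).
have w_take t k j : take k.*2 (w t (k + j)%N) = w t k.
  by rewrite /w /mkseq -map_take take_iota (minn_idPl _) // leq_double leq_addr.
have z_word t k j : word k.*2 (iter j T (z t (k + j)%N)) = w t k.
  by rewrite -take_word zw w_take.
have z_cauchy t k j i : (i <= k)%N ->
    `|iter (k + i) T (z t k) - iter (k + j + i) T (z t (k + j)%N)| <= kappa ^+ k * D.
  move=> ik; rewrite addnAC (iterD (k + i) j); apply: word_contract => //.
    exact: (iter_invariant ZT).
  by rewrite z_word zw.
have /choice[Psi HPsi] : forall t, exists s : orbit_space, forall k i, (i <= k)%N ->
    `|s i - iter (k + i) T (z t k)| <= kappa ^+ k * D.
  move=> t; pose y i k := iter (k + i) T (z t k).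
  have ycauchy i k k' : (i <= k)%N -> (k <= k')%N -> `|y i k - y i k'| <= kappa ^+ k * D.
    by move=> ik /subnKC <-; rewrite /y; exact: z_cauchy.
  have lim_ex (pr : plane -> R) : (forall p q, pr (p - q) = pr p - pr q) ->
      (forall p, `|pr p| <= `|p|) -> forall i, exists L, forall k,
      pr (y i (i + k)%N) - kappa ^+ (i + k) * D <= L <= pr (y i (i + k)%N) + kappa ^+ (i + k) * D.
    move=> prB prle i; apply: between_sequences => n n'.
    have key k k' : (k <= k')%N ->
        `|pr (y i (i + k)%N) - pr (y i (i + k')%N)| <= kappa ^+ (i + k) * D.
      move=> kk; rewrite -prB (le_trans (prle _)) // ycauchy ?leq_addr //.
      by rewrite leq_add2l.
    have pos k : 0 <= kappa ^+ (i + k) * D.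
      by rewrite mulr_ge0 // exprn_ge0 //; case/andP: kappa01.
    have := pos n; have := pos n'.
    by case: (leqP n n') => [|/ltnW] /key; rewrite ler_norml; lra.
  have fst_le (p : plane) : `|p.1| <= `|p|.
    by have := lexx `|p|; rewrite {1}plane_norm_le => /andP[].
  have snd_le (p : plane) : `|p.2| <= `|p|.
    by have := lexx `|p|; rewrite {1}plane_norm_le => /andP[].
  have /choice[L1 HL1] := lim_ex fst (fun _ _ => erefl) fst_le.
  have /choice[L2 HL2] := lim_ex snd (fun _ _ => erefl) snd_le.
  exists (fun i => (L1 i, L2 i)) => k i /subnKC <-; rewrite plane_norm_le /=.
  have := HL1 i (k - i)%N; have := HL2 i (k - i)%N; rewrite /y !ler_norml.
  by move=> /andP[h1 h2] /andP[h3 h4]; apply/andP; split; apply/andP; split; lra.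
(* Whether a coded orbit lies in an open set can be read from a finite central word. This
gives measurability, and invariance because frequencies are invariant. *)
pose good U k (u : seq 'I_m.+1) := forall x, Z x -> word k.*2 x = u ->
  forall s : orbit_space, (forall i, (i <= k)%N -> `|s i - iter (k + i) T x| <= kappa ^+ k * D) -> U s.
(* The same for the shifted orbit, with a word of half-length [k + 1]: its centre lies one
step further, and the shift adds one more step. *)
pose good1 U k (u : seq 'I_m.+1) := exists x,
  [/\ Z x, word k.+1.*2 x = u & good U k (word k.*2 (iter 2 T x))].
have goodS (U : set orbit_space) k x : Z x -> good U k (word k.*2 (T x)) -> good U k.+1 (word k.+1.*2 x).
  move=> Zx Gk x' Zx' xx' s hs; apply: (Gk (T x')); first exact: ZT.
    by have := take_word k 1%N; rewrite addn1 => tw; rewrite -!tw -xx'.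
  move=> i ik; rewrite -iterSr -addSn; apply: le_trans (kappa_le (leqnSn k)).
  by apply: hs; rewrite leqW.
have good_small U (s : orbit_space) : open U -> U s -> exists k0, forall k, (k0 <= k)%N ->
    forall x, Z x -> (forall i, (i <= k)%N -> `|s i - iter (k + i) T x| <= kappa ^+ k * D) ->
    good U k (word k.*2 x).
  move=> oU Us; have [k0 [e e0 He]] := orbit_space_openP oU Us.
  have [N HN] := expr_lt_eventually (3 * D) kappa01 e0.
  exists (maxn k0 N) => k; rewrite geq_max => /andP[k0k Nk] x Zx hx x' Zx' xx' s' hs'.
  apply: He => i ik0; have ik := leq_trans ik0 k0k.
  have d1 := hx i ik; have d2 := hs' i ik; have d3 := word_contract Zx' Zx ik xx'.
  apply/ltW/(le_lt_trans _ (HN k Nk)).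
  rewrite (_ : s i - s' i = (s i - iter (k + i) T x) - (s' i - iter (k + i) T x')
    - (iter (k + i) T x' - iter (k + i) T x)); last first.
    by rewrite !opprB [RHS]addrAC !subrKA.
  rewrite mulrCA (le_trans (ler_normB _ _)) // (_ : 3 = 1 + 1 + 1); last by ring.
  by rewrite !mulrDl !mul1r lerD // (le_trans (ler_normB _ _)) // lerD.
have PsiE U : open U -> Psi @^-1` U = \bigcup_k [set t | good U k (w t k)].
  move=> oU; apply/seteqP; split => t /=.
    move=> /(good_small _ _ oU)[k0 Hk0]; exists k0 => //=.
    by rewrite -zw; apply: Hk0 => // i ik; exact: HPsi.
  by move=> [k _ /= Gk]; apply: (Gk (z t k)) => // i ik; exact: HPsi.
have PsiE1 U : open U -> (@shift R \o Psi) @^-1` U = \bigcup_k [set t | good1 U k (w t k.+1)].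
  move=> oU; apply/seteqP; split => t /=.
    move=> /(good_small _ _ oU)[k0 Hk0]; exists k0 => //=.
    exists (z t k0.+1); split => //; apply: Hk0 => //.
      exact: (iter_invariant ZT).
    move=> i ik; rewrite -iterD (_ : (k0 + i + 2)%N = (k0.+1 + i.+1)%N); last by lia.
    exact: le_trans (HPsi _ _ _ _) (kappa_le (leqnSn k0)).
  move=> [k _ /= [x [Zx xw Gk]]]; apply: (Gk (iter 2 T (z t k.+1))).
  - exact: (iter_invariant ZT).
  - apply/central_word_same_codes/same_codes_iter.
    by rewrite add2n -doubleS; apply/central_word_same_codes; rewrite xw zw.
  - move=> i ik; rewrite -iterD (_ : (k + i + 2)%N = (k.+1 + i.+1)%N); last by lia.
    exact: le_trans (HPsi _ _ _ _) (kappa_le (leqnSn k)).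
exists Psi; split.
- by move=> U oU; rewrite PsiE //; apply: bigcup_measurable => k _; exact: mpath.
- move=> U oU; rewrite PsiE // PsiE1 //.
  have cvgU (F : nat -> set (measurableTypeR R)) : (forall k, measurable (F k)) ->
      (forall k, F k `<=` F k.+1) -> unit_lebesgue \o F @ \oo --> unit_lebesgue (\bigcup_k F k).
    move=> mF ndF; apply: nondecreasing_cvg_mu => //; first exact: bigcup_measurable.
    by apply/nondecreasing_seqP => k; apply/subsetPset.
  have m0 k : measurable [set t | good U k (w t k)] by exact: mpath.
  have m1 k : measurable [set t | good1 U k (w t k.+1)] by exact: mpath.
  have c0 := cvgU _ m0; have c1 := cvgU _ m1.
  have E : (unit_lebesgue \o fun k => [set t | good U k (w t k)]) =
      (unit_lebesgue \o fun k => [set t | good1 U k (w t k.+1)]).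
    apply/funext => k /=; apply/esym; apply: (path_eq _ (good1 U k) (good U k) _ 2) => x Zx.
    split; last by move=> G; exists x.
    move=> [x' [Zx' xx' G]]; rewrite (_ : word _ (iter 2 T x) = word k.*2 (iter 2 T x')) //.
    apply/central_word_same_codes/same_codes_iter.
    by rewrite add2n -doubleS; apply/central_word_same_codes.
  rewrite E in c0; apply: (cvg_unique _ (c0 _) (c1 _)) => //.
    move=> k t /= G; rewrite -zw; apply: goodS => //.
    by have := z_word t k 1%N; rewrite addn1 /= => ->.
  move=> k t /= [x [Zx xw G]]; exists (z t k.+2); split => //.
  apply: goodS; first exact: (iter_invariant ZT).
  rewrite (_ : word _ _ = word k.*2 (iter 2 T x)) //.
  rewrite -iterS iterSr; apply/central_word_same_codes/same_codes_iter.
  rewrite add2n -doubleS; apply/central_word_same_codes.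
  by rewrite xw; have := z_word t k.+1 1%N; rewrite addn1 /=.
- move=> t U; rewrite nbhsE => -[V [oV Vs] VU].
  have [k [e e0 He]] := orbit_space_openP oV Vs.
  have [N HN] := expr_lt_eventually D kappa01 e0.
  exists (orbit_of T (iter (k + N) T (z t (k + N)%N))); split.
    by exists (iter (k + N) T (z t (k + N)%N)) => //; exact: (iter_invariant ZT).
  apply/VU/He => i ik; rewrite /orbit_of -iterD addnC.
  apply: le_trans (HPsi _ _ _ _) _; first exact: leq_trans (leq_addr _ _).
  by apply/ltW/HN; exact: leq_addl.
- move=> t A B [n _ nA]; rewrite nbhs_ballP => -[e /= e0 eB].
  have [N HN] := expr_lt_eventually D kappa01 e0.
  have [_ [n' n'le ze] _] := Hctr (t, maxn n N).
  exists (iter (maxn n N) T (z t (maxn n N))); split.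
    rewrite /z ze -iterD; apply: nA => /=.
    by apply: leq_trans (leq_addr _ _); exact: leq_maxl.
  apply/eB/plane_ballE; apply: le_lt_trans (HN (maxn n N) (leq_maxr _ _)).
  by have := HPsi t (maxn n N) 0 (leq0n _); rewrite addn0.
Qed.

End StationaryLaw.

(** * Limit sets and uniform time averages *)

Section PlaneSequences.
Context {R : realType}.
Local Notation plane := (R * R)%type.

Lemma plane_clusterP (u : nat -> plane) p : cluster (u @ \oo) p <->
  forall e : R, 0 < e -> forall N, exists2 n, (N <= n)%N & `|p - u n| < e.
Proof.
split=> [H e e0 N|H A B [N _ NA]].
  have [_ [[n /= Nn <-] /plane_ballE]] :
      (u @` [set n | (N <= n)%N]) `&` ball p e !=set0.
    apply: H; last exact: nbhsx_ballx.
    by exists N => // n /= Nn; exists n.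
  by move=> h; exists n.
rewrite nbhs_ballP => -[e /= e0 eB]; have [n Nn h] := H e e0 N.
by exists (u n); split; [exact: NA|apply/eB/plane_ballE].
Qed.

Lemma cluster_closed (u : nat -> plane) : closed (cluster (u @ \oo)).
Proof. by rewrite clusterE; apply: closed_bigI => A _; exact: closed_closure. Qed.

Lemma cluster_sub_closed (u : nat -> plane) (C : set plane) N : closed C ->
  (forall n, (N <= n)%N -> C (u n)) -> cluster (u @ \oo) `<=` C.
Proof.
move=> /closure_id cC uC p; rewrite clusterE => /(_ C); rewrite -cC; apply.
by exists N => // n /= Nn; exact: uC.
Qed.

Lemma compact_approaches_cluster (u : nat -> plane) (C : set plane) : compact C ->
  (forall n, C (u n)) -> forall e : R, 0 < e ->
  \forall n \near \oo, exists2 p, cluster (u @ \oo) p & ball p e (u n).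
Proof.
move=> cC uC e e0; apply: contrapT => H.
have /choice[v Hv] : forall k, exists n, (k <= n)%N /\
    ~ exists2 p, cluster (u @ \oo) p & ball p e (u n).
  move=> k; apply: contrapT => H'; apply: H; exists k => // n /= kn.
  by apply: contrapT => nH; apply: H'; exists n.
have [p [_ clp]] : C `&` cluster ((u \o v) @ \oo) !=set0.
  by apply: cC; exists 0%N => // n _; exact: uC.
have {}clp := (plane_clusterP _ _).1 clp.
have Kp : cluster (u @ \oo) p.
  apply/plane_clusterP => e' e'0 N; have [n Nn h] := clp e' e'0 N.
  by exists (v n) => //; apply: leq_trans Nn (Hv n).1.
have [n _ h] := clp e e0 0%N; apply: (Hv n).2; exists p => //.
exact/plane_ballE.
Qed.

End PlaneSequences.

Definition uniform_mean (R : realType) (X : choiceType) (T : X -> X) (Z : set X)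
    (f : X -> R) (L : R) : Prop :=
  forall e : R, 0 < e -> exists N, forall n x, (N <= n)%N -> Z x ->
    `|birkhoff_sum T f n x - n%:R * L| <= e * n%:R.

Section TimeAverages.
Context {R : realType} {m : nat}.
Local Notation plane := (R * R)%type.
Variables (T : plane -> plane) (Z : set plane) (code : plane -> 'I_m.+1) (kappa D : R).
Hypothesis ZT : forall x, Z x -> Z (T x).
Hypothesis BD : forall k (M : R) (f : plane -> R), (forall x, Z x -> `|f x| <= M) ->
  code_determined T code Z k f -> bounded_discrepancy T Z f.
Hypothesis kappa01 : 0 <= kappa < 1.
Hypothesis Z_bounded : forall x y, Z x -> Z y -> `|x - y| <= D.
Hypothesis contract : forall x y, Z x -> Z y -> code x = code y ->
  `|T x - T y| <= kappa * `|x - y|.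

Let contractn := same_codes_contract ZT kappa01 Z_bounded contract.

(** Let [p] be a limit point of the orbit of [x]. The visits of an orbit to the set of
points with the same first codes as some point that comes close to [p] have bounded
discrepancy; they are infinite in number for [x], hence for [y], and by contraction [y]
comes close to [p] as well. *)
Lemma cluster_orbit_eq x y : Z x -> Z y ->
  cluster (orbit_of T x @ \oo) = cluster (orbit_of T y @ \oo).
Proof.
wlog suff H : x y / Z x -> Z y ->
    cluster (orbit_of T x @ \oo) `<=` cluster (orbit_of T y @ \oo).
  by move=> Zx Zy; apply/seteqP; split; exact: H.
move=> Zx Zy p /plane_clusterP clp; apply/plane_clusterP => e e0 N.
have e20 : 0 < e / 2 by rewrite divr_gt0.
have [k0 Hk0] := expr_lt_eventually D kappa01 e20; have {Hk0} := Hk0 _ (leqnn k0).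
set k := k0 => kD.
pose good v := exists2 v', Z v' /\ same_codes T code k v v' & `|p - iter k T v'| < e / 2.
pose f v : R := `[< good v >]%:R.
have fk : code_determined T code Z k f.
  move=> v w Zv Zw vw; congr (nat_of_bool _)%:R; apply: asbool_equiv_eq; split.
    move=> [v' [Zv' vv'] h]; exists v' => //; split => //.
    exact: same_codes_trans (same_codes_sym vw) vv'.
  move=> [v' [Zv' vv'] h]; exists v' => //; split => //.
  exact: same_codes_trans vw vv'.
have f01 v : 0 <= f v <= 1 by rewrite /f ler0n lern1 leq_b1.
have fM v : Z v -> `|f v| <= 1 by move=> _; have /andP[f0 f1] := f01 v; rewrite ger0_norm.
have [C HC] := BD fM fk.
have [n Nn fn] : exists2 n, (N <= n)%N & f (iter n T y) = 1.
  apply: contrapT => no.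
  have f0 n : (N <= n)%N -> f (iter n T y) = 0.
    move=> Nn; rewrite /f; case: asboolP => // gd.
    by exfalso; apply: no; exists n => //; rewrite /f; case: asboolP.
  have Sy n : birkhoff_sum T f n y <= N%:R.
    case: (leqP n N) => nN.
      have := birkhoff_sum_le n ZT fM Zy; rewrite mul1r => h.
      apply: le_trans (ler_norm _) (le_trans h _); by rewrite ler_nat.
    rewrite -(subnKC (ltnW nN)) birkhoff_sumD.
    rewrite [X in _ + X <= _](_ : _ = 0); last first.
      by rewrite /birkhoff_sum big1 // => i _; rewrite -iterD f0 // leq_addl.
    rewrite addr0; have := birkhoff_sum_le N ZT fM Zy; rewrite mul1r.
    exact: le_trans (ler_norm _).
  have grow j : exists n, j%:R <= birkhoff_sum T f n x.
    elim: j => [|j [n Hn]]; first by exists 0%N; rewrite birkhoff_sum0.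
    have [n' n'n h] := clp _ e20 (n + k)%N.
    exists (n' - k).+1; rewrite /birkhoff_sum big_ord_recr /=.
    have -> : f (iter (n' - k) T x) = 1.
      rewrite /f asboolT //; exists (iter (n' - k) T x); first by split => //; exact: (iter_invariant ZT).
      by rewrite -iterD subnKC // (leq_trans _ n'n) // leq_addl.
    rewrite -natr1 lerD2r (le_trans Hn) //.
    have nn : (n <= n' - k)%N by rewrite leq_subRL 1?addnC // (leq_trans _ n'n) // leq_addl.
    rewrite -[X in _ <= X]/(birkhoff_sum T f (n' - k) x) -(subnKC nn) birkhoff_sumD.
    by rewrite lerDl; apply: sumr_ge0 => i _; case/andP: (f01 (iter i T (iter n T x))).
  have [c hC] := natr_above (C + 1); have [n Hn] := grow (N + c)%N.
  move: Hn; rewrite natrD => Hn.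
  by have := HC x y n Zx Zy; have := Sy n; rewrite ler_norml; lra.
have [v' [Zv' vv'] h] : good (iter n T y).
  by move: fn; rewrite /f; case: asboolP => // _ /eqP; rewrite mulr0n eq_sym oner_eq0.
exists (k + n)%N; first by rewrite (leq_trans Nn) // leq_addl.
have := contractn (iter_invariant ZT n Zy) Zv' vv'.
rewrite -iterD distrC /orbit_of => h'.
rewrite -(subrKA (iter k T v')) (le_lt_trans (ler_normD _ _)) // [ltRHS](splitr e).
by rewrite ltrD // (le_lt_trans h').
Qed.

Definition uniformly_continuous_on (W : set plane) (phi : plane -> R) :=
  forall e : R, 0 < e -> exists2 d : R, 0 < d &
    forall x y, W x -> W y -> `|x - y| < d -> `|phi x - phi y| <= e.

Hypothesis Z_neq0 : Z !=set0.

(** By contraction the value of an observable [k] steps later is almost determined by the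
first [k] codes; an observable determined by codes has a mean, with bounded error. *)
Lemma uniform_time_mean (phi : plane -> R) (M : R) : (forall x, Z x -> `|phi x| <= M) ->
  uniformly_continuous_on Z phi -> exists L, uniform_mean T Z phi L.
Proof.
move=> phiM ucphi; have [x0 Zx0] := Z_neq0.
have M0 : 0 <= M by apply: le_trans (phiM _ Zx0).
have approx e : 0 < e -> exists L N, forall n x, (N <= n)%N -> Z x ->
    `|birkhoff_sum T phi n x - n%:R * L| <= 2 * e * n%:R.
  move=> e0; have [d d0 Hd] := ucphi e e0.
  have [k0 Hk0] := expr_lt_eventually D kappa01 d0; have {Hk0} := Hk0 _ (leqnn k0).
  set k := k0 => kD.
  pose rep x := xget x [set y | Z y /\ same_codes T code k x y].
  have repP x : Z x -> Z (rep x) /\ same_codes T code k x (rep x).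
    by move=> Zx; apply: (@xgetPex _ x [set y | Z y /\ same_codes T code k x y]); exists x.
  have repE x y : Z x -> Z y -> same_codes T code k x y -> rep x = rep y.
    move=> Zx Zy xy; rewrite /rep.
    have -> : [set z | Z z /\ same_codes T code k x z] = [set z | Z z /\ same_codes T code k y z].
      apply/seteqP; split => z [Zz h]; split => //; [apply: same_codes_trans h|apply: same_codes_trans h] => //.
      exact: same_codes_sym.
    have [z Hz] : exists z, Z z /\ same_codes T code k y z by exists y.
    by rewrite /xget; case: pselect => // H; exfalso; apply: H; exists z; apply/asboolP.
  pose f x := phi (iter k T (rep x)).
  have fM x : Z x -> `|f x| <= M.
    by move=> /repP[Zr _]; apply: phiM; exact: (iter_invariant ZT).
  have fk : code_determined T code Z k f by move=> x y Zx Zy xy; rewrite /f (repE x y).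
  have [L [C HC]] := code_determined_mean ZT Z_neq0 BD fM fk.
  have [N] := natr_above ((C + 2 * (M * k%:R)) / e); rewrite ler_pdivrMr // mulrC => HN.
  exists L, N => n x Nn Zx.
  have h1 := HC x n Zx.
  have h2 : `|birkhoff_sum T phi n (iter k T x) - birkhoff_sum T f n x| <= e * n%:R.
    rewrite /birkhoff_sum -sumrB (le_trans (ler_norm_sum _ _ _)) //.
    rewrite (_ : e * n%:R = \sum_(i < n) e); last by rewrite sumr_const card_ord mulr_natr.
    apply: ler_sum => i _; rewrite -iterD addnC iterD.
    have Zi := iter_invariant ZT i Zx; have [Zr rr] := repP _ Zi.
    apply: Hd; [exact: (iter_invariant ZT)|exact: (iter_invariant ZT)|].
    exact: le_lt_trans (contractn Zi Zr rr) kD.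
  have h3 : birkhoff_sum T phi n (iter k T x) =
      birkhoff_sum T phi n x + birkhoff_sum T phi k (iter n T x) - birkhoff_sum T phi k x.
    by rewrite -birkhoff_sumD addnC birkhoff_sumD addrAC subrr add0r.
  have h4 := birkhoff_sum_le k ZT phiM Zx.
  have h5 := birkhoff_sum_le k ZT phiM (iter_invariant ZT n Zx).
  have h6 : e * N%:R <= e * n%:R by rewrite ler_wpM2l ?ler_nat // ltW.
  by move: h1 h2 h4 h5; rewrite h3 !ler_norml => /andP[? ?] /andP[? ?] /andP[? ?] /andP[? ?];
    apply/andP; split; lra.
pose eps j : R := j.+1%:R^-1.
have eps0 j : 0 < eps j by rewrite invr_gt0.
have /choice[Lj HLj] := fun j => approx (eps j) (eps0 j).
have [L HL] : exists L, forall j, Lj j - 2 * eps j <= L <= Lj j + 2 * eps j.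
  apply: between_sequences => i j.
  have [Ni Hi] := HLj i; have [Nj Hj] := HLj j.
  pose n := (maxn Ni Nj).+1.
  have hi := Hi n x0 (leqW (leq_maxl _ _)) Zx0.
  have hj := Hj n x0 (leqW (leq_maxr _ _)) Zx0.
  have n0 : 0 < n%:R :> R by rewrite ltr0n.
  rewrite -(ler_pM2l n0); move: hi hj; rewrite !ler_norml; nra.
exists L => e e0.
have [j Hj] : exists j, 4 * eps j <= e.
  have [j] := natr_above (4 / e); rewrite ler_pdivrMr // mulrC => Hj.
  exists j; rewrite /eps ler_pdivrMr ?ltr0n // (le_trans Hj) //.
  by rewrite ler_wpM2l ?ler_nat // ltW.
have [N HN] := HLj j; exists N => n x Nn Zx.
have := HN n x Nn Zx; have := HL j; have n0 : 0 <= n%:R :> R by rewrite ler0n.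
have hn : 4 * eps j * n%:R <= e * n%:R by rewrite ler_wpM2r.
move=> /andP[h1 h2]; have h3 := ler_wpM2l n0 h1; have h4 := ler_wpM2l n0 h2.
by rewrite !ler_norml => /andP[h5 h6]; apply/andP; split; lra.
Qed.

End TimeAverages.

(** * Stationary laws on the space of orbits *)

Section PlaneMeasurability.
Context {R : realType}.
Local Notation plane := (R * R)%type.

Lemma plane_open_measurable (U : set plane) : open U -> measurable U.
Proof.
move=> oU.
pose box (q : rat * rat * nat) : set plane :=
  ball (ratr q.1.1 : R) (q.2.+1%:R^-1) `*` ball (ratr q.1.2 : R) (q.2.+1%:R^-1).
have -> : U = \bigcup_(q in [set q | box q `<=` U]) box q.
  apply/seteqP; split => [p Up|p [q /= qU /qU]//].
  have [e /= e0 eU] := (nbhs_ballP _ _).1 (open_nbhs_nbhs (conj oU Up)).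
  have [n Hn] := natr_above (2 / e).
  have n0 : 0 < n.+1%:R^-1 :> R by rewrite invr_gt0.
  have ne : 2 * n.+1%:R^-1 < e.
    rewrite ltr_pdivrMr // mulrC -ltr_pdivrMr // (le_lt_trans Hn) // ltr_nat.
    exact: ltnSn.
  have rat_near (x : R) : exists q : rat, `|ratr q - x| < n.+1%:R^-1.
    have xx : x - n.+1%:R^-1 < x + n.+1%:R^-1 by move: n0; set r := _^-1; lra.
    have [q /= Hq] := rat_in_itvoo xx.
    by exists q; rewrite ltr_norml; move: Hq; rewrite in_itv /=; set r := _^-1 => /andP[? ?]; apply/andP; split; lra.
  have [q1 h1] := rat_near p.1; have [q2 h2] := rat_near p.2.
  exists (q1, q2, n); last by split; rewrite /= -ball_normE.
  move=> y [/=]; rewrite -!ball_normE /= => y1 y2; apply/eU/plane_ballE.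
  rewrite plane_norm_lt /=; move: y1 y2 h1 h2 ne; rewrite !ltr_norml /=; set r := _^-1.
  by move=> /andP[? ?] /andP[? ?] /andP[? ?] /andP[? ?] ?; apply/andP; split; apply/andP; split; lra.
rewrite bigcup_mkcond; apply: countable_bigcupT_measurable => [|q]; first exact: countableP.
case: ifPn => // _; apply: measurableX; apply: open_measurable; exact: ball_open.
Qed.

Lemma plane_closed_measurable (K : set plane) : closed K -> measurable K.
Proof. by move=> /closed_openC/plane_open_measurable/measurableC; rewrite setCK. Qed.

Lemma plane_within_continuous_measurable (K : set plane) (phi : plane -> R) :
  closed K -> {within K, continuous phi} -> measurable_fun K phi.
Proof.
move=> cK /continuousP cphi mK; have {}mK := plane_closed_measurable cK.
apply: (measurability _ (RGenOpens.measurableE R)) => //.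
move=> _ [_ [a [b ->] <-]]; have /open_subspaceP[V oV VK] := cphi _ (@interval_open _ (BRight a) (BLeft b) isT isT).
by rewrite setIC -VK; apply: measurableI => //; exact: plane_open_measurable.
Qed.

Lemma orbit_space_eval_measurable i :
  measurable_fun setT (fun s : borel_orbit_space => s i : plane).
Proof.
have pr (f : borel_orbit_space -> R) :
    continuous (f : orbit_space -> R) -> measurable_fun setT f.
  move=> /continuousP cf; apply: (measurability _ (RGenOpens.measurableE R)) => //.
  move=> _ [_ [a [b ->] <-]]; rewrite setTI; apply: sub_sigma_algebra.
  exact: cf.
have ce := @orbit_space_eval_continuous R i.
apply/measurable_fun_pairP; split; apply: pr => s.
  by apply: continuous_comp (ce s) _; exact: cvg_fst.
by apply: continuous_comp (ce s) _; exact: cvg_snd.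
Qed.

Lemma shift_measurable :
  measurable_fun setT (@shift R : borel_orbit_space -> borel_orbit_space).
Proof.
apply: (@measurability _ _ borel_orbit_space borel_orbit_space setT _ (@open (@orbit_space R)) erefl) => // _ [U oU <-].
rewrite setTI; apply: sub_sigma_algebra.
by move/continuousP: (@shift_continuous R); exact.
Qed.

End PlaneMeasurability.

Lemma push_probability d d' (X : measurableType d) (Y : measurableType d') (R : realType)
    (P : probability X R) (f : X -> Y) : measurable_fun setT f ->
  exists Q : probability Y R, (forall A, Q A = P (f @^-1` A)) /\
    forall h : Y -> \bar R, measurable_fun setT h -> P.-integrable setT (h \o f) ->
      (\int[Q]_y h y = \int[P]_x h (f x))%E.
Proof.
move=> mf; pose g : {mfun X >-> Y} := HB.pack f (isMeasurableFun.Build _ _ _ _ f mf).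
exists (distribution P g); split => // h mh ih.
exact: (@integral_distribution _ _ _ _ _ P g h mh ih).
Qed.

Lemma probability_ae d (X : measurableType d) (R : realType) (P : probability X R)
    (A : set X) : measurable A -> P A = 1%E -> {ae P, forall x, A x}.
Proof.
move=> mA PA; exists (~` A); split; first exact: measurableC.
  by rewrite probability_setC // PA subee.
by [].
Qed.

Section Stationary.
Context {R : realType}.
Local Notation plane := (R * R)%type.
Local Notation orbit_space := (@orbit_space R).
Local Notation borel_orbit_space := (@borel_orbit_space R).

Definition stationary_law (T : plane -> plane) (Reg : set plane)
    (nu : probability plane R) : Prop :=
  exists Q : probability borel_orbit_space R,
    [/\ Q (closure (orbit_of T @` Reg)) = 1%E,
        forall A : set borel_orbit_space, measurable A -> Q (@shift R @^-1` A) = Q A &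
        forall B : set plane, measurable B -> Q [set s : orbit_space | B (s 0%N)] = nu B].

(** The law of the starting point of the coded orbit of a uniformly distributed parameter.
Invariance under the shift is checked on open sets, which generate. *)
Lemma coded_stationary_law (T : plane -> plane) (Reg K : set plane)
    (Psi : measurableTypeR R -> orbit_space) :
  (forall U, open U -> measurable (Psi @^-1` U)) ->
  (forall U, open U -> unit_lebesgue (Psi @^-1` U) =
     unit_lebesgue ((@shift R \o Psi) @^-1` U)) ->
  (forall t, closure (orbit_of T @` Reg) (Psi t)) -> (forall t, K (Psi t 0%N)) ->
  exists2 mu : probability plane R, stationary_law T Reg mu & mu K = 1%E.
Proof.
move=> mU shU clPsi KPsi.
have mPsi : measurable_fun setT (Psi : _ -> borel_orbit_space).
  apply: (@measurability _ _ _ borel_orbit_space setT _ (@open orbit_space) erefl) => // _ [U oU <-].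
  by rewrite setTI; exact: mU.
have [Q [QE _]] := push_probability (unit_lebesgue : probability _ _) mPsi.
have [mu [muE _]] := push_probability Q (@orbit_space_eval_measurable R 0).
have [Qs [QsE _]] := push_probability Q (@shift_measurable R).
exists mu; last first.
  rewrite muE QE -(probability_setT (unit_lebesgue : probability _ R)); congr unit_lebesgue.
  by apply/seteqP; split => t //= _; exact: KPsi.
exists Q; split.
- rewrite QE -(probability_setT (unit_lebesgue : probability _ R)); congr unit_lebesgue.
  by apply/seteqP; split => t //= _; exact: clPsi.
- move=> A mA; rewrite -QsE; apply/esym.
  apply: (@measure_unique _ R borel_orbit_space (@open orbit_space) (fun=> setT)) => //.
  + by move=> U V; exact: openI.
  + by move=> _; exact: openT.
  + by rewrite bigcup_const.
  + move=> U oU; have h : Q U = Qs U by rewrite QsE !QE; exact: shU.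
    exact: h.
  + by move=> _; apply: (@le_lt_trans _ _ 1%E); [exact: probability_le1|exact: ltry].
- by move=> B mB; rewrite muE.
Qed.

(** A stationary law carried by [K] sees only limits of orbits that start near [K], hence in
[Z]. The average of [phi] over [n] steps of such a limit is close to [L], and by
stationarity it has the same integral as [phi]. *)
Lemma stationary_integral (T : plane -> plane) (Reg Z W K : set plane)
    (phi : plane -> R) (M L d : R) (nu : probability plane R) :
  (forall x n, Reg x -> W (iter n T x)) -> closed K -> K `<=` W -> 0 < d ->
  (forall x p, Reg x -> K p -> `|p - x| < d -> Z x) ->
  {within W, continuous phi} -> (forall p, K p -> `|phi p| <= M) ->
  uniform_mean T Z phi L ->
  stationary_law T Reg nu -> nu K = 1%E ->
  (\int[nu]_(p in K) (phi p)%:E = L%:E)%E.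
Proof.
move=> RegW cK KW d0 nearK cphi phiM meanL [Q [Q1 Qshift Qnu]] nuK.
have mK := plane_closed_measurable cK.
have QK i : Q [set s : orbit_space | K (s i)] = 1%E.
  elim: i => [|i IH]; first by rewrite Qnu.
  rewrite -[RHS]IH -(Qshift [set s : orbit_space | K (s i)]) //.
  have := @orbit_space_eval_measurable R i measurableT K mK; rewrite setTI.
  exact.
have Qnui i (B : set plane) : measurable B -> Q [set s : orbit_space | B (s i)] = nu B.
  move=> mB; elim: i => [|i IH]; first exact: Qnu.
  rewrite -IH -(Qshift [set s : orbit_space | B (s i)]) //.
  have := @orbit_space_eval_measurable R i measurableT B mB; rewrite setTI.
  exact.
have mcl : measurable (closure (orbit_of T @` Reg) : set borel_orbit_space).
  rewrite -[closure _]setCK; apply: measurableC; apply: sub_sigma_algebra.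
  by rewrite openC; exact: closed_closure.
(* Countably many almost sure events, indexed by a single integer. *)
pose good n (s : borel_orbit_space) :=
  if n is i.+1 then K (s i) else closure (orbit_of T @` Reg) s.
have [N [mN QN0 NP]] : {ae Q, forall s, forall n, good n s}.
  apply: ae_foralln => -[|i]; first exact: probability_ae mcl Q1.
  apply: (probability_ae _ (QK i)).
  have := @orbit_space_eval_measurable R i measurableT K mK; rewrite setTI.
  exact.
pose f := phi \_ K.
have fK p : K p -> f p = phi p by move=> Kp; rewrite /f patchE mem_set.
have mf : measurable_fun setT f.
  have cphiK : {within K, continuous phi} by exact: continuous_subspaceW cphi.
  exact: (measurable_restrictT phi mK).1 (plane_within_continuous_measurable cK cphiK).
have fM p : `|f p| <= `|M|.
  rewrite /f patchE; case: ifPn => [/set_mem Kp|_]; last by rewrite normr0.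
  exact: le_trans (phiM p Kp) (ler_norm M).
have intf (P : probability borel_orbit_space R) (h : borel_orbit_space -> plane) :
    measurable_fun setT h -> P.-integrable setT (EFin \o (f \o h)).
  move=> mh; apply: measurable_bounded_integrable => //.
  - by apply: (@le_lt_trans _ _ 1%E); [exact: probability_le1|exact: ltry].
  - exact: measurableT_comp.
  - by exists `|M|; split; [exact: num_real|move=> c cM s _; exact: le_trans (fM _) (ltW cM)].
have me := @orbit_space_eval_measurable R.
pose I := (\int[nu]_p (f p)%:E)%E.
have Ii i : (\int[Q]_s (f (s i))%:E)%E = I.
  have [nui [nuiE hi]] := push_probability Q (me i).
  rewrite -(hi (EFin \o f)) //; last exact: (intf Q _ (me i)).
    by apply: eq_measure_integral => B mB _; exact: etrans (nuiE B) (Qnui i B mB).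
  exact/measurable_EFinP.
have IE : (\int[nu]_(p in K) (phi p)%:E)%E = I.
  rewrite integral_mkcond; apply: eq_integral => p _.
  by rewrite /f !patchE; case: ifP.
have Ifin : I \is a fin_num.
  rewrite -(Ii 0%N); apply: integrable_fin_num => //; exact: (intf Q _ (me 0%N)).
rewrite IE -(fineK Ifin); congr (_%:E).
have main e : 0 < e -> exists2 n, (0 < n)%N & forall s : orbit_space, ~ N s ->
    `|\sum_(i < n) f (s i) - n%:R * L| <= e * n%:R.
  move=> e0; have e20 : 0 < e / 2 by rewrite divr_gt0.
  have [n0 Hn0] := meanL _ e20; pose n := n0.+1.
  exists n => // s Ns; have [cls Ks] : closure (orbit_of T @` Reg) s /\ forall i, K (s i).
    have gs : forall n, good n s by apply: contrapT => h; apply/Ns/NP.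
    by split; [exact: gs 0%N|move=> i; exact: gs i.+1].
  have [r r0 Hr] : exists2 r : R, 0 < r & forall i y, (i < n)%N -> W y ->
      `|s i - y| < r -> `|phi (s i) - phi y| < e / 2.
    elim: n => [|k [r r0 Hr]]; first by exists 1.
    have /subspace_continuousP/(_ _ (KW _ (Ks k)))/cvgrPdist_lt/(_ _ e20) := cphi.
    rewrite near_withinE -/(nbhs _ _) => /nbhs_ballP[r' /= r'0 Hr'].
    exists (Num.min r r'); first by rewrite lt_min r0.
    move=> i y; rewrite ltnS leq_eqVlt => /predU1P[->|ik] Wy; rewrite lt_min => /andP[h1 h2].
      by apply: Hr' => //; exact/plane_ballE.
    exact: Hr.
  have rd0 : 0 < Num.min r d by rewrite lt_min r0.
  have [_ [[x Rx <-] hx]] := cls _ (orbit_space_nbhs s n rd0).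
  have hx' i : (i <= n)%N -> `|s i - iter i T x| < Num.min r d := hx i.
  have Zx : Z x.
    apply: (nearK x (s 0%N)) => //; have := hx' 0%N isT.
    by rewrite lt_min => /andP[].
  have h1 := Hn0 n x (leqnSn _) Zx.
  have h2 : `|\sum_(i < n) f (s i) - birkhoff_sum T phi n x| <= e / 2 * n%:R.
    rewrite /birkhoff_sum -sumrB (le_trans (ler_norm_sum _ _ _)) //.
    rewrite (_ : e / 2 * n%:R = \sum_(i < n) (e / 2)); last by rewrite sumr_const card_ord mulr_natr.
    apply: ler_sum => i _; rewrite fK //; apply/ltW/Hr => //; first exact: RegW.
    have := hx' i (ltnW (ltn_ord i)).
    by rewrite lt_min => /andP[].
  rewrite -(subrKA (birkhoff_sum T phi n x)) (le_trans (ler_normD _ _)) //.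
  by rewrite [in leRHS](splitr e) mulrDl lerD.
have key e : 0 < e -> `|fine I - L| <= e.
  move=> e0; have [n n0 Hn] := main e e0.
  have nR0 : 0 < n%:R :> R by rewrite ltr0n.
  pose S (s : borel_orbit_space) : R := \sum_(i < n) f (s i).
  have SI : (\int[Q]_s (S s)%:E)%E = (n%:R * fine I)%:E.
    rewrite /S; under eq_integral do rewrite -sumEFin.
    rewrite integral_sum //; last by move=> i; exact: (intf Q _ (me i)).
    rewrite (eq_bigr (fun=> (fine I)%:E)); last by move=> i _; rewrite Ii fineK.
    by rewrite sumEFin sumr_const card_ord mulr_natl.
  have intS : Q.-integrable setT (EFin \o S).
    rewrite (_ : EFin \o S = fun s => (\sum_(i < n) (f (s i))%:E)%E); last first.
      by apply/funext => s /=; rewrite sumEFin.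
    by apply: integrable_sum => // i _; exact: (intf Q _ (me i)).
  have mTN : measurable ([set: borel_orbit_space] `\` N) by exact: measurableD.
  have QTN : Q ([set: borel_orbit_space] `\` N) = 1%E.
    by rewrite setTD probability_setC // QN0 sube0.
  have intc (c : R) : Q.-integrable ([set: borel_orbit_space] `\` N) (cst c%:E).
    exact: finite_measure_integrable_cst.
  have intSN : Q.-integrable ([set: borel_orbit_space] `\` N) (EFin \o S).
    by apply: integrableS intS.
  have SIN : (\int[Q]_(s in [set: borel_orbit_space] `\` N) (S s)%:E)%E = (n%:R * fine I)%:E.
    by rewrite -SI (negligible_integral mN measurableT intS QN0).
  have cI (c : R) : (\int[Q]_(s in [set: borel_orbit_space] `\` N) (cst c%:E s))%E = c%:E.
    by rewrite integral_cst // -[RHS]mule1; congr (_ * _)%E; exact: QTN.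
  have up : ((n%:R * fine I)%:E <= (n%:R * L + e * n%:R)%:E)%E.
    rewrite -SIN -[leRHS]cI; apply: le_integral => // s /set_mem[_ Ns].
    by rewrite /= lee_fin; have := Hn s Ns; rewrite ler_norml /S; lra.
  have lo : ((n%:R * L - e * n%:R)%:E <= (n%:R * fine I)%:E)%E.
    rewrite -SIN -[leLHS]cI; apply: le_integral => // s /set_mem[_ Ns].
    by rewrite /= lee_fin; have := Hn s Ns; rewrite ler_norml /S; lra.
  move: up lo; rewrite !lee_fin => up lo.
  have le1 : fine I <= L + e by rewrite -(ler_pM2l nR0) mulrDr [_ * e]mulrC.
  have le2 : L - e <= fine I by rewrite -(ler_pM2l nR0) mulrBr [_ * e]mulrC.
  by rewrite ler_norml; apply/andP; split; lra.
apply/eqP; rewrite -subr_eq0 -normr_le0; apply/ler_addgt0Pr => e e0.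
by rewrite add0r; exact: key.
Qed.

End Stationary.

Section Quadrants.
Context {R : realType}.
Local Notation plane := (R * R)%type.

Let quadrant (x y : R) : set plane := `[x, +oo[%classic `*` `[y, +oo[%classic.

Let quadrantP x y p : quadrant x y p <-> x <= p.1 /\ y <= p.2.
Proof. by rewrite /quadrant /= !in_itv /= !andbT. Qed.

Let measurable_quadrant x y : measurable (quadrant x y).
Proof. by apply: measurableX; exact: measurable_itv. Qed.

Let quadrants := [set Q | exists x y, Q = quadrant x y].

Let quadrants_setI : setI_closed quadrants.
Proof.
move=> _ _ [x [y ->]] [x' [y' ->]]; exists (Num.max x x'), (Num.max y y').
apply/seteqP; split => p.
  move=> [/quadrantP[h1 h2] /quadrantP[h3 h4]]; apply/quadrantP.
  by rewrite !ge_max h1 h2 h3 h4.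
move=> /quadrantP; rewrite !ge_max => -[/andP[h1 h2] /andP[h3 h4]].
by split; apply/quadrantP.
Qed.

Let quadrants_generate : (measurable : set (set plane)) = <<s quadrants >>.
Proof.
apply/seteqP; split; last first.
  apply: smallest_sub; first exact: sigma_algebra_measurable.
  by move=> _ [x [y ->]]; exact: measurable_quadrant.
suff mid : measurable_fun setT (idfun : g_sigma_algebraType quadrants -> plane).
  by move=> B mB; have := mid measurableT B mB; rewrite setTI preimage_id.
have below (z : R) : exists n : nat, - n%:R <= z.
  by have [n] := natr_above (- z); exists n; rewrite lerNl.
apply/measurable_fun_pairP; split.
  apply: (@measurability _ _ (g_sigma_algebraType quadrants) R setT _ (@RGenCInfty.G R) (RGenCInfty.measurableE R)).
  move=> _ [_ [x ->] <-]; rewrite setTI.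
  rewrite (_ : _ @^-1` _ = \bigcup_n quadrant x (- n%:R)).
    by apply: bigcup_measurable => n _; apply: sub_sigma_algebra; exists x, (- n%:R).
  apply/seteqP; split => p /=; rewrite in_itv /= andbT.
    by move=> xp; have [n hn] := below p.2; exists n => //; apply/quadrantP.
  by move=> [n _ /quadrantP[]].
apply: (@measurability _ _ (g_sigma_algebraType quadrants) R setT _ (@RGenCInfty.G R) (RGenCInfty.measurableE R)).
move=> _ [_ [x ->] <-]; rewrite setTI.
rewrite (_ : _ @^-1` _ = \bigcup_n quadrant (- n%:R) x).
  by apply: bigcup_measurable => n _; apply: sub_sigma_algebra; exists (- n%:R), x.
apply/seteqP; split => p /=; rewrite in_itv /= andbT.
  by move=> xp; have [n hn] := below p.1; exists n => //; apply/quadrantP.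
by move=> [n _ /quadrantP[]].
Qed.

(** Quadrants generate the Borel sets and are stable under intersection. The indicator of a
quadrant is squeezed between a product of two ramps and the indicator of a slightly larger
quadrant. *)
Lemma probability_eq_integral (K : set plane) (mu nu : probability plane R) :
  closed K -> mu K = 1%E -> nu K = 1%E ->
  (forall phi : plane -> R, continuous phi -> (forall p, 0 <= phi p <= 1) ->
    (\int[mu]_(p in K) (phi p)%:E = \int[nu]_(p in K) (phi p)%:E)%E) ->
  forall B, measurable B -> nu B = mu B.
Proof.
move=> cK muK nuK H; have mK := plane_closed_measurable cK.
pose rho k (u : R) : R := Num.max 0 (1 - k.+1%:R * Num.max 0 u).
have rho01 k u : 0 <= rho k u <= 1.
  rewrite /rho le_max lexx /= ge_max ler01 /= lerBlDr lerDl mulr_ge0 //.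
  by rewrite le_max lexx.
have rho1 k u : u <= 0 -> rho k u = 1.
  by move=> u0; rewrite /rho (max_l u0) mulr0 subr0 max_r.
have rho0 k u : k.+1%:R^-1 <= u -> rho k u = 0.
  move=> ku; have u0 : 0 <= u by apply: le_trans ku; rewrite invr_ge0.
  rewrite /rho (max_r u0) max_l // subr_le0 -ler_pdivrMl ?ltr0n // mulr1.
  exact: ku.
have crho k : continuous (rho k).
  have cmax (f : R -> R) : continuous f -> continuous (fun u => Num.max 0 (f u)).
    by move=> cf u; apply: (@continuous_max R R (cst 0) f u) (cf u); exact: cst_continuous.
  have c1 : continuous (fun u : R => Num.max 0 u) by apply: (cmax id) => v; exact: cvg_id.
  apply: cmax => u; apply: cvgB; first exact: cvg_cst.
  by apply: cvgM; [exact: cvg_cst|exact: c1].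
pose phi x y k (p : plane) := rho k (x - p.1) * rho k (y - p.2).
have phi01 x y k p : 0 <= phi x y k p <= 1.
  have /andP[a0 a1] := rho01 k (x - p.1); have /andP[b0 b1] := rho01 k (y - p.2).
  by rewrite /phi mulr_ge0 //= mulr_ile1.
have cphi x y k : continuous (phi x y k).
  move=> p; apply: cvgM.
    apply: (@continuous_comp plane R R (fun p => x - p.1) (rho k) p); last exact: crho.
    by apply: cvgB; [exact: cvg_cst|exact: cvg_fst].
  apply: (@continuous_comp plane R R (fun p => y - p.2) (rho k) p); last exact: crho.
  by apply: cvgB; [exact: cvg_cst|exact: cvg_snd].
have intphi x y k : measurable_fun K (EFin \o phi x y k).
  apply/measurable_EFinP; apply: plane_within_continuous_measurable => //.
  by apply: continuous_subspaceT; exact: cphi.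
pose C x y k := quadrant (x - k.+1%:R^-1) (y - k.+1%:R^-1).
have lower (P : probability plane R) x y k : P K = 1%E ->
    (P (quadrant x y) <= \int[P]_(p in K) (phi x y k p)%:E)%E.
  move=> PK; have -> : P (quadrant x y) = P (quadrant x y `&` K).
    have PCK : P (~` K) = 0%E by rewrite probability_setC // PK subee.
    rewrite -(setIT (quadrant x y)) -(setUv K) setIUr measureU.
    - rewrite -setIUr setUv setIT [X in (_ + X)%E](_ : _ = 0%E) ?adde0 //.
      apply/eqP; rewrite eq_le measure_ge0 andbT -PCK le_measure ?inE //.
        by apply: measurableI => //; exact: measurableC.
      exact: measurableC.
    - exact: measurableI.
    - by apply: measurableI => //; exact: measurableC.
    - by rewrite setIACA setICr setI0.
  rewrite -integral_indic //; apply: ge0_le_integral => //.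
  - by apply/measurable_EFinP; exact: measurable_indic.
  - exact: intphi.
  - move=> p _; rewrite lee_fin indicE; case: (boolP (p \in _)) => [/set_mem/quadrantP[h1 h2]|_].
      by rewrite /phi !rho1 ?mulr1 // subr_le0.
    by case/andP: (phi01 x y k p).
have upper (P : probability plane R) x y k :
    (\int[P]_(p in K) (phi x y k p)%:E <= P (C x y k))%E.
  apply: (@le_trans _ _ (P (C x y k `&` K))); last first.
    apply: le_measure; rewrite ?inE; last exact: subIsetl.
      by apply: measurableI => //; exact: measurable_quadrant.
    exact: measurable_quadrant.
  rewrite -integral_indic //; last exact: measurable_quadrant.
  apply: ge0_le_integral => //.
  - by move=> p _; rewrite lee_fin; case/andP: (phi01 x y k p).
  - exact: intphi.
  - by apply/measurable_EFinP; apply: measurable_indic; exact: measurable_quadrant.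
  - move=> p _; rewrite lee_fin indicE; case: (boolP (p \in _)) => [_|/negP nC].
      by case/andP: (phi01 x y k p).
    rewrite /phi; case: (leP (x - k.+1%:R^-1) p.1) => h1.
      case: (leP (y - k.+1%:R^-1) p.2) => h2.
        by exfalso; apply/nC/mem_set/quadrantP.
      by rewrite [X in _ * X]rho0 ?mulr0 // lerBrDr addrC -lerBrDr ltW.
    by rewrite rho0 ?mul0r // lerBrDr addrC -lerBrDr ltW.
have le_quadrant (P P' : probability plane R) x y : P K = 1%E -> 
    (forall k, (\int[P]_(p in K) (phi x y k p)%:E = \int[P']_(p in K) (phi x y k p)%:E)%E) ->
    (P (quadrant x y) <= P' (quadrant x y))%E.
  move=> PK PP'.
  have cvgC : P' \o C x y @ \oo --> P' (\bigcap_k C x y k).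
    apply: nonincreasing_cvg_mu => //.
    - by apply: (@le_lt_trans _ _ 1%E); [apply: probability_le1; exact: measurable_quadrant|exact: ltry].
    - by move=> k; exact: measurable_quadrant.
    - by apply: bigcapT_measurable => k; exact: measurable_quadrant.
    - move=> k l kl; apply/subsetPset => p /quadrantP[h1 h2]; apply/quadrantP.
      have : l.+1%:R^-1 <= k.+1%:R^-1 :> R by rewrite lef_pV2 ?posrE ?ltr0n // ler_nat.
      by move: h1 h2; set r := k.+1%:R^-1; set r' := l.+1%:R^-1; split; lra.
  have capC : \bigcap_k C x y k = quadrant x y.
    apply/seteqP; split => p; last first.
      move=> /quadrantP[h1 h2] k _; apply/quadrantP.
      have : 0 <= k.+1%:R^-1 :> R by rewrite invr_ge0.
      by set r := _^-1; split; lra.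
    move=> Hp; have near_p e : 0 < e -> x - e <= p.1 /\ y - e <= p.2.
      move=> e0; have [k hk] := natr_above e^-1; have /quadrantP[h1 h2] := Hp k I.
      have ke : k.+1%:R^-1 <= e.
        rewrite -[leRHS]invrK lef_pV2 ?posrE ?invr_gt0 ?ltr0n // (le_trans hk) //.
        by rewrite ler_nat.
      by split; [apply: le_trans h1|apply: le_trans h2]; rewrite lerD2l lerN2.
    apply/quadrantP; split; apply/ler_addgt0Pr => e /near_p[h1 h2]; lra.
  rewrite capC in cvgC; rewrite -(cvg_lim _ cvgC) //; apply: lime_ge.
    by apply/cvg_ex; eexists; exact: cvgC.
  by apply: nearW => k; apply: le_trans (lower P x y k PK) _; rewrite PP'; exact: upper.
move=> B mB; apply: (@measure_unique _ R plane quadrants (fun n => quadrant (- n%:R) (- n%:R))) => //.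
- by move=> i; exists (- i%:R), (- i%:R).
- apply/seteqP; split => p // _.
  have [n1 h1] := natr_above (- p.1); have [n2 h2] := natr_above (- p.2).
  exists (maxn n1 n2) => //; apply/quadrantP; split; rewrite lerNl.
    by apply: le_trans h1 _; rewrite ler_nat leq_maxl.
  by apply: le_trans h2 _; rewrite ler_nat leq_maxr.
- move=> _ [x [y ->]]; apply/le_anti/andP; split; apply: le_quadrant => // k.
    by rewrite H.
  by rewrite H.
- by move=> k; apply: (@le_lt_trans _ _ 1%E); [apply: probability_le1; exact: measurable_quadrant|exact: ltry].
Qed.

End Quadrants.

(** * Outer billiards around the quadrilateral *)

Section Polygons.
Context {R : realType}.
Local Notation plane := (R * R)%type.

Lemma polygon_vertex n (V : 'I_n -> plane) i : polygon V (V i).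
Proof.
exists (fun j => (j == i)%:R); split; first by move=> j; exact: ler0n.
  by rewrite (bigD1 i) //= eqxx big1 ?addr0 // => j /negbTE ->.
rewrite [LHS]surjective_pairing; congr (_, _).
  by rewrite (bigD1 i) //= eqxx mul1r big1 ?addr0 // => j /negbTE ->; rewrite mul0r.
by rewrite (bigD1 i) //= eqxx mul1r big1 ?addr0 // => j /negbTE ->; rewrite mul0r.
Qed.

Lemma polygon_affine_ge0 n (V : 'I_n -> plane) (c0 c1 c2 : R) :
  (forall j, 0 <= c0 + c1 * (V j).1 + c2 * (V j).2) ->
  forall p, polygon V p -> 0 <= c0 + c1 * p.1 + c2 * p.2.
Proof.
move=> H p [w [w0 w1 ->]] /=.
rewrite -[c0]mulr1 -w1 !mulr_sumr -!big_split /=; apply: sumr_ge0 => i _.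
have := mulr_ge0 (w0 i) (H i); congr (0 <= _); ring.
Qed.

(** Being on the left of a ray can be tested on the vertices. Two tangent vertices would lie
weakly on the left of each other's rays, against the strict inequality. *)
Lemma outer_billiardE n lam (V : 'I_n -> plane) x i :
  (forall j, j != i -> 0 < cross (V i - x) (V j - x)) ->
  outer_billiard lam V x =
    ((1 + lam) * (V i).1 - lam * x.1, (1 + lam) * (V i).2 - lam * x.2).
Proof.
move=> H; rewrite /outer_billiard.
set y := (X in _ = X); set P := (X in xget _ X).
have Py : P y.
  exists i; split => // p; rewrite /cross /=.
  pose c1 := - ((V i).2 - x.2); pose c2 := (V i).1 - x.1.
  move=> /(@polygon_affine_ge0 _ V (- (c1 * x.1 + c2 * x.2)) c1 c2) h.
  rewrite [X in 0 <= X](_ : _ = - (c1 * x.1 + c2 * x.2) + c1 * p.1 + c2 * p.2);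
    last by rewrite /c1 /c2; ring.
  apply: h => j; have [->|ji] := eqVneq j i.
    by rewrite [X in 0 <= X](_ : _ = 0) // /c1 /c2; ring.
  apply: ltW; have := H j ji; rewrite /cross /=.
  by rewrite [X in 0 < X -> _](_ : _ = - (c1 * x.1 + c2 * x.2) + c1 * (V j).1 + c2 * (V j).2) //
    /c1 /c2; ring.
have Puniq z : P z -> z = y.
  move=> [j [left_j ->]]; rewrite /y; have [->//|ji] := eqVneq j i; exfalso.
  have := left_j (V i) (polygon_vertex V i); have := H j ji.
  rewrite /cross /=; lra.
by apply: Puniq; apply: (@xgetPex _ x P); exists y.
Qed.

End Polygons.

Section Quadrilateral.
Context {R : realType}.
Variables (a b lam : R).
Hypotheses (ha : 0 < a < 1) (hb : 0 < b < 1) (lam_gt0 : 0 < lam).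
Local Notation plane := (R * R)%type.
Local Notation V := (quad a b).
Local Notation T := (outer_billiard lam V).

Definition vA : 'I_4 := @Ordinal 4 0 isT.
Definition vB : 'I_4 := @Ordinal 4 1 isT.
Definition vC : 'I_4 := @Ordinal 4 2 isT.
Definition vD : 'I_4 := @Ordinal 4 3 isT.

Lemma ord4P (P : 'I_4 -> Prop) : P vA -> P vB -> P vC -> P vD -> forall i, P i.
Proof.
move=> PA PB PC PD [[|[|[|[|//]]]] Hi].
- by have -> : Ordinal Hi = vA by exact: val_inj.
- by have -> : Ordinal Hi = vB by exact: val_inj.
- by have -> : Ordinal Hi = vC by exact: val_inj.
- by have -> : Ordinal Hi = vD by exact: val_inj.
Qed.

(** Positive to the right of the line through [B] and [C]. *)
Definition sideBC (x : plane) : R := (1 - b) * (x.1 - a) + (1 - a) * (x.2 - 1).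

(** The open region between the two singular rays that bound the domain of a vertex: the
points from which this vertex is the tangent vertex. *)
Definition wedge (i : 'I_4) (x : plane) : bool :=
  match val i with
  | 0 => (0 < x.1) && (1 < x.2)
  | 1 => (x.2 < 1) && (0 < sideBC x)
  | 2 => (x.2 < b * x.1) && (sideBC x < 0)
  | _ => (x.1 < 0) && (b * x.1 < x.2)
  end.

Definition reflect_vertex (i : 'I_4) (x : plane) : plane :=
  ((1 + lam) * (V i).1 - lam * x.1, (1 + lam) * (V i).2 - lam * x.2).

Lemma wedge_cross i x : wedge i x ->
  forall j, j != i -> 0 < cross (V i - x) (V j - x).
Proof.
have /andP[a0 a1] := ha; have /andP[b0 b1] := hb.
have ab : a * b < 1 by nra.
move: i x; apply: ord4P => -[x y]; rewrite /wedge /= /sideBC /= => /andP[h1 h2];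
  apply: ord4P => // _; rewrite /cross /quad /= /tnth /=.
- have d : 0 < y - 1 by lra.
  by have := mulr_gt0 a0 d; lra.
- have d : 0 < 1 - b by lra.
  by have := mulr_gt0 h1 d; lra.
- lra.
- have d : 0 < 1 - y by lra.
  by have := mulr_gt0 a0 d; lra.
- lra.
- have d : 0 < 1 - y by lra.
  have d' : 0 < 1 - a by lra.
  have e := mulr_gt0 d' d; have f := mulr_gt0 a0 d.
  have xa : 0 < x - a.
    by rewrite -(pmulr_rgt0 _ (_ : 0 < 1 - b)); lra.
  lra.
- have yb : y <= b.
    rewrite leNgt; apply/negP => yb; have bx : b < b * x by lra.
    have x1 : 0 < x - 1 by rewrite -(pmulr_rgt0 _ b0); lra.
    have d : 0 < 1 - b by lra.
    have d' : 0 < 1 - a by lra.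
    have yb' : 0 < y - b by lra.
    by have := mulr_gt0 d x1; have := mulr_gt0 d' yb'; lra.
  have := mulr_ge0 (ltW a0) (_ : 0 <= b - y); lra.
- lra.
- lra.
- lra.
- have d : 0 < - x by lra.
  have d' : 0 < 1 - a * b by lra.
  have d'' : 0 < y - b * x by lra.
  by have := mulr_gt0 d d'; have := mulr_gt0 a0 d''; lra.
- lra.
Qed.

Lemma wedgeE i x : wedge i x -> T x = reflect_vertex i x.
Proof. by move=> /wedge_cross; exact: outer_billiardE. Qed.

Lemma wedge_uniq i j x : wedge i x -> wedge j x -> i = j.
Proof.
move=> wi wj; apply/eqP/negPn/negP => ij; have ji : j != i by rewrite eq_sym.
have := wedge_cross wi ji; have := wedge_cross wj ij.
by rewrite /cross /=; lra.
Qed.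

Definition vertex_code (x : plane) : 'I_4 := odflt vA [pick i | wedge i x].

Lemma wedge_code i x : wedge i x -> vertex_code x = i.
Proof.
rewrite /vertex_code => wi; case: pickP => [j wj|/(_ i)]; last by rewrite wi.
exact: wedge_uniq wj wi.
Qed.

Lemma sum_ord4 (F : 'I_4 -> R) : \sum_(i < 4) F i = F vA + F vB + F vC + F vD.
Proof.
rewrite !big_ord_recl big_ord0 addr0 !addrA.
by congr (F _ + F _ + F _ + F _); exact: val_inj.
Qed.

Lemma quad_polygonP (x : plane) : polygon V x <->
  [/\ 0 <= x.1, x.2 <= 1, sideBC x <= 0 & b * x.1 <= x.2].
Proof.
have /andP[a0 a1] := ha; have /andP[b0 b1] := hb.
have ab : 0 < 1 - a * b by rewrite subr_gt0; nra.
split.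
  move=> Px; split.
  - by have := @polygon_affine_ge0 R 4 V 0 1 0 _ x Px; rewrite add0r mul1r mul0r addr0; apply;
      apply: ord4P; rewrite /quad /tnth /=; lra.
  - suff : 0 <= 1 + 0 * x.1 + (-1) * x.2 by lra.
    by apply: (@polygon_affine_ge0 R 4 V) => //; apply: ord4P; rewrite /quad /tnth /=; lra.
  - rewrite /sideBC; suff : 0 <= (1 - a * b) + (b - 1) * x.1 + (a - 1) * x.2 by lra.
    by apply: (@polygon_affine_ge0 R 4 V) => //; apply: ord4P; rewrite /quad /tnth /=; nra.
  - suff : 0 <= 0 + (- b) * x.1 + 1 * x.2 by lra.
    by apply: (@polygon_affine_ge0 R 4 V) => //; apply: ord4P; rewrite /quad /tnth /=; nra.
case: x => x y; rewrite /sideBC /= => -[x0 y1 F0 G0].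
have wit (wA wB wC wD : R) : 0 <= wA -> 0 <= wB -> 0 <= wC -> 0 <= wD ->
    wA + wB + wC + wD = 1 -> x = a * wB + wC -> y = wA + wB + b * wC -> polygon V (x, y).
  move=> hA hB hC hD w1 wx wy.
  exists (fun i => match val i with 0 => wA | 1 => wB | 2 => wC | _ => wD end); split.
  - by apply: ord4P.
  - by rewrite sum_ord4.
  - by rewrite !sum_ord4 /quad /tnth /=; congr (_, _); [rewrite wx; ring|rewrite wy; ring].
have a0' : a != 0 by rewrite gt_eqF.
have ab' : 1 - a * b != 0 by rewrite gt_eqF.
case: (leP x (a * y)) => h.
  have xa : x / a <= y by rewrite ler_pdivrMr // mulrC.
  apply: (wit (y - x / a) (x / a) 0 (1 - y)); try lra.
  - by rewrite divr_ge0 // ltW.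
  - by field.
apply: (wit 0 ((y - b * x) / (1 - a * b)) ((x - a * y) / (1 - a * b))
    (- ((1 - b) * (x - a) + (1 - a) * (y - 1)) / (1 - a * b))) => //.
- by apply: divr_ge0; [lra|exact: ltW].
- by apply: divr_ge0; [lra|exact: ltW].
- by apply: divr_ge0; [lra|exact: ltW].
- by field.
- by field.
- by field.
Qed.

Lemma quad_singularP (x : plane) : singular_rays V x <->
  [\/ x.2 = 1 /\ 0 <= x.1, sideBC x = 0 /\ a <= x.1,
      x.2 = b * x.1 /\ x.1 <= 1 | x.1 = 0 /\ 0 <= x.2].
Proof.
have /andP[a0 a1] := ha; have /andP[b0 b1] := hb.
have SA : ordS vA = vB by exact: val_inj.
have SB : ordS vB = vC by exact: val_inj.
have SC : ordS vC = vD by exact: val_inj.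
have SD : ordS vD = vA by exact: val_inj.
case: x => x y; rewrite /sideBC /=; split.
  move=> [i _]; move: i; apply: ord4P => -[t t0]; rewrite ?SA ?SB ?SC ?SD /quad /tnth /= => -[-> ->].
  - by apply: Or41; split; [ring|nra].
  - by apply: Or42; split; [ring|nra].
  - by apply: Or43; split; [ring|lra].
  - by apply: Or44; split; [ring|lra].
case=> -[h1 h2].
- exists vA => //; exists (x / a); first by rewrite divr_ge0 // ltW.
  by rewrite SA /quad /tnth /= h1; congr (_, _); field; rewrite gt_eqF.
- have a1' : 1 - a != 0 by rewrite gt_eqF // subr_gt0.
  exists vB => //; exists ((x - a) / (1 - a)); first by rewrite divr_ge0 // subr_ge0 // ltW.
  rewrite SB /quad /tnth /=; congr (_, _); first by field.
  by apply: (mulfI a1'); transitivity (1 - a - (1 - b) * (x - a)); [lra|field].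
- exists vC => //; exists (1 - x); first by lra.
  by rewrite SC /quad /tnth /= h1; congr (_, _); ring.
- exists vD => //; exists y => //.
  by rewrite SD /quad /tnth /= h1; congr (_, _); ring.
Qed.

Lemma wedge_ex x : ~ polygon V x -> ~ singular_rays V x -> exists i, wedge i x.
Proof.
have /andP[a0 a1] := ha; have /andP[b0 b1] := hb.
case: x => x y; rewrite quad_polygonP quad_singularP /=.
set F := sideBC _ => nP nS; have FE : F = (1 - b) * (x - a) + (1 - a) * (y - 1) by [].
have d : 0 < 1 - b by lra.
have d' : 0 < 1 - a by lra.
have ab : 0 < 1 - a * b by rewrite subr_gt0; nra.
have wC : y < b * x -> F < 0 -> exists i, wedge i (x, y).
  by move=> h1 h2; exists vC; rewrite /wedge /= h1.
have FC : x <= 0 -> y <= 0 -> F < 0.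
  move=> h1 h2; have := mulr_ge0 (ltW d) (_ : 0 <= - x); have := mulr_ge0 (ltW d') (_ : 0 <= - y).
  by rewrite FE; lra.
have [x0|x0|x0] := ltrgtP 0 x.
- have [y1|y1|y1] := ltrgtP 1 y; first by exists vA; rewrite /wedge /= x0.
    have e := mulr_gt0 d' (_ : 0 < 1 - y).
    have [F0|F0|F0] := ltrgtP 0 F; first by exists vB; rewrite /wedge /= y1.
      have [G0|G0|G0] := ltrgtP y (b * x); first exact: wC.
        by exfalso; apply: nP; split; exact: ltW.
      exfalso; apply: nS; apply: Or43; split => //.
      rewrite leNgt; apply/negP => x1; have := mulr_gt0 ab (_ : 0 < x - 1).
      by move: F0; rewrite FE G0; lra.
    exfalso; apply: nS; apply: Or42; split => //.
    rewrite -subr_ge0 -(pmulr_rge0 _ d); move: e; lra.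
  by exfalso; apply: nS; apply: Or41; rewrite -y1 ltW.
- have [G0|G0|G0] := ltrgtP y (b * x); last 2 first.
  + by exists vD; rewrite /wedge /= x0.
  + by exfalso; apply: nS; apply: Or43; split => //; lra.
  by apply: wC => //; apply: FC; [exact: ltW|nra].
- have [y0|y0] := leP 0 y; first by exfalso; apply: nS; apply: Or44.
  by apply: wC; [rewrite -x0 mulr0|apply: FC; [rewrite -x0|exact: ltW]].
Qed.

Lemma wedge_not_polygon i x : wedge i x -> ~ polygon V x.
Proof.
rewrite quad_polygonP; case: x => x y; move: i; apply: ord4P;
  rewrite /wedge /= => /andP[h1 h2] [p1 p2 p3 p4]; lra.
Qed.

Lemma wedge_not_singular i x : wedge i x -> ~ singular_rays V x.
Proof.
have /andP[a0 a1] := ha; have /andP[b0 b1] := hb.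
have d : 0 < 1 - b by lra.
have d' : 0 < 1 - a by lra.
have ab : 0 < 1 - a * b by rewrite subr_gt0; nra.
rewrite quad_singularP; case: x => x y; move: i; apply: ord4P;
  rewrite /wedge /sideBC /= => /andP[h1 h2] [] [h3 h4]; try lra.
- have := mulr_ge0 (ltW d) (_ : 0 <= x - a); have := mulr_gt0 d' (_ : 0 < y - 1); lra.
- have := mulr_ge0 (ltW b0) (_ : 0 <= 1 - x); lra.
- have := mulr_ge0 (ltW ab) (_ : 0 <= 1 - x); move: h2; rewrite h3; lra.
- have := mulr_gt0 d a0; have := mulr_gt0 d' (_ : 0 < 1 - y); move: h2; rewrite h3; lra.
- have : 1 < x by rewrite -subr_gt0 -(pmulr_rgt0 _ b0); lra.
  by move=> x1; have := mulr_gt0 d (_ : 0 < x - 1); move: h2; rewrite h3; nra.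
- by move: h1; rewrite h3 mulr0; lra.
Qed.

Lemma reflect_not_polygon i x : wedge i x -> ~ polygon V (reflect_vertex i x).
Proof.
have d := lam_gt0.
rewrite quad_polygonP; case: x => x y; move: i; apply: ord4P;
  rewrite /wedge /sideBC /reflect_vertex /quad /tnth /= => /andP[h1 h2] [p1 p2 p3 p4].
- have := mulr_gt0 d h1; lra.
- have := mulr_gt0 d (_ : 0 < 1 - y); lra.
- have := mulr_gt0 d (_ : 0 < - ((1 - b) * (x - a) + (1 - a) * (y - 1))); lra.
- have := mulr_gt0 d (_ : 0 < y - b * x); lra.
Qed.

(** The four wedges cover the complement of the polygon and of the singular rays, and a
point reflected in its tangent vertex does not fall into the polygon: only a singular ray
can stop an orbit. *)
Lemma regular_pointsP x : regular_points lam V x <->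
  forall k, exists i, wedge i (iter k T x).
Proof.
split=> [/not_orP[nP nS] k|H].
  have nSk j : ~ singular_rays V (iter j T x) by move=> Sj; apply: nS; exists j.
  suff : ~ polygon V (iter k T x) by move=> nPk; exact: wedge_ex.
  elim: k => [//|k IH]; have [i wi] := wedge_ex IH (nSk k).
  by rewrite iterS (wedgeE wi); exact: reflect_not_polygon.
move=> [P|[k _ Sk]].
  by have [i wi] := H 0%N; exact: wedge_not_polygon wi P.
by have [i wi] := H k; exact: wedge_not_singular wi Sk.
Qed.

End Quadrilateral.

(** * The trapping zone *)

Section Zone.
Context {R : realType}.
Variables (a b lam len e : R).
Hypotheses (ha : 0 < a < 1) (hb : 0 < b < 1) (lamE : lam = 1 - b).
Hypothesis halam : a < 1 + lam - lam ^+ 3 - lam ^+ 4.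
Hypothesis lenE : lam ^+ 2 * len = 1 + lam - a.
Hypothesis e_gt0 : 0 < e.
Local Notation plane := (R * R)%type.
Local Notation T := (outer_billiard lam (quad a b)).
Local Notation W := (wedge a b).
Local Notation regular := (regular_points lam (quad a b)).
Local Notation code := (vertex_code a b).

(** Three flat boxes: along the line [y = 1] on the left, reaching over the side [AB], along
the line [y = - lam] below the polygon, and along the line [y = 1] to the right of [B].
On them the map is nearly one-dimensional, and it multiplies the distance to these lines by [lam]. *)
Definition zone_upper_left eta (x : plane) :=
  [&& - len + e <= x.1, x.1 <= a - lam ^+ 3 * e & `|x.2 - 1| <= eta].
Definition zone_lower d eta (x : plane) :=
  [&& - d <= x.1, x.1 <= lam * (len - e) & `|x.2 + lam| <= eta].
Definition zone_upper_right d eta (x : plane) :=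
  [&& a + lam ^+ 2 * e <= x.1, x.1 <= 1 + lam + lam * d & `|x.2 - 1| <= eta].

Definition zone d eta x :=
  [|| zone_upper_left eta x, zone_lower d eta x | zone_upper_right d eta x].

(** The third condition is what makes the rightmost box return inside the leftmost one;
it can be met for small parameters exactly when [lam + lam ^+ 2 < len], which is the
hypothesis on [a]. The others control which wedges meet the boxes. *)
Definition admissible (d eta : R) := [/\ 0 <= d, 0 <= eta,
  lam + lam ^+ 2 + (e + lam ^+ 2 * d) <= len, lam ^+ 3 * e <= a &
  [/\ eta < lam ^+ 3 * e, eta < 1 - a & eta + d < lam]].

Variables (d eta : R).
Hypothesis adm : admissible d eta.

Let lam0 : 0 < lam. Proof. by case/andP: hb; rewrite lamE; lra. Qed.
Let lam1 : lam < 1. Proof. by case/andP: hb; rewrite lamE; lra. Qed.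
Let bE : b = 1 - lam. Proof. by rewrite lamE; ring. Qed.
Let a0 : 0 < a. Proof. by case/andP: ha. Qed.
Let a1 : a < 1. Proof. by case/andP: ha. Qed.
Let l2e : 0 < lam ^+ 2 * e. Proof. by rewrite mulr_gt0 ?exprn_gt0. Qed.
Let l3e : 0 < lam ^+ 3 * e. Proof. by rewrite mulr_gt0 ?exprn_gt0. Qed.
Let l3e_le : lam ^+ 3 * e <= lam ^+ 2 * e.
Proof. by rewrite exprS -mulrA ler_piMl // ltW. Qed.
Let la2 : lam * a < lam. Proof. by rewrite gtr_pMr. Qed.

Let T_A x : W vA x -> T x = (- lam * x.1, 1 - lam * (x.2 - 1)).
Proof.
move=> /(wedgeE lam ha hb) ->; rewrite /reflect_vertex /quad /tnth /=.
by congr (_, _); ring.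
Qed.
Let T_B x : W vB x -> T x = ((1 + lam) * a - lam * x.1, 1 - lam * (x.2 - 1)).
Proof.
move=> /(wedgeE lam ha hb) ->; rewrite /reflect_vertex /quad /tnth /=.
by congr (_, _); ring.
Qed.
Let T_C x : W vC x -> T x = (1 + lam - lam * x.1, 1 - lam * (x.2 + lam)).
Proof.
move=> /(wedgeE lam ha hb) ->; rewrite /reflect_vertex /quad /tnth /= bE.
by congr (_, _); ring.
Qed.
Let T_D x : W vD x -> T x = (- lam * x.1, - lam - lam * (x.2 - 1)).
Proof.
move=> /(wedgeE lam ha hb) ->; rewrite /reflect_vertex /quad /tnth /=.
by congr (_, _); ring.
Qed.

Let normM (u : R) h : `|u| <= h -> `|lam * u| <= lam * h.
Proof. by move=> uh; rewrite normrM gtr0_norm // ler_pM2l. Qed.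

Lemma upper_left_wedge i x : zone_upper_left eta x -> W i x ->
  (i = vD /\ x.1 < 0) \/ [/\ i = vA, 0 < x.1 & 1 < x.2].
Proof.
have [_ _ _ _ [_ ea _]] := adm.
case: x => x y /and3P[/= x1 x2]; rewrite ler_norml => /andP[y1 y2].
have xa : x <= a by have := l3e; lra.
have da : 0 <= lam * (a - x) by rewrite mulr_ge0 ?subr_ge0 // ltW.
move: i; apply: ord4P; rewrite /wedge /sideBC /= -?lamE => /andP[h1 h2].
- by right.
- have := mulr_gt0 (_ : 0 < 1 - a) (_ : 0 < 1 - y); have := a1; lra.
- exfalso; have /andP[b0 b1] := hb.
  have bx : b * x <= a * b by rewrite mulrC ler_pM2r.
  by have := a1; have ab : a * b < a by [rewrite gtr_pMr]; lra.
- by left.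
Qed.

Lemma upper_left_wedgeD x : zone_upper_left eta x -> x.1 < 0 -> W vD x.
Proof.
have [_ _ _ _ [_ ea _]] := adm; have /andP[b0 b1] := hb.
case: x => x y /and3P[/= x1 x2]; rewrite ler_norml => /andP[y1 y2] x0.
rewrite /wedge /= x0 /=; have : b * x < 0 by rewrite pmulr_rlt0.
by have := a0; lra.
Qed.

Lemma lower_wedge x : zone_lower d eta x -> W vC x.
Proof.
have [d0 eta0 _ _ [el ea ed]] := adm; have /andP[b0 b1] := hb.
case: x => x y /and3P[/= x1 x2]; rewrite ler_norml => /andP[y1 y2].
rewrite /wedge /sideBC /=; apply/andP; split.
  have := ler_wpM2l (ltW b0) x1; have : b * d <= d by rewrite ler_piMl // ltW.
  by lra.
have := ler_wpM2l (ltW lam0) x2; rewrite mulrA -expr2 mulrBr lenE -lamE => h.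
have h2 : (1 - a) * (y - 1) <= (1 - a) * (eta - lam - 1).
  by apply: ler_wpM2l; [have := a1; lra|lra].
have h3 : a * eta >= 0 by rewrite mulr_ge0 // ltW.
by have := l3e_le; lra.
Qed.

Lemma upper_right_wedge x : zone_upper_right d eta x -> x.2 != 1 ->
  W (if 1 < x.2 then vA else vB) x.
Proof.
have [d0 eta0 _ _ [el ea ed]] := adm; have /andP[b0 b1] := hb.
case: x => x y /and3P[/= x1 x2]; rewrite ler_norml => /andP[y1 y2] y_neq1.
case: ltrgtP y_neq1 => // y_1 _; rewrite /wedge /sideBC /=; first by apply/andP; split => //; have := a0; have := l2e; lra.
rewrite y_1 /= -lamE.
have h1 : lam ^+ 3 * e <= lam * (x - a).
  by rewrite exprS -mulrA ler_pM2l //; lra.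
have h2 : 0 <= a * (1 - y) by apply: mulr_ge0; [exact: ltW|lra].
by lra.
Qed.

Lemma upper_right_regular i x : zone_upper_right d eta x -> W i x -> x.2 != 1.
Proof.
case: x => x y /and3P[/= x1 x2 _]; apply: contraTN => /eqP ->.
move: i; apply: ord4P; rewrite /wedge /sideBC /= -?lamE ?ltxx ?andbF //=.
  apply/negP => /andP[h1 h2]; have : 0 < lam * (x - a) by rewrite mulr_gt0 //; have := l2e; lra.
  by lra.
by apply/negP => /andP[h1 h2]; have := a0; have := l2e; lra.
Qed.

Let e2 : lam * e <= e. Proof. by rewrite ler_piMl // ltW. Qed.

Lemma zone_step i x : zone d eta x -> W i x -> zone d (lam * eta) (T x).
Proof.
have [d0 eta0 cl la3 [el ea ed]] := adm.
have ld : 0 <= lam * d by rewrite mulr_ge0 // ltW.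
have l2 : 0 < lam ^+ 2 by rewrite exprn_gt0.
move=> /or3P[zx|zx|zx] Wx.
- have [[iD x0]|[iA x0 y1]] := upper_left_wedge zx Wx; subst i.
    have /and3P[x1 x2 ye] := zx; rewrite (T_D Wx); apply/or3P/Or32/and3P => /=; split.
    + by have : 0 < - (lam * x.1) by [rewrite -mulrN mulr_gt0 // oppr_gt0]; lra.
    + by rewrite mulNr -mulrN ler_pM2l //; lra.
    + by rewrite addrAC addNr sub0r normrN; exact: normM.
  have /and3P[x1 x2 ye] := zx; rewrite (T_A Wx); apply/or3P/Or31/and3P => /=; split.
  + have : lam * x.1 <= lam * a by rewrite ler_pM2l //; have := l3e; lra.
    have := la2; have : 0 <= lam ^+ 2 * d by rewrite mulr_ge0 // ltW.
    by lra.
  + have : 0 < lam * x.1 by rewrite mulr_gt0.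
    by lra.
  + by rewrite addrAC subrr sub0r normrN; exact: normM.
- rewrite (T_C (lower_wedge zx)); have /and3P[x1 x2 ye] := zx.
  apply/or3P/Or33/and3P => /=; split.
  + by have := ler_wpM2l (ltW lam0) x2; rewrite mulrA -expr2 mulrBr lenE; lra.
  + by have := ler_wpM2l (ltW lam0) x1; lra.
  + by rewrite addrAC subrr sub0r normrN; exact: normM.
- have y_neq1 := upper_right_regular zx Wx; have := upper_right_wedge zx y_neq1.
  have /and3P[x1 x2 ye] := zx.
  have lx := ler_wpM2l (ltW lam0) x2; have lx' := ler_wpM2l (ltW lam0) x1.
  have dd : lam * (1 + lam + lam * d) = lam + lam ^+ 2 + lam ^+ 2 * d by ring.
  have ee : lam * (a + lam ^+ 2 * e) = lam * a + lam ^+ 3 * e by ring.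
  case: ifP => _ WB; [rewrite (T_A WB)|rewrite (T_B WB)]; apply/or3P/Or31/and3P => /=; split.
  + by lra.
  + by have : 0 < lam * a by [rewrite mulr_gt0]; lra.
  + by rewrite addrAC subrr sub0r normrN; exact: normM.
  + by have : 0 < lam * a by [rewrite mulr_gt0]; lra.
  + by lra.
  + by rewrite addrAC subrr sub0r normrN; exact: normM.
Qed.

Lemma zone_weaken d' eta' x : d <= d' -> eta <= eta' -> zone d eta x -> zone d' eta' x.
Proof.
move=> dd ee /or3P[] /and3P[h1 h2 h3]; apply/or3P; [apply: Or31|apply: Or32|apply: Or33];
  apply/and3P; split=> //; try exact: le_trans ee; try lra.
apply: le_trans h2 _; by rewrite lerD2l ler_pM2l.
Qed.

(** The abscissa at which an orbit comes back above the line [y = 1], three steps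
after leaving the abscissa [p] below it. *)
Definition return_abscissa (p : R) := (1 + lam) * a - (lam + lam ^+ 2) - lam ^+ 3 * p.

(** Just below the line, to the left of [A]: every trapped orbit comes back here, after an
excursion through the vertices [D, C, B, A] or [D, C, B, D, C, A]. *)
Definition base (x : plane) := [&& - len + e <= x.1, x.1 < 0, 1 - eta <= x.2 & x.2 < 1].

Let q (x : plane) := return_abscissa x.1.

Lemma base_zone x : base x -> zone_upper_left eta x.
Proof.
have [_ _ _ la3 _] := adm; move=> /and4P[h1 h2 h3 h4]; apply/and3P; split => //; first by lra.
by rewrite ler_norml; apply/andP; split; lra.
Qed.

(** To the left of [A] the tangent vertex is [D] on both sides of the line [y = 1]; the image
is below the polygon, where the tangent vertex is [C]. *)
Lemma left_start x : zone_upper_left eta x -> x.1 < 0 ->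
  [/\ W vD x, W vC (T x), zone_upper_right d eta (T (T x)) &
    T (T x) = (1 + lam + lam ^+ 2 * x.1, 1 + lam ^+ 2 * (x.2 - 1))].
Proof.
move=> zx x0; have /and3P[h1 h2 h3] := zx.
have WD := upper_left_wedgeD zx x0; have TD := T_D WD.
have [d0 eta0 cl la3 [el ea ed]] := adm.
have lx : 0 < - (lam * x.1) by rewrite -mulrN mulr_gt0 // oppr_gt0.
have zl : zone_lower d eta (T x).
  rewrite TD; apply/and3P => /=; split; first by lra.
    by rewrite mulNr -mulrN ler_pM2l //; lra.
  rewrite addrAC addNr sub0r normrN; apply: (@le_trans _ _ (lam * eta)).
    exact: normM.
  by rewrite ler_piMl // ltW.
have WC := lower_wedge zl; have TC := T_C WC.
have E2 : T (T x) = (1 + lam + lam ^+ 2 * x.1, 1 + lam ^+ 2 * (x.2 - 1)).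
  by rewrite TC TD /=; congr (_, _); ring.
split => //; have l2 : 0 < lam ^+ 2 by rewrite exprn_gt0.
rewrite E2; apply/and3P => /=; split.
- by have := ler_wpM2l (ltW l2) h1; rewrite mulrDr mulrN lenE; lra.
- have : lam ^+ 2 * x.1 < 0 by rewrite pmulr_rlt0.
  by have : 0 <= lam * d by [rewrite mulr_ge0 // ltW]; lra.
- rewrite addrAC subrr add0r normrM (gtr0_norm l2) (@le_trans _ _ `|x.2 - 1|) //.
  by apply: ler_piMl => //; apply: exprn_ile1; exact: ltW.
Qed.

Lemma base_start x : base x ->
  [/\ W vD x, W vC (T x), W vB (T (T x)) &
    T (T (T x)) = (q x, 1 - lam ^+ 3 * (x.2 - 1))].
Proof.
move=> Bx; have /and4P[h1 h2 h3 h4] := Bx.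
have [WD WC zr E2] := left_start (base_zone Bx) h2.
have y1 : lam ^+ 2 * (x.2 - 1) < 0 by rewrite pmulr_rlt0 ?exprn_gt0 // subr_lt0.
have WB : W vB (T (T x)).
  have y_neq1 : (T (T x)).2 != 1 by rewrite E2 /= lt_eqF //; lra.
  have := upper_right_wedge zr y_neq1.
  by rewrite ifF // E2 /=; apply/negbTE; rewrite -leNgt; lra.
split => //; rewrite (T_B WB) E2 /q /return_abscissa /=.
by congr (_, _); ring.
Qed.

Lemma return_bounds x : base x ->
  (1 + lam) * a - (lam + lam ^+ 2) < q x /\ q x <= a - lam ^+ 3 * e.
Proof.
move=> /and4P[h1 h2 h3 h4]; have l3 : 0 < lam ^+ 3 by rewrite exprn_gt0.
have n3 : lam ^+ 3 * x.1 < 0 by rewrite pmulr_rlt0.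
have h := ler_wpM2l (ltW l3) h1.
have E : lam ^+ 3 * (- len + e) = - (lam * (lam ^+ 2 * len)) + lam ^+ 3 * e by ring.
rewrite E lenE in h.
by split; rewrite /q /return_abscissa; lra.
Qed.

Let return_zone x : base x -> zone_upper_left eta (T (T (T x))).
Proof.
have [d0 eta0 cl la3 [el ea ed]] := adm.
move=> Bx; have [_ _ _ ->] := base_start Bx; have [q1 q2] := return_bounds Bx.
have /and4P[h1 h2 h3 h4] := Bx.
have l2d : 0 <= lam ^+ 2 * d by rewrite mulr_ge0 // exprn_ge0 // ltW.
have aa : 0 < (1 + lam) * a by rewrite mulr_gt0 // addr_gt0.
apply/and3P; split => //=; first by lra.
have l3 : 0 < lam ^+ 3 by rewrite exprn_gt0.
rewrite addrAC subrr sub0r normrN normrM (gtr0_norm l3) (@le_trans _ _ `|x.2 - 1|) //.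
  by rewrite ler_piMl // expr_le1 // ltW.
by rewrite ler_norml; apply/andP; split; lra.
Qed.

Lemma return_above x : base x -> 1 < (T (T (T x))).2.
Proof.
move=> Bx; have [_ _ _ ->] := base_start Bx; have /and4P[h1 h2 h3 h4] := Bx.
rewrite /= ltrDl oppr_gt0 pmulr_rlt0 ?exprn_gt0 //; lra.
Qed.

Lemma base_short x : base x -> 0 < q x ->
  W vA (T (T (T x))) /\ T (T (T (T x))) = (- lam * q x, 1 + lam ^+ 4 * (x.2 - 1)).
Proof.
move=> Bx q0; have [_ _ _ E3] := base_start Bx; have y1 := return_above Bx.
have WA : W vA (T (T (T x))) by rewrite /wedge /= y1 E3 /= q0.
by split => //; rewrite (T_A WA) E3 /=; congr (_, _); ring.
Qed.

Lemma above_start x : zone_upper_left eta x -> x.1 < 0 -> 1 < x.2 ->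
  [/\ W vD x, W vC (T x), W vA (T (T x)) &
    T (T (T x)) = (- (lam + lam ^+ 2) - lam ^+ 3 * x.1, 1 - lam ^+ 3 * (x.2 - 1))].
Proof.
move=> zx x0 y1; have [WD WC zr E2] := left_start zx x0.
have yy : 1 < (T (T x)).2 by rewrite E2 /= ltrDl mulr_gt0 ?exprn_gt0 // subr_gt0.
have WA : W vA (T (T x)).
  have y_neq1 : (T (T x)).2 != 1 by rewrite gt_eqF.
  by have := upper_right_wedge zr y_neq1; rewrite yy.
split => //; rewrite (T_A WA) E2 /=.
by congr (_, _); ring.
Qed.

Lemma base_long x : base x -> q x < 0 ->
  [/\ W vD (T (T (T x))), W vC (T (T (T (T x)))), W vA (T (T (T (T (T x))))) &
    T (T (T (T (T (T x))))) =
      (- (lam + lam ^+ 2) - lam ^+ 3 * q x, 1 + lam ^+ 6 * (x.2 - 1))].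
Proof.
move=> Bx q0; have [_ _ _ E3] := base_start Bx.
have x0 : (T (T (T x))).1 < 0 by rewrite E3.
have [WD WC WA E6] := above_start (return_zone Bx) x0 (return_above Bx).
by split => //; rewrite E6 E3 /=; congr (_, _); ring.
Qed.

End Zone.

(** * Trapped orbits and their first return map *)

Section TrappedOrbits.
Context {R : realType}.
Variables (a b lam len e : R).
Hypotheses (ha : 0 < a < 1) (hb : 0 < b < 1) (lamE : lam = 1 - b).
Hypothesis halam : a < 1 + lam - lam ^+ 3 - lam ^+ 4.
Hypothesis lenE : lam ^+ 2 * len = 1 + lam - a.
Hypothesis e_gt0 : 0 < e.
Variables (d eta : R).
Hypothesis adm : admissible a lam len e d eta.
Local Notation plane := (R * R)%type.
Local Notation T := (outer_billiard lam (quad a b)).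
Local Notation W := (wedge a b).
Local Notation regular := (regular_points lam (quad a b)).
Local Notation code := (vertex_code a b).
Local Notation q x := (return_abscissa a lam x.1).

Let lam0 : 0 < lam. Proof. by case/andP: hb; rewrite lamE; lra. Qed.
Let lam1 : lam < 1. Proof. by case/andP: hb; rewrite lamE; lra. Qed.

Lemma regular_wedge x : regular x -> exists i, W i x.
Proof. by move=> /(regular_pointsP ha hb lam0)/(_ 0%N). Qed.

Lemma regular_step x : regular x -> regular (T x).
Proof.
move=> /(regular_pointsP ha hb lam0) H; apply/(regular_pointsP ha hb lam0) => k.
by have := H k.+1; rewrite iterSr.
Qed.

Lemma regular_iter n x : regular x -> regular (iter n T x).
Proof. by move=> Rx; apply: (iter_invariant regular_step). Qed.

Definition trapped : set plane := [set x | regular x /\ zone a lam len e d eta x].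
Definition trapped_base : set plane := [set x | regular x /\ base len e eta x].

Lemma zone_step_weak i x : zone a lam len e d eta x -> W i x ->
  zone a lam len e d eta (T x).
Proof.
have [d0 eta0 _ _ _] := adm.
move=> zx /(zone_step ha hb lamE lenE e_gt0 adm zx); apply: (zone_weaken hb lamE) => //.
by rewrite ler_piMl // ltW.
Qed.

Lemma trapped_step x : trapped x -> trapped (T x).
Proof.
move=> [Rx zx]; split; first exact: regular_step.
by have [i Wx] := regular_wedge Rx; exact: zone_step_weak zx Wx.
Qed.

Lemma trapped_base_trapped : trapped_base `<=` trapped.
Proof. by move=> x [Rx /(base_zone adm) zx]; split => //; apply/or3P/Or31. Qed.

Lemma trapped_below x : trapped x -> x.1 < 0 -> 0 < x.2 -> x.2 < 1 -> trapped_base x.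
Proof.
have /andP[a0 a1] := ha; have [d0 eta0 _ _ [_ ea ed]] := adm.
move=> [Rx /or3P[] /and3P[h1 h2]]; rewrite ler_norml => /andP[h3 h4] x0 y0 y1.
- by split => //; apply/and4P; split => //; lra.
- lra.
- have : 0 < lam ^+ 2 * e by rewrite mulr_gt0 ?exprn_gt0.
  lra.
Qed.

Let tau (s : bool) := if s then 6%N else 4%N.
Let s (x : plane) := q x < 0.

(** Returning exactly above [A] means landing on the singular ray through [D] and [A]. *)
Lemma base_q_neq0 x : trapped_base x -> q x != 0.
Proof.
move=> [Rx Bx]; have [WD WC WB E3] := base_start ha hb lamE lenE e_gt0 adm Bx.
have [i W3] := regular_wedge (regular_step (regular_step (regular_step Rx))).
have := zone_step_weak _ WB; have := zone_step_weak _ WC; have := zone_step_weak _ WD.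
have zx : zone a lam len e d eta x by apply/or3P/Or31/(base_zone adm).
move=> /(_ zx) z1 /(_ z1) z2 /(_ z2) z3.
apply/negP => /eqP q0; move: W3; rewrite /= E3 q0 => W3.
have /andP[a0 a1] := ha; have [d0 eta0 _ _ [_ ea ed]] := adm.
have y1 : 0 < 1 - lam ^+ 3 * (x.2 - 1).
  have /and4P[_ _ _ h] := Bx; have : lam ^+ 3 * (x.2 - 1) < 0.
    by rewrite pmulr_rlt0 ?exprn_gt0 // subr_lt0.
  by lra.
move: W3; move: i y1; apply: ord4P; rewrite /wedge /sideBC /= ?ltxx ?mulr0 //= -?lamE => y1.
- move=> /andP[h1 h2]; have /and4P[_ _ _ h] := Bx.
  have : lam ^+ 3 * (x.2 - 1) < 0 by rewrite pmulr_rlt0 ?exprn_gt0 // subr_lt0.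
  by lra.
- by move=> /andP[h1 h2]; have := lt_trans y1 h1; rewrite ltxx.
Qed.

Lemma base_codes x : trapped_base x ->
  [/\ code x = vD, code (iter 1 T x) = vC, code (iter 2 T x) = vB &
    if s x then [/\ code (iter 3 T x) = vD, code (iter 4 T x) = vC & code (iter 5 T x) = vA]
    else code (iter 3 T x) = vA].
Proof.
move=> Bx; have q0 := base_q_neq0 Bx; case: Bx => Rx Bx.
have [WD WC WB E3] := base_start ha hb lamE lenE e_gt0 adm Bx.
have W0 : W vD (iter 0 T x) := WD.
have W1 : W vC (iter 1 T x) := WC.
have W2 : W vB (iter 2 T x) := WB.
rewrite (wedge_code ha hb W0) (wedge_code ha hb W1) (wedge_code ha hb W2); split => //.
rewrite /s; case: ltrgtP q0 => // h _.
  have [W3 W4 W5 _] := base_long ha hb lamE lenE e_gt0 adm Bx h.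
  have W3' : W vD (iter 3 T x) := W3.
  have W4' : W vC (iter 4 T x) := W4.
  have W5' : W vA (iter 5 T x) := W5.
  exact: And3 (wedge_code ha hb W3') (wedge_code ha hb W4') (wedge_code ha hb W5').
have [W3 _] := base_short ha hb lamE lenE e_gt0 adm Bx h.
have W3' : W vA (iter 3 T x) := W3.
exact: (wedge_code ha hb W3').
Qed.

Lemma base_return x : trapped_base x ->
  induced_map T s tau x = if s x
    then (- (lam + lam ^+ 2) - lam ^+ 3 * q x, 1 + lam ^+ 6 * (x.2 - 1))
    else (- lam * q x, 1 + lam ^+ 4 * (x.2 - 1)).
Proof.
move=> Bx; have q0 := base_q_neq0 Bx; case: Bx => Rx Bx.
rewrite /induced_map /s; case: ltrgtP q0 => // h _ /=.
  by have [_ _ _ ->] := base_long ha hb lamE lenE e_gt0 adm Bx h.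
by have [_ ->] := base_short ha hb lamE lenE e_gt0 adm Bx h.
Qed.

Lemma trapped_base_return x : trapped_base x -> trapped_base (induced_map T s tau x).
Proof.
move=> Bx; have E := base_return Bx; have q0 := base_q_neq0 Bx.
have tx : trapped (induced_map T s tau x).
  by apply: (iter_invariant trapped_step); exact: trapped_base_trapped.
have [Rx Bx'] := Bx; have [q1 _] := return_bounds hb lamE lenE Bx'.
have /and4P[h1 h2 h3 h4] := Bx'; have /andP[a0 a1] := ha.
have [d0 eta0 _ _ [_ ea ed]] := adm.
have y0 n : 0 < 1 + lam ^+ n * (x.2 - 1) /\ 1 + lam ^+ n * (x.2 - 1) < 1.
  have ln : 0 < lam ^+ n by rewrite exprn_gt0.
  have ln1 : lam ^+ n <= 1 by apply: exprn_ile1; exact: ltW.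
  split; last by rewrite gtrDl pmulr_rlt0 // subr_lt0.
  have y1 : 0 <= 1 - x.2 by lra.
  by have := ler_wpM2r y1 ln1; lra.
have h3q : - lam ^+ 3 * q x < lam + lam ^+ 2.
  have l3 : 0 < lam ^+ 3 by rewrite exprn_gt0.
  have := ltr_pM2l l3 ((1 + lam) * a - (lam + lam ^+ 2)) (q x); rewrite q1 => h.
  have l2 : 0 < lam ^+ 2 by rewrite exprn_gt0.
  have p1 : 0 < lam ^+ 3 * ((1 + lam) * a) by rewrite !mulr_gt0 // addr_gt0.
  have l31 : lam ^+ 3 * (lam + lam ^+ 2) <= lam + lam ^+ 2.
    have c0 : 0 < lam + lam ^+ 2 by rewrite addr_gt0 ?exprn_gt0.
    have l31 : lam ^+ 3 <= 1 by apply: exprn_ile1; exact: ltW.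
    by apply: ler_piMl => //; exact: ltW.
  have {}h : lam ^+ 3 * ((1 + lam) * a - (lam + lam ^+ 2)) < lam ^+ 3 * q x by rewrite h.
  by move: h; rewrite mulrBr; lra.
apply: trapped_below => //; rewrite E; case: ifP => h /=; try by case: (y0 6%N).
- by lra.
- have q0' : 0 < q x by rewrite lt_neqAle eq_sym q0 leNgt; apply/negP; rewrite -/(s x) h.
  by rewrite mulNr oppr_lt0 mulr_gt0.
- by case: (y0 4%N).
- by case: (y0 4%N).
Qed.

(** A point of the line [y = 1] lies on a singular ray to the right of [A]; to the left of
[A] it is sent in two steps to the part of the line to the right of [B]. *)
Lemma trapped_off_line x : trapped x -> 0 < x.2 -> x.2 != 1.
Proof.
have /andP[a0 a1] := ha; have [d0 eta0 cl la3 [el ea ed]] := adm.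
move=> [Rx /or3P[] zx] y0; have [i Wx] := regular_wedge Rx.
- have [[_ x0]|[_ x0 y1]] := upper_left_wedge ha hb lamE e_gt0 adm zx Wx; last by rewrite gt_eqF.
  have [_ _ zr E2] := left_start ha hb lamE lenE e_gt0 adm zx x0.
  have [j Wj] := regular_wedge (regular_step (regular_step Rx)).
  apply/negP => /eqP y1; have := upper_right_regular ha hb lamE e_gt0 zr Wj.
  by rewrite E2 y1 /= subrr mulr0 addr0 eqxx.
- by move: zx => /and3P[_ _]; rewrite ler_norml => /andP[h3 h4]; rewrite lt_eqF //; lra.
- exact: upper_right_regular zx Wx.
Qed.

Let trapped_height x : trapped x -> 0 < x.2 -> `|x.2 - 1| <= eta.
Proof.
have [d0 eta0 _ _ [_ ea ed]] := adm.
move=> [_ /or3P[] /and3P[_ _]] //; rewrite ler_norml => /andP[h3 h4]; lra.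
Qed.

Let step_A x : W vA x -> T x = (- lam * x.1, 1 - lam * (x.2 - 1)).
Proof.
by move=> /(wedgeE lam ha hb) ->; rewrite /reflect_vertex /quad /tnth /=; congr (_, _); ring.
Qed.

Let step_B x : W vB x -> T x = ((1 + lam) * a - lam * x.1, 1 - lam * (x.2 - 1)).
Proof.
by move=> /(wedgeE lam ha hb) ->; rewrite /reflect_vertex /quad /tnth /=; congr (_, _); ring.
Qed.

Let A_enters x : trapped x -> W vA x -> trapped_base (T x).
Proof.
have /andP[a0 a1] := ha; have [d0 eta0 _ _ [_ ea ed]] := adm.
move=> tx WA; have /andP[x0 y1] := WA.
have := trapped_height tx (lt_trans ltr01 y1); rewrite gtr0_norm ?subr_gt0 // => ye.
have ly : 0 < lam * (x.2 - 1) by rewrite mulr_gt0 // subr_gt0.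
have ly' : lam * (x.2 - 1) <= x.2 - 1.
  by apply: ler_piMl; [rewrite subr_ge0; exact: ltW|exact: ltW].
apply: trapped_below; first exact: trapped_step.
all: rewrite (step_A WA) /= ?mulNr ?oppr_lt0 ?mulr_gt0 //; lra.
Qed.

Let upper_left_enters x : trapped x -> zone_upper_left a lam len e eta x ->
  exists2 j, (j <= 3)%N & trapped_base (iter j T x).
Proof.
have /andP[a0 a1] := ha; have [d0 eta0 cl la3 [el ea ed]] := adm.
move=> tx zx; have [Rx _] := tx; have [i Wx] := regular_wedge Rx.
have [[iD x0]|[iA x0 y1]] := upper_left_wedge ha hb lamE e_gt0 adm zx Wx; last first.
  by exists 1%N => //; apply: A_enters => //; rewrite -iA.
have /and3P[x1 _] := zx; rewrite ler_norml => /andP[y1 y2].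
have y0 : 0 < x.2 by lra.
case: (ltrgtP x.2 1) (trapped_off_line tx y0) => // h _.
  by exists 0%N => //; exact: trapped_below.
have [WD WC WA E3] := above_start ha hb lamE lenE e_gt0 adm zx x0 h.
by exists 3%N => //; apply: A_enters => //; do 2 apply: trapped_step.
Qed.

Lemma trapped_enters x : trapped x -> exists2 j, (j <= 6)%N & trapped_base (iter j T x).
Proof.
have /andP[a0 a1] := ha; have [d0 eta0 cl la3 [el ea ed]] := adm.
have l3e : 0 < lam ^+ 3 * e by rewrite mulr_gt0 ?exprn_gt0.
have l2e : 0 < lam ^+ 2 * e by rewrite mulr_gt0 ?exprn_gt0.
have right x' : trapped x' -> zone_upper_right a lam e d eta x' ->
    exists2 j, (j <= 4)%N & trapped_base (iter j T x').
  move=> tx zx; have /and3P[x1 x2] := zx; rewrite ler_norml => /andP[y1 y2].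
  have y0 : 0 < x'.2 by lra.
  have := upper_right_wedge ha hb lamE e_gt0 adm zx (trapped_off_line tx y0).
  case: ifP => y_1 Wx; first by exists 1%N => //; exact: A_enters.
  have TB := step_B Wx; have tTx := trapped_step tx.
  have yT : 1 <= (T x').2.
    by rewrite TB /= lerDl oppr_ge0 pmulr_rle0 // subr_le0 leNgt y_1.
  have xT : (T x').1 < a + lam ^+ 2 * e.
    have lx := ler_wpM2l (ltW lam0) x1; rewrite TB /=.
    have : 0 < lam * (lam ^+ 2 * e) by rewrite mulr_gt0.
    by lra.
  have [_ /or3P[zT|/and3P[_ _]|/and3P[h _ _]]] := tTx.
  - have [j j3 Bj] := upper_left_enters tTx zT.
    by exists j.+1 => //; rewrite iterSr.
  - by rewrite ler_norml => /andP[_ h]; exfalso; lra.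
  - by exfalso; lra.
move=> tx; have [_ /or3P[zx|zx|zx]] := tx.
- have [j j3 Bj] := upper_left_enters tx zx.
  by exists j => //; apply: leq_trans j3 _.
- have WC := lower_wedge ha hb lamE lenE e_gt0 adm zx.
  have TC : T x = (1 + lam - lam * x.1, 1 - lam * (x.2 + lam)).
    rewrite (wedgeE lam ha hb WC) /reflect_vertex /quad /tnth /= lamE.
    by congr (_, _); ring.
  have tTx := trapped_step tx; have /and3P[x1 x2 y1] := zx.
  have yT : 0 < (T x).2.
    have : `|lam * (x.2 + lam)| <= eta.
      by rewrite normrM gtr0_norm // (le_trans _ y1) // ler_piMl // ltW.
    by rewrite TC /= ler_norml => /andP[h1 h2]; lra.
  have xT : a - lam ^+ 3 * e < (T x).1.
    have := ler_wpM2l (ltW lam0) x2; rewrite mulrA -expr2 mulrBr lenE TC /=.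
    by lra.
  have [_ /or3P[/and3P[_ h _]|/and3P[_ _]|zT]] := tTx.
  - by exfalso; lra.
  - by rewrite ler_norml => /andP[_ h]; exfalso; lra.
  - have [j j4 Bj] := right _ tTx zT.
    by exists j.+1; [apply: (@leq_trans 5)|rewrite iterSr].
- have [j j4 Bj] := right _ tx zx.
  by exists j => //; apply: leq_trans j4 _.
Qed.

(** The return map is increasing on each side of its discontinuity and sends the points on
the right of it below the points on the left: it preserves the cyclic order, as a rotation
does. Hence the visits of two orbits to one side can never differ by more than one. *)
Lemma trapped_visits x y : trapped_base x -> trapped_base y -> x.1 <= y.1 ->
  forall n, (visits (induced_map T s tau) s n x <= visits (induced_map T s tau) s n y
    <= (visits (induced_map T s tau) s n x).+1)%N.
Proof.
move=> Bx By xy n; elim: n x y Bx By xy => [|n IH] x y Bx By xy.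
  by rewrite /visits !big_ord0.
have Bgx := trapped_base_return Bx; have Bgy := trapped_base_return By.
have vS z : visits (induced_map T s tau) s n.+1 z =
    (s z + visits (induced_map T s tau) s n (induced_map T s tau z))%N.
  rewrite /visits big_ord_recl /=; congr (_ + _)%N.
  by apply: eq_bigr => i _; rewrite -iterSr.
have l3 : 0 < lam ^+ 3 by rewrite exprn_gt0.
have l3xy : lam ^+ 3 * x.1 <= lam ^+ 3 * y.1 by rewrite ler_pM2l.
have qxy : q y <= q x by rewrite /return_abscissa; lra.
have Ex := base_return Bx; have Ey := base_return By; rewrite !vS.
case sx: (s x) Ex => Ex; case sy: (s y) Ey => Ey.
- have := IH _ _ Bgx Bgy; rewrite Ex Ey /= !add1n !ltnS; apply.
  by rewrite lerD2l lerN2 ler_pM2l.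
- by exfalso; move: sx sy; rewrite /s => h; rewrite (le_lt_trans qxy h).
- have := IH _ _ Bgy Bgx; rewrite Ex Ey /= add1n add0n => IH'.
(* The two images are in the opposite order; the hypothesis on [a] enters here. *)
  have prem : - (lam + lam ^+ 2) - lam ^+ 3 * q y <= - lam * q x.
    have [_ q1] := return_bounds hb lamE lenE Bx.2.
    have [q2 _] := return_bounds hb lamE lenE By.2.
    have l3e : 0 < lam ^+ 3 * e by rewrite mulr_gt0.
    have lq : lam * q x <= lam * a by rewrite ler_pM2l //; lra.
    have l3q : lam ^+ 3 * ((1 + lam) * a - (lam + lam ^+ 2)) <= lam ^+ 3 * q y.
      by rewrite ler_pM2l // ltW.
    have /andP[a0 a1] := ha.
    have key : 0 < lam * (1 + lam - lam ^+ 3 - lam ^+ 4 - a) by rewrite mulr_gt0 // subr_gt0.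
    have pa : 0 < lam ^+ 3 * ((1 + lam) * a) by rewrite !mulr_gt0 // addr_gt0.
    by move: l3q; rewrite mulrBr; lra.
  by have /andP[v1 v2] := IH' prem; rewrite v2 ltnS v1.
- have := IH _ _ Bgx Bgy; rewrite Ex Ey /= !add0n; apply.
  by rewrite !mulNr lerN2 ler_pM2l.
Qed.

Lemma trapped_bounded_discrepancy k (M : R) (f : plane -> R) :
  (forall x, trapped x -> `|f x| <= M) ->
  code_determined T code trapped k f -> bounded_discrepancy T trapped f.
Proof.
apply: (@induced_bounded_discrepancy R plane _ T code trapped trapped_base s tau 6).
- exact: trapped_step.
- exact: trapped_base_trapped.
- exact: trapped_base_return.
- by case.
- exact: trapped_enters.
- move=> x y Bx By sxy; have [x0 x1 x2 x3] := base_codes Bx; have [y0 y1 y2 y3] := base_codes By.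
  move: x3 y3; rewrite -sxy; case: (s x).
    move=> [x3 x4 x5] [y3 y4 y5] [|[|[|[|[|[|i]]]]]] i6.
    + exact: etrans x0 (esym y0).
    + exact: etrans x1 (esym y1).
    + exact: etrans x2 (esym y2).
    + exact: etrans x3 (esym y3).
    + exact: etrans x4 (esym y4).
    + exact: etrans x5 (esym y5).
    + by exfalso; clear -i6.
  move=> x3 y3 [|[|[|[|i]]]] i4.
  + exact: etrans x0 (esym y0).
  + exact: etrans x1 (esym y1).
  + exact: etrans x2 (esym y2).
  + exact: etrans x3 (esym y3).
  + by exfalso; clear -i4.
- move=> x y Bx By; case: (lerP x.1 y.1) => [|/ltW] h; [left|right]; exact: trapped_visits.
Qed.

Lemma trapped_contract x y : trapped x -> trapped y -> code x = code y ->
  `|T x - T y| <= lam * `|x - y|.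
Proof.
move=> [Rx _] [Ry _]; have [i Wx] := regular_wedge Rx; have [j Wy] := regular_wedge Ry.
rewrite (wedge_code ha hb Wx) (wedge_code ha hb Wy) => ij; subst j.
rewrite (wedgeE lam ha hb Wx) (wedgeE lam ha hb Wy) /reflect_vertex.
have -> : ((1 + lam) * (quad a b i).1 - lam * x.1, (1 + lam) * (quad a b i).2 - lam * x.2) -
    ((1 + lam) * (quad a b i).1 - lam * y.1, (1 + lam) * (quad a b i).2 - lam * y.2) =
    - lam *: (x - y) :> plane.
  by congr (_, _); rewrite /= /GRing.scale /=; ring.
by rewrite normrZ normrN gtr0_norm.
Qed.

Lemma trapped_bounded : exists D : R, forall x, trapped x -> `|x| <= D.
Proof.
have [d0 eta0 _ _ [_ ea ed]] := adm; have /andP[a0 a1] := ha.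
have ll : 0 < lam * lam by rewrite mulr_gt0.
exists (`|len| + e + a + lam * (`|len| + e) + d + 3) => x [_ zx].
have l0 := lam0; have l1 := lam1; have h0 := ler_norm len; have h1 := ler_norm (- len); rewrite normrN in h1.
have e2 : lam ^+ 2 * e <= e by apply: ler_piMl; [exact: ltW|apply: exprn_ile1; exact: ltW].
have l3e : 0 < lam ^+ 3 * e by rewrite mulr_gt0 ?exprn_gt0.
have l2e : 0 < lam ^+ 2 * e by rewrite mulr_gt0 ?exprn_gt0.
have n0 : 0 <= `|len| by [].
have m1 : 0 <= lam * `|len| by rewrite mulr_ge0 // ltW.
have m2 : 0 <= lam * e by rewrite mulr_ge0 // ltW.
have m3 : lam * (len - e) <= lam * (`|len| + e) by rewrite ler_pM2l //; lra.
have m4 : lam * d <= d by rewrite ler_piMl // ltW.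
rewrite plane_norm_le; move: zx => /or3P[] /and3P[]; rewrite !ler_norml => ? ? /andP[? ?];
  apply/andP; split; apply/andP; split; lra.
Qed.

End TrappedOrbits.

(** * Existence of regular points *)

Section ExistenceOfRegularPoints.
Context {R : realType}.
Variables (a b lam len e : R).
Hypotheses (ha : 0 < a < 1) (hb : 0 < b < 1) (lamE : lam = 1 - b).
Hypothesis halam : a < 1 + lam - lam ^+ 3 - lam ^+ 4.
Hypothesis lenE : lam ^+ 2 * len = 1 + lam - a.
Hypothesis e_gt0 : 0 < e.
Variables (d eta : R).
Hypothesis adm : admissible a lam len e d eta.
Hypothesis eta_gt0 : 0 < eta.
Local Notation plane := (R * R)%type.
Local Notation T := (outer_billiard lam (quad a b)).
Local Notation W := (wedge a b).
Local Notation regular := (regular_points lam (quad a b)).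
Local Notation q := (return_abscissa a lam).

Let lam0 : 0 < lam. Proof. by case/andP: hb; rewrite lamE; lra. Qed.
Let lam1 : lam < 1. Proof. by case/andP: hb; rewrite lamE; lra. Qed.
Local Notation c := (lam + lam ^+ 2).

(** The return map read on abscissas, which does not depend on the height. *)
Let G (p : R) := if 0 < q p then - lam * q p else - c - lam ^+ 3 * q p.

Let dom (p : R) := - c <= p < 0.

Let c_le : - len + e <= - c.
Proof.
have [d0 _ cl _ _] := adm.
by have : 0 <= lam ^+ 2 * d by [rewrite mulr_ge0 // exprn_ge0 // ltW]; lra.
Qed.

Let base_of p y : dom p -> 1 - eta <= y < 1 -> base len e eta (p, y).
Proof.
move=> /andP[p1 p2] /andP[y1 y2]; apply/and4P; split => //=.
exact: le_trans c_le p1.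
Qed.

Let q_dom p : dom p -> (1 + lam) * a - c < q p /\ q p < a.
Proof.
move=> hp; have y1 : 1 - eta <= 1 - eta < 1 by rewrite lexx gtrBl eta_gt0.
have [h1 h2] := return_bounds hb lamE lenE (base_of hp y1).
have : 0 < lam ^+ 3 * e by rewrite mulr_gt0 ?exprn_gt0.
by split => //; lra.
Qed.

Let G_dom p : dom p -> dom (G p).
Proof.
move=> hp; have [q1 q2] := q_dom hp; have /andP[a0 a1] := ha.
have l3 : 0 < lam ^+ 3 by rewrite exprn_gt0.
have l2 : 0 < lam ^+ 2 by rewrite exprn_gt0.
rewrite /G /dom; case: ltP => q0.
  rewrite mulNr oppr_lt0 mulr_gt0 // andbT lerN2.
  have : lam * q p <= lam by rewrite ler_piMr ?ltW //; lra.
  by lra.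
apply/andP; split.
  have : lam ^+ 3 * q p <= 0 by rewrite pmulr_rle0.
  by lra.
have l31 : lam ^+ 3 < 1 by rewrite exprn_ilt1 // ltW.
have h := ltr_pM2l l3 ((1 + lam) * a - c) (q p); rewrite q1 in h.
have p1 : 0 < lam ^+ 3 * ((1 + lam) * a) by rewrite !mulr_gt0 // addr_gt0.
have p2 : lam ^+ 3 * c < c by rewrite gtr_pMl // addr_gt0.
have {}h : lam ^+ 3 * ((1 + lam) * a - c) < lam ^+ 3 * q p by rewrite h.
by move: h; rewrite mulrBr; lra.
Qed.

Let G_inj p p' : dom p -> dom p' -> G p = G p' -> p = p'.
Proof.
have l3 : 0 < lam ^+ 3 by rewrite exprn_gt0.
have qinj x y : q x = q y -> x = y.
  rewrite /return_abscissa => /addrI/oppr_inj/mulfI; apply.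
  by rewrite gt_eqF.
have lr x y : dom x -> dom y -> 0 < q x -> q y <= 0 -> - c - lam ^+ 3 * q y < - lam * q x.
  move=> hx hy qx qy; have [_ q1] := q_dom hx; have [q2 _] := q_dom hy.
  have lq : lam * q x < lam * a by rewrite ltr_pM2l.
  have l3q : lam ^+ 3 * ((1 + lam) * a - c) < lam ^+ 3 * q y by rewrite ltr_pM2l.
  have /andP[a0 a1] := ha.
  have key : 0 < lam * (1 + lam - lam ^+ 3 - lam ^+ 4 - a) by rewrite mulr_gt0 // subr_gt0.
  have pa : 0 < lam ^+ 3 * ((1 + lam) * a) by rewrite !mulr_gt0 // addr_gt0.
  by move: l3q; rewrite mulrBr; lra.
move=> hp hp'; rewrite /G; case: ltP => h; case: ltP => h'.
- by move=> /mulfI; rewrite oppr_eq0 gt_eqF // => /(_ isT)/qinj.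
- by move=> E; have := lr _ _ hp hp' h h'; rewrite E ltxx.
- by move=> E; have := lr _ _ hp' hp h' h; rewrite E ltxx.
- by move=> /addrI/oppr_inj/mulfI; rewrite gt_eqF // => /(_ isT)/qinj.
Qed.

Let iterG_dom n p : dom p -> dom (iter n G p).
Proof. by move=> hp; elim: n => //= n; exact: G_dom. Qed.

Let iterG_inj n p p' : dom p -> dom p' -> iter n G p = iter n G p' -> p = p'.
Proof.
move=> hp hp'; elim: n => // n IH /= E; apply: IH.
by apply: G_inj E; exact: iterG_dom.
Qed.

(** The abscissas whose orbit meets a singular ray are the preimages of one point
under the iterates of an injective map, hence countable. *)
Let good_abscissa : exists2 p, dom p & forall n, q (iter n G p) != 0.
Proof.
have l3 : 0 < lam ^+ 3 by rewrite exprn_gt0.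
apply: contrapT => H.
have cov : `[- c, 0%R[%classic `<=` \bigcup_n [set p | dom p /\ q (iter n G p) = 0].
  move=> p; rewrite /= in_itv /= => hp; apply: contrapT => H'; apply: H; exists p => //.
  by move=> n; apply/eqP => qn; apply: H'; exists n.
have cnt : countable (`[- c, 0%R[%classic : set R).
  apply: sub_countable (subset_card_le cov) _; apply: bigcup_countable => //.
  move=> n _; apply: finite_set_countable.
  have [[p0 [hp0 q0]]|no] := pselect (exists p, dom p /\ q (iter n G p) = 0).
    apply: (@sub_finite_set _ _ [set p0]) => //; move=> p [hp qp] /=.
    apply: (iterG_inj hp hp0 (n := n)).
    move: q0; rewrite -qp /return_abscissa => /addrI/oppr_inj/mulfI -> //.
    by rewrite gt_eqF.
  by apply: (@sub_finite_set _ _ set0) => // p hp; apply: no; exists p.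
have := countable_lebesgue_measure0 cnt; rewrite lebesgue_measure_itv /= lte_fin.
have c0 : 0 < c by rewrite addr_gt0 ?exprn_gt0.
by rewrite oppr_lt0 c0 opprK add0e => -[] /eqP; rewrite gt_eqF.
Qed.

Let return_ex p y : dom p -> 1 - eta <= y < 1 -> q p != 0 ->
  exists k y', [/\ (0 < k)%N, 1 - eta <= y' < 1, iter k T (p, y) = (G p, y') &
    forall i, (i < k)%N -> exists v, W v (iter i T (p, y))].
Proof.
move=> hp hy q0; have Bx := base_of hp hy.
have yn n : 1 - eta <= 1 + lam ^+ n * (y - 1) < 1.
  have /andP[y1 y2] := hy; have ln : 0 < lam ^+ n by rewrite exprn_gt0.
  have ln1 : lam ^+ n <= 1 by apply: exprn_ile1; exact: ltW.
  apply/andP; split; last by rewrite gtrDl pmulr_rlt0 // subr_lt0.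
  have y3 : 0 <= 1 - y by lra.
  by have := ler_wpM2r y3 ln1; lra.
have [W0 W1 W2 _] := base_start ha hb lamE lenE e_gt0 adm Bx.
case: ltrgtP q0 => // qp _.
- have [W3 W4 W5 E] := base_long ha hb lamE lenE e_gt0 adm Bx qp.
  exists 6%N, (1 + lam ^+ 6 * (y - 1)); split => //.
    by rewrite [LHS]E /G ltNge (ltW qp).
  move=> [|[|[|[|[|[|i]]]]]] i6; last by exfalso; clear -i6.
  - by exists vD; exact: W0.
  - by exists vC; exact: W1.
  - by exists vB; exact: W2.
  - by exists vD; exact: W3.
  - by exists vC; exact: W4.
  - by exists vA; exact: W5.
- have [W3 E] := base_short ha hb lamE lenE e_gt0 adm Bx qp.
  exists 4%N, (1 + lam ^+ 4 * (y - 1)); split => //.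
    by rewrite [LHS]E /G qp.
  move=> [|[|[|[|i]]]] i4; last by exfalso; clear -i4.
  - by exists vD; exact: W0.
  - by exists vC; exact: W1.
  - by exists vB; exact: W2.
  - by exists vA; exact: W3.
Qed.

Lemma regular_base_ex : exists x, trapped_base a b lam len e eta x.
Proof.
have [p hp qn] := good_abscissa.
exists (p, 1 - eta); split; last by apply: base_of => //; rewrite lexx gtrBl eta_gt0.
apply/(regular_pointsP ha hb lam0) => k.
suff orbit_wedge j p0 y : dom p0 -> (forall n, q (iter n G p0) != 0) -> 1 - eta <= y < 1 ->
    exists i, W i (iter j T (p0, y)).
  by apply: orbit_wedge => //; rewrite lexx gtrBl eta_gt0.
elim/ltn_ind: j p0 y => {}k IH p0 y hp0 {}qn y0.
have [j [y' [j0 hy' E Wj]]] := return_ex hp0 y0 (qn 0%N).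
case: (ltnP k j) => kj; first exact: Wj.
rewrite -(subnK kj) iterD E; apply: IH.
- by rewrite ltn_subrL j0 (leq_trans j0 kj).
- exact: G_dom.
- by move=> n; rewrite -iterSr.
- exact: hy'.
Qed.

End ExistenceOfRegularPoints.

(** * Capture of all orbits *)

Section GlobalCapture.
Context {R : realType}.
Variables (a b lam len e d eta : R).
Hypotheses (ha : 0 < a < 1) (ha' : 4 / 10 <= a <= 5 / 10) (hb : b = 4 / 10).
Hypotheses (lamE : lam = 1 - b) (lenE : lam ^+ 2 * len = 1 + lam - a).
Hypotheses (e1 : e <= 1) (eta_gt0 : 0 < eta).
Hypothesis la3 : lam ^+ 3 * e <= a.
Local Notation plane := (R * R)%type.
Local Notation T := (outer_billiard lam (quad a b)).
Local Notation W := (wedge a b).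
Local Notation regular := (regular_points lam (quad a b)).

Let lamV : lam = 6 / 10. Proof. by rewrite lamE hb; lra. Qed.
Let hb' : 0 < b < 1. Proof. by rewrite hb; lra. Qed.

(** The map sends the coordinates to the unit interval scaled by [1 + lam = 8 / 5], minus
[3 / 5] of their value; the interval from [- 3 / 2] to [5 / 2] is invariant under this, and
the distance to it is contracted. *)
Definition centered_box r (x : plane) :=
  [&& - (3 / 2) - r <= x.1, x.1 <= 5 / 2 + r, - (3 / 2) - r <= x.2 & x.2 <= 5 / 2 + r].

Let step i x : W i x -> T x = reflect_vertex a b lam i x.
Proof. exact: wedgeE. Qed.

Lemma centered_box_step r i x : centered_box r x -> W i x -> centered_box (6 / 10 * r) (T x).
Proof.
move=> /and4P[x1 x2 y1 y2] Wx; rewrite (step Wx) lamV.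
have /andP[a0 a1] := ha; clear Wx.
by apply/and4P; split; move: i; apply: ord4P;
  rewrite /reflect_vertex /quad /tnth /= ?hb; lra.
Qed.

Local Notation box := (centered_box (1 / 10)).

Lemma box_step i x : box x -> W i x -> box (T x).
Proof.
move=> Bx Wx; have /and4P[x1 x2 y1 y2] := centered_box_step Bx Wx.
by apply/and4P; split; lra.
Qed.

(** A step through [C] cannot follow another one. After [B] a point is above the line
[y = 1], after [A] it is below, but in the box not far enough for [C] to be tangent. *)
Lemma box_before_C i x : box x -> W i x -> W vC (T x) -> i = vD.
Proof.
move=> /and4P[x1 x2 y1 y2] Wx; rewrite (step Wx).
have /andP[a0 a1] := ha'.
move: i Wx; apply: ord4P => //;
  rewrite /wedge /reflect_vertex /sideBC /quad /tnth /= lamV hb => /andP[h1 h2] /andP[h3 h4];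
  exfalso; try lra.
Qed.

(** After [D] the abscissa is positive, and in the box the point is too low for [A] or [B]. *)
Lemma box_after_D j x : box x -> W vD x -> W j (T x) -> j = vC.
Proof.
move=> /and4P[x1 x2 y1 y2] Wx; rewrite (step Wx).
have /andP[a0 a1] := ha'.
move: j Wx; apply: ord4P => //;
  rewrite /wedge /reflect_vertex /sideBC /quad /tnth /= lamV hb => /andP[h1 h2] /andP[h3 h4];
  exfalso; try lra; nra.
Qed.

Lemma regular_reaches_box x : regular x -> exists n, box (iter n T x).
Proof.
move=> Rx.
have Bn n : centered_box ((6 / 10) ^+ n * (`|x.1| + `|x.2|)) (iter n T x).
  elim: n => [|n IH].
    rewrite expr0 mul1r /=; have := ler_norm x.1; have := ler_norm (- x.1).
    have := ler_norm x.2; have := ler_norm (- x.2); rewrite !normrN => h1 h2 h3 h4.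
    have n1 := normr_ge0 x.1; have n2 := normr_ge0 x.2.
    by apply/and4P; split; lra.
  have [i Wi] := regular_wedge ha hb' lamE (regular_iter ha hb' lamE (n := n) Rx).
  by rewrite iterS exprS -mulrA; exact: centered_box_step IH Wi.
have [N HN] := @expr_lt_eventually R (6 / 10) (`|x.1| + `|x.2|) (1 / 10) ltac:(lra) ltac:(lra).
exists N; have h := HN _ (leqnn N); have /and4P[x1 x2 y1 y2] := Bn N.
by apply/and4P; split; lra.
Qed.

(** Away from [C] the height is compared with that of the line [y = 1]. A step through [A]
or [B] multiplies the distance to this line by [- 3 / 5]; a step through [D] is followed by
one through [C], and both together multiply it by [9 / 25]. *)
Let level h (x : plane) := [/\ regular x, box x, ~~ W vC x & `|x.2 - 1| <= h].

Let level_ex x : regular x -> exists n h, level h (iter n T x).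
Proof.
move=> Rx; have [n Bn] := regular_reaches_box Rx; have Rn := regular_iter ha hb' lamE (n := n) Rx.
have [i Wi] := regular_wedge ha hb' lamE Rn.
case C: (W vC (iter n T x)); last by exists n, `|(iter n T x).2 - 1|; split => //; rewrite C.
exists n.+1, `|(iter n.+1 T x).2 - 1|; split => //.
- exact: regular_iter.
- exact: box_step Bn Wi.
- by apply/negP => C'; have := box_before_C Bn C C'.
Qed.

Let level_step h x : level h x -> exists n, level (6 / 10 * h) (iter n T x).
Proof.
move=> [Rx Bx nC hx]; have [i Wi] := regular_wedge ha hb' lamE Rx.
have hM r : 0 <= r -> r <= 6 / 10 -> `|r * (x.2 - 1)| <= 6 / 10 * h.
  move=> r0 r1; rewrite normrM ger0_norm //.
  by apply: ler_pM.
have RT := regular_step ha hb' lamE Rx; have BT := box_step Bx Wi.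
have [j Wj] := regular_wedge ha hb' lamE RT.
case D: (W vD x).
  have jC := box_after_D Bx D Wj; subst j.
  exists 2%N; split => /=.
  - exact: (regular_step ha hb' lamE).
  - exact: box_step BT Wj.
  - by apply/negP => C'; have := box_before_C BT Wj C'.
  - rewrite (step Wj) (step D) /reflect_vertex /quad /tnth /= lamV hb.
    have := hM (36 / 100) ltac:(lra) ltac:(lra).
    by congr (`|_| <= _); lra.
exists 1%N; split => //=.
- apply/negP => C; have iD := box_before_C Bx Wi C.
  by move: D; rewrite -iD Wi.
- have := hM (6 / 10) ltac:(lra) ltac:(lra).
  rewrite -normrN (step Wi); congr (`|_| <= _).
  move: i Wi; apply: ord4P; rewrite ?D ?(negbTE nC) // => Wi;
    rewrite /reflect_vertex /quad /tnth /= lamV; lra.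
Qed.

Let level_small x : regular x -> exists n, level eta (iter n T x).
Proof.
move=> /level_ex[n [h hn]].
have lev k : exists m, level ((6 / 10) ^+ k * h) (iter m T x).
  elim: k => [|k [m]]; first by exists n; rewrite mul1r.
  move=> /level_step[j]; rewrite -iterD mulrA -exprS; by exists (j + m)%N.
have [N HN] := @expr_lt_eventually R (6 / 10) h eta ltac:(lra) eta_gt0.
have [m [h1 h2 h3 h4]] := lev N; exists m; split => //.
by apply: le_trans h4 (ltW _); exact: HN.
Qed.

Let len_ge : 3 <= len.
Proof.
have /andP[a0 a1] := ha'.
by move: lenE; rewrite lamV => ?; lra.
Qed.

Let level_left x : level eta x -> x.1 <= a - lam ^+ 3 * e -> zone a lam len e d eta x.
Proof.
move=> [_ /and4P[x1 _ _ _] _ hx] xa; apply/or3P/Or31/and3P; split => //.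
by have := len_ge; move: e1; lra.
Qed.

Let level_A x : level eta x -> W vA x -> zone a lam len e d eta (T x).
Proof.
move=> [Rx Bx nC hx] WA; have /and4P[x1 x2 _ _] := Bx; have /andP[x0 y1] := WA.
have L := len_ge; have E1 := e1; rewrite (step WA) /reflect_vertex /quad /tnth /= lamV.
apply/or3P/Or31/and3P; split => /=; first by lra.
  by move: la3; rewrite lamV; lra.
have -> : (1 + 6 / 10) * 1 - 6 / 10 * x.2 - 1 = - (6 / 10 * (x.2 - 1)) by lra.
rewrite normrN normrM ger0_norm; last lra.
by have := normr_ge0 (x.2 - 1); lra.
Qed.

(** The orbit approaches the line [y = 1]. In the box, a point close to this line and with
negative abscissa is in the zone; if the abscissa is not negative the orbit turns around
[A] or [B], and the next one or two steps lead into the zone. *)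
Lemma regular_captured x : regular x -> exists n, zone a lam len e d eta (iter n T x).
Proof.
move=> Rx; have [n Ln] := level_small Rx; set y := iter n T x in Ln.
have [Ry By nC hy] := Ln; have [i Wi] := regular_wedge ha hb' lamE Ry.
have left z : z.1 < 0 -> z.1 <= a - lam ^+ 3 * e by move: la3; lra.
case: (ltP y.1 0) => y0; first by exists n; apply: level_left => //; exact: left.
move: i Wi; apply: ord4P => Wi.
- by exists n.+1; exact: level_A.
- have /andP[y1 sy] := Wi; have RT := regular_step ha hb' lamE Ry.
  have [j Wj] := regular_wedge ha hb' lamE RT.
  have LT : level eta (T y).
    have [h1 h2 h3 h4] := Ln; split => //; first exact: box_step By Wi.
      by apply/negP => C; have := box_before_C By Wi C.
    rewrite (step Wi) /reflect_vertex /quad /tnth /= lamV.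
    have -> : (1 + 6 / 10) * 1 - 6 / 10 * y.2 - 1 = - (6 / 10 * (y.2 - 1)) by lra.
    rewrite normrN normrM ger0_norm; last lra.
    by have := normr_ge0 (y.2 - 1); lra.
  have yT : 1 < (T y).2 by rewrite (step Wi) /reflect_vertex /quad /tnth /= lamV; lra.
  have [_ _ nCT _] := LT.
  move: j Wj; apply: ord4P => Wj.
  + by exists n.+2; exact: level_A.
  + by have /andP[h _] := Wj; exfalso; lra.
  + by rewrite Wj in nCT.
  + by exists n.+1; apply: level_left => //; apply: left; have /andP[] := Wj.
- by rewrite Wi in nC.
- by have /andP[h _] := Wi; exfalso; lra.
Qed.

End GlobalCapture.

(** * Unique ergodicity of coded contractions *)

Section CompactSets.
Context {R : realType}.
Local Notation plane := (R * R)%type.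

Lemma compact_seq_cluster (C : set plane) (u : nat -> plane) : compact C ->
  (forall n, C (u n)) -> exists2 p, C p &
    forall e : R, 0 < e -> forall N, exists2 n, (N <= n)%N & `|p - u n| < e.
Proof.
move=> cC uC; have [p [Cp clp]] : C `&` cluster (u @ \oo) !=set0.
  by apply: cC; exists 0%N => // n _; exact: uC.
by exists p => //; exact/plane_clusterP.
Qed.

Let within_dist (C : set plane) (phi : plane -> R) p (e : R) :
  {within C, continuous phi} -> C p -> 0 < e ->
  exists2 r : R, 0 < r & forall y, C y -> `|p - y| < r -> `|phi p - phi y| < e.
Proof.
move=> /subspace_continuousP/(_ p) cphi Cp e0; have /cvgrPdist_lt/(_ _ e0) := cphi Cp.
rewrite near_withinE -/(nbhs _ _) => /nbhs_ballP[r /= r0 Hr].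
by exists r => // y Cy h; apply: Hr => //; exact/plane_ballE.
Qed.

Lemma compact_continuous_bounded (C : set plane) (phi : plane -> R) : compact C ->
  {within C, continuous phi} -> exists M : R, forall x, C x -> `|phi x| <= M.
Proof.
move=> cC cphi; apply: contrapT => H.
have /choice[u Hu] : forall n : nat, exists x, C x /\ n%:R < `|phi x|.
  move=> n; apply: contrapT => no; apply: H; exists n%:R => x Cx.
  by rewrite leNgt; apply/negP => h; apply: no; exists x.
have [p Cp clp] := compact_seq_cluster cC (fun n => (Hu n).1).
have [r r0 Hr] := within_dist cphi Cp ltr01.
have [N HN] := natr_above (`|phi p| + 1).
have [n Nn h] := clp _ r0 N; have [Cu hu] := Hu n.
have := Hr _ Cu h; rewrite distrC => h'.
have : n%:R < `|phi p| + 1.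
  rewrite (lt_trans hu) // -[phi (u n)](subrK (phi p)) addrC.
  by rewrite (le_lt_trans (ler_normD _ _)) // ltrD2l.
have : N%:R <= n%:R :> R by rewrite ler_nat.
by lra.
Qed.

Lemma compact_uniformly_continuous (C : set plane) (phi : plane -> R) : compact C ->
  {within C, continuous phi} -> uniformly_continuous_on C phi.
Proof.
move=> cC cphi e e0; apply: contrapT => H.
have /choice[u Hu] : forall n : nat, exists xy : plane * plane,
    [/\ C xy.1, C xy.2, `|xy.1 - xy.2| < n.+1%:R^-1 & e < `|phi xy.1 - phi xy.2|].
  move=> n; apply: contrapT => no; apply: H; exists n.+1%:R^-1 => // x y Cx Cy xy.
  by rewrite leNgt; apply/negP => h; apply: no; exists (x, y).
have uC n : C (u n).1 by have [] := Hu n.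
have [p Cp clp] := compact_seq_cluster cC uC.
have e20 : 0 < e / 2 by rewrite divr_gt0.
have [r r0 Hr] := within_dist cphi Cp e20; have r20 : 0 < r / 2 by rewrite divr_gt0.
have [N HN] := natr_above (2 / r).
have [n Nn h] := clp _ r20 N; have [C1 C2 h1 h2] := Hu n.
have hn : n.+1%:R^-1 <= r / 2.
  rewrite -[leRHS]invrK lef_pV2 ?posrE ?invr_gt0 ?divr_gt0 // invf_div.
  by rewrite (le_trans HN) // ler_nat (leq_trans Nn).
have r2 : r / 2 < r by lra.
have d1 := Hr _ C1 (lt_trans h r2).
have d2 : `|phi p - phi (u n).2| < e / 2.
  apply: Hr => //; rewrite -(subrKA (u n).1) (le_lt_trans (ler_normD _ _)) //.
  by rewrite [ltRHS](splitr r) ltrD // (lt_le_trans h1).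
move: h2; rewrite ltNge => /negP; apply.
rewrite -(subrKA (phi p)) (le_trans (ler_normD _ _)) // [leRHS](splitr e).
by rewrite lerD // ltW // distrC.
Qed.

Lemma uniform_mean_cvg (T : plane -> plane) (Z : set plane) (phi : plane -> R) L x k :
  uniform_mean T Z phi L -> Z (iter k T x) ->
  (\sum_(0 <= i < m) phi (iter i T x)) / m%:R @[m --> \oo] --> L.
Proof.
move=> meanL Zx; apply/cvgrPdist_le => e e0.
have e20 : 0 < e / 2 by rewrite divr_gt0.
have [N HN] := meanL _ e20.
pose S n := birkhoff_sum T phi n x.
have [N' HN'] := natr_above ((`|S k| + k%:R * `|L|) / (e / 2)).
rewrite ler_pdivrMr ?divr_gt0 // in HN'.
near=> m; have m0 : 0 < m%:R :> R by rewrite ltr0n; near: m; exists 1%N.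
have Nkm : (N + k <= m)%N by near: m; exists (N + k)%N.
have N'm : (N' <= m)%N by near: m; exists N'.
have km : (k <= m)%N by rewrite (leq_trans _ Nkm) // leq_addl.
rewrite big_mkord -/(birkhoff_sum T phi m x).
have -> : birkhoff_sum T phi m x = S k + birkhoff_sum T phi (m - k) (iter k T x).
  by rewrite -{1}(subnKC km) birkhoff_sumD.
have := HN (m - k)%N _ _ Zx; rewrite leq_subRL // addnC => /(_ Nkm).
rewrite natrB // => h; rewrite -(ler_pM2r m0) -{2}[m%:R]gtr0_norm // -normrM.
rewrite mulrBl divfK ?gt_eqF // distrC.
have N'm' : N'%:R <= m%:R :> R by rewrite ler_nat.
have km' : k%:R <= m%:R :> R by rewrite ler_nat.
have k0 : 0 <= k%:R :> R by [].
have e1 : N'%:R * (e / 2) <= m%:R * (e / 2) by rewrite ler_pM2r // divr_gt0.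
have kL : `|k%:R * L| = k%:R * `|L| by rewrite normrM ger0_norm.
have ek : 0 <= e / 2 * k%:R by rewrite mulr_ge0 // ltW // divr_gt0.
set B := birkhoff_sum _ _ _ _ in h *.
have -> : S k + B - L * m%:R = S k - k%:R * L + (B - (m%:R - k%:R) * L) by ring.
have h1 := ler_normD (S k - k%:R * L) (B - (m%:R - k%:R) * L).
have h2 := ler_normB (S k) (k%:R * L).
rewrite kL in h2; lra.
Unshelve. all: by end_near. Qed.

End CompactSets.

Section UniqueErgodicity.
Context {R : realType} {m : nat}.
Local Notation plane := (R * R)%type.
Variables (T : plane -> plane) (Reg Z W C : set plane) (code : plane -> 'I_m.+1).
Variables (kappa D d : R) (x0 : plane).
Hypothesis ZT : forall x, Z x -> Z (T x).
Hypothesis BD : forall k (M : R) (f : plane -> R), (forall x, Z x -> `|f x| <= M) ->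
  code_determined T code Z k f -> bounded_discrepancy T Z f.
Hypothesis kappa01 : 0 <= kappa < 1.
Hypothesis Z_bounded : forall x y, Z x -> Z y -> `|x - y| <= D.
Hypothesis contract : forall x y, Z x -> Z y -> code x = code y ->
  `|T x - T y| <= kappa * `|x - y|.
Hypothesis Zx0 : Z x0.
Hypotheses (ZReg : Z `<=` Reg) (RegW : forall x n, Reg x -> W (iter n T x)).
Hypotheses (cC : compact C) (clC : closed C) (ZC : Z `<=` C) (CW : C `<=` W).
Local Notation K := (cluster (orbit_of T x0 @ \oo)).
Hypotheses (d_gt0 : 0 < d) (nearK : forall x p, Reg x -> K p -> `|p - x| < d -> Z x).

Let KC : K `<=` C.
Proof.
by apply: (@cluster_sub_closed _ _ _ 0) => // n _; apply/ZC/(iter_invariant ZT).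
Qed.

(** On the compact set that contains the trapped orbits an observable is bounded and uniformly
continuous, so it has a uniform mean over them. A stationary law on the limit set lives on
limits of regular orbits, and those that come close to this set are trapped. *)
Lemma trapped_mean_integral (phi : plane -> R) : {within W, continuous phi} ->
  exists L, uniform_mean T Z phi L /\ forall nu : probability plane R,
    stationary_law T Reg nu -> nu K = 1%E -> (\int[nu]_(p in K) (phi p)%:E = L%:E)%E.
Proof.
move=> cphi; have cphiC : {within C, continuous phi} by exact: continuous_subspaceW cphi.
have [M HM] := compact_continuous_bounded cC cphiC.
have ucphi := compact_uniformly_continuous cC cphiC.
have [L HL] : exists L, uniform_mean T Z phi L.
  apply: (uniform_time_mean ZT BD kappa01 Z_bounded contract _ (M := M)).
  - by exists x0.
  - by move=> x /ZC; exact: HM.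
  - by move=> e /ucphi[r r0 Hr]; exists r => // x y /ZC Cx /ZC; exact: Hr.
exists L; split => // nu snu nuK.
apply: (stationary_integral RegW _ _ d_gt0 nearK cphi _ HL snu nuK).
- exact: cluster_closed.
- by apply: subset_trans CW.
- by move=> p /KC; exact: HM.
Qed.

(** Coded orbits provide a law; any two laws give the same integral to an observable, namely
its time average. *)
Lemma unique_stationary_law : exists mu : probability plane R,
  [/\ stationary_law T Reg mu, mu K = 1%E & forall nu : probability plane R,
    stationary_law T Reg nu -> nu K = 1%E -> forall B, measurable B -> nu B = mu B].
Proof.
have [Psi [mPsi shPsi clPsi KPsi]] := coded_orbits ZT Zx0 BD kappa01 Z_bounded contract.
have clR t : closure (orbit_of T @` Reg) (Psi t).
  by apply: closure_subset (clPsi t); exact: image_subset.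
have [mu smu muK] := coded_stationary_law mPsi shPsi clR KPsi.
exists mu; split => // nu snu nuK; apply: (probability_eq_integral _ muK nuK).
  exact: cluster_closed.
move=> phi cphi _; have cW : {within W, continuous phi} by exact: continuous_subspaceT.
by have [L [_ HL]] := trapped_mean_integral cW; rewrite !HL.
Qed.

End UniqueErgodicity.

(** * The attractor and its law *)

Section Attractor.
Context {R : realType}.
Variables (a b lam e : R).
Hypotheses (ha : 0 < a < 1) (hb : 0 < b < 1) (lamE : lam = 1 - b).
Hypothesis halam : a < 1 + lam - lam ^+ 3 - lam ^+ 4.
Local Notation plane := (R * R)%type.
Local Notation T := (outer_billiard lam (quad a b)).
Local Notation regular := (regular_points lam (quad a b)).
Local Notation len := (rect_length a b).
Local Notation P := (polygon (quad a b)).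

Lemma rect_lengthE : lam ^+ 2 * len = 1 + lam - a.
Proof.
have l0 : 1 - b != 0 by rewrite subr_eq0 gt_eqF //; case/andP: hb.
rewrite /rect_length lamE; have -> : 1 + (1 - b) - a = 1 - b + (1 - a) by ring.
by field.
Qed.

Let lenE := rect_lengthE.
Let lam0 : 0 < lam. Proof. by case/andP: hb; rewrite lamE; lra. Qed.
Let lam1 : lam < 1. Proof. by case/andP: hb; rewrite lamE; lra. Qed.

Lemma rect_length_gt : lam + lam ^+ 2 < len.
Proof.
have l2 : 0 < lam ^+ 2 by rewrite exprn_gt0.
by rewrite -(ltr_pM2l l2) lenE; move: halam; lra.
Qed.

Lemma small_admissible : \forall e \near (0 : R)^'+,
  [/\ 0 < e, e <= 1, lam ^+ 3 * e <= a, admissible a lam len e e (e ^+ 2) &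
    admissible a lam len (2 * e) 0 (e ^+ 2 / 2)].
Proof.
have l0 := lam0; have l1 := lam1; have /andP[a0 a1] := ha.
have lg : 0 < len - (lam + lam ^+ 2) by rewrite subr_gt0 rect_length_gt.
have l3 : 0 < lam ^+ 3 by rewrite exprn_gt0.
have l31 : lam ^+ 3 <= 1 by apply: exprn_ile1; exact: ltW.
have l21 : lam ^+ 2 <= 1 by apply: exprn_ile1; exact: ltW.
near=> x; have x0 : 0 < x by near: x; exact: nbhs_right_gt.
have x1 : x < (len - (lam + lam ^+ 2)) / 2 by near: x; apply: nbhs_right_lt; rewrite divr_gt0.
have x2 : x < a / 2 by near: x; apply: nbhs_right_lt; rewrite divr_gt0.
have x3 : x < lam ^+ 3 / 2 by near: x; apply: nbhs_right_lt; rewrite divr_gt0.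
have x4 : x < 1 - a by near: x; apply: nbhs_right_lt; rewrite subr_gt0.
have x5 : x < lam / 2 by near: x; apply: nbhs_right_lt; rewrite divr_gt0.
have l3x : lam ^+ 3 * x <= x by rewrite ler_piMl // ltW.
have l2x : lam ^+ 2 * x <= x by rewrite ler_piMl // ltW.
have xx : x ^+ 2 < lam ^+ 3 * x by rewrite expr2 ltr_pM2r //; lra.
have xx0 : 0 <= x ^+ 2 by rewrite exprn_ge0 // ltW.
have xx1 : x ^+ 2 <= x by rewrite expr2 ler_piMl ?ltW //; lra.
have le1 : x <= 1 by lra.
have outer1 : lam + lam ^+ 2 + (x + lam ^+ 2 * x) <= len by lra.
have inner1 : lam + lam ^+ 2 + (2 * x + lam ^+ 2 * 0) <= len by lra.
have inner2 : lam ^+ 3 * (2 * x) <= a by lra.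
have x0' := ltW x0.
split; [exact: x0|exact: le1|lra| |]; split; [exact: x0'|exact: xx0|exact: outer1|lra| |
  exact: lexx|lra|exact: inner1|exact: inner2|]; split; lra.
Unshelve. all: by end_near. Qed.

Hypotheses (e_gt0 : 0 < e) (e_le1 : e <= 1) (la3 : lam ^+ 3 * e <= a).
Hypothesis adm : admissible a lam len e e (e ^+ 2).
Hypothesis adm_inner : admissible a lam len (2 * e) 0 (e ^+ 2 / 2).

Local Notation Z := (trapped a b lam len e e (e ^+ 2)).
Local Notation inner := (zone a lam len (2 * e) 0 (e ^+ 2 / 2)).

(** The orbits trapped in the smaller zone stay at a definite distance from the
boundary of the larger one. *)
Lemma inner_zone_nbhs p x : inner p -> `|p - x| < e ^+ 2 / 2 -> zone a lam len e e (e ^+ 2) x.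
Proof.
have l0 := lam0; have l1 := lam1; have e0 := e_gt0.
have [_ _ _ _ [el _ _]] := adm.
have l3e : lam ^+ 3 * e <= lam ^+ 2 * e.
  by rewrite ler_pM2r // exprS ler_piMl ?exprn_ge0 ?ltW.
have l2e : lam ^+ 2 * e <= lam * e.
  by rewrite ler_pM2r // exprS expr1 ler_piMl ?ltW.
have l1e : lam * e <= e by rewrite ler_piMl // ltW.
move=> zp; rewrite plane_norm_lt /= !ltr_norml => /andP[/andP[x1 x2] /andP[y1 y2]].
move: zp => /or3P[] /and3P[p1 p2]; rewrite ler_norml => /andP[p3 p4]; apply/or3P;
  [apply: Or31|apply: Or32|apply: Or33]; apply/and3P; split;
  rewrite ?ler_norml; try (apply/andP; split); lra.
Qed.

Lemma trapped_inner : trapped a b lam len (2 * e) 0 (e ^+ 2 / 2) `<=` Z.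
Proof.
move=> x [Rx zx]; split => //; apply: (inner_zone_nbhs zx).
by rewrite subrr normr0 divr_gt0 // exprn_gt0.
Qed.

Lemma rect_trapped : rect_points a b e `<=` Z.
Proof.
have e2 : 0 <= e ^+ 2 by rewrite exprn_ge0 // ltW.
move=> x []; rewrite -lamE => Rx H; split => //; apply/or3P/Or31.
by case: H => -[]; rewrite /= !in_itv /= => /andP[x1 x2] /andP[y1 y2];
  apply/and3P; split; rewrite ?ler_norml; try (apply/andP; split);
  have := la3; lra.
Qed.

Lemma inner_rect x : trapped_base a b lam len (2 * e) (e ^+ 2 / 2) x -> rect_points a b e x.
Proof.
have e2 : 0 <= e ^+ 2 by rewrite exprn_ge0 // ltW.
have e0 := e_gt0; move=> [Rx /and4P[x1 x2 y1 y2]]; split; first by rewrite -lamE.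
by right; split; rewrite /= in_itv /=; apply/andP; split; lra.
Qed.

Lemma regular_outside x n : regular x -> (~` P°) (iter n T x).
Proof.
move=> Rx /interior_subset; have := regular_iter ha hb lamE (n := n) Rx.
by rewrite /regular_points => h Px; apply: h; left.
Qed.

Variable x0 : plane.
Hypothesis x0_inner : trapped_base a b lam len (2 * e) (e ^+ 2 / 2) x0.
Local Notation K := (cluster (orbit_of T x0 @ \oo)).

Let x0_trapped : trapped a b lam len (2 * e) 0 (e ^+ 2 / 2) x0.
Proof. exact: (trapped_base_trapped adm_inner x0_inner). Qed.

Let Zx0 : Z x0. Proof. exact: trapped_inner x0_trapped. Qed.

Let ZT x : Z x -> Z (T x).
Proof. exact: (trapped_step ha hb lamE lenE e_gt0 adm). Qed.

Let inner_closed : closed [set p | inner p].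
Proof.
have -> : [set p | inner p] =
    (fst @^-1` `[- len + 2 * e, a - lam ^+ 3 * (2 * e)] `&`
       snd @^-1` `[1 - e ^+ 2 / 2, 1 + e ^+ 2 / 2]) `|`
    (fst @^-1` `[- 0, lam * (len - 2 * e)] `&`
       snd @^-1` `[- lam - e ^+ 2 / 2, - lam + e ^+ 2 / 2]) `|`
    (fst @^-1` `[a + lam ^+ 2 * (2 * e), 1 + lam + lam * 0] `&`
       snd @^-1` `[1 - e ^+ 2 / 2, 1 + e ^+ 2 / 2]).
  apply/seteqP; split => p.
    move=> /or3P[] /and3P[p1 p2]; rewrite ler_norml => /andP[p3 p4];
      [left; left|left; right|right]; split; rewrite /= in_itv /=; apply/andP; split => //; lra.
  move=> [[[]|[]]|[]]; rewrite /= !in_itv /= => /andP[p1 p2] /andP[p3 p4]; apply/or3P;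
    [apply: Or31|apply: Or32|apply: Or33]; apply/and3P; split => //;
    rewrite ler_norml; apply/andP; split; lra.
have cl (f : plane -> R) u v : continuous f -> closed (f @^-1` `[u, v]).
  by move=> cf; apply: closed_comp => [x _|]; [exact: cf|exact: itv_closed].
by apply: closedU; [apply: closedU|]; apply: closedI; apply: cl => p;
  [exact: cvg_fst|exact: cvg_snd|exact: cvg_fst|exact: cvg_snd|exact: cvg_fst|exact: cvg_snd].
Qed.

Let K_inner : K `<=` [set p | inner p].
Proof.
apply: (@cluster_sub_closed _ _ _ 0) => // n _.
have e20 : 0 < 2 * e by rewrite mulr_gt0.
have stepi := trapped_step ha hb lamE lenE e20 adm_inner.
by have [] := iter_invariant stepi n x0_trapped.
Qed.

Let nearK x p : regular x -> K p -> `|p - x| < e ^+ 2 / 2 -> Z x.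
Proof. by move=> Rx /K_inner zp h; split => //; exact: inner_zone_nbhs zp h. Qed.

Let compact_box : exists2 C : set plane, compact C /\ closed C & Z `<=` C /\ C `<=` ~` P°.
Proof.
have [D HD] := trapped_bounded ha hb lamE e_gt0 adm.
have cB : compact (`[- D, D]%classic `*` `[- D, D]%classic : set plane).
  by apply: compact_setX; exact: segment_compact.
have cW : closed (~` P° : set plane) by apply: open_closedC; exact: open_interior.
exists ((`[- D, D]%classic `*` `[- D, D]%classic) `&` ~` P°).
  have cC : compact ((`[- D, D]%classic `*` `[- D, D]%classic : set plane) `&` ~` P°).
    exact: compact_closedI.
  by split => //; apply: compact_closed => //; exact: norm_hausdorff.
split; last exact: subIsetr.
move=> x Zx; split; last exact: (regular_outside (n := 0) Zx.1).
have := HD x Zx; rewrite plane_norm_le !ler_norml => /andP[h1 h2].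
by split; rewrite /= in_itv.
Qed.

Let BD k (M : R) (f : plane -> R) : (forall x, Z x -> `|f x| <= M) ->
  code_determined T (vertex_code a b) Z k f -> bounded_discrepancy T Z f.
Proof. exact: (trapped_bounded_discrepancy ha hb lamE halam lenE e_gt0 adm). Qed.

Let lam01 : 0 <= lam < 1. Proof. by rewrite lam1 ltW. Qed.

Let Z_bounded : exists D, forall x y, Z x -> Z y -> `|x - y| <= D.
Proof.
have [D HD] := trapped_bounded ha hb lamE e_gt0 adm; exists (D + D) => x y Zx Zy.
by rewrite (le_trans (ler_normB _ _)) // lerD // HD.
Qed.

Let contract x y : Z x -> Z y -> vertex_code a b x = vertex_code a b y ->
  `|T x - T y| <= lam * `|x - y|.
Proof. exact: trapped_contract. Qed.

(** All trapped orbits have the same limit set. It is computed on an orbit trapped in the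
smaller zone, because it then has a neighbourhood of trapped regular points. *)
Lemma attractorE : K_ab a b e = K.
Proof.
have [D HD] := Z_bounded; have [C [cC clC] [ZC _]] := compact_box.
have omega x : Z x -> cluster (orbit_of T x @ \oo) = K.
  by move=> Zx; exact: (cluster_orbit_eq ZT BD lam01 HD contract Zx Zx0).
have orbitE : orbit (1 - b) (quad a b) = orbit_of T by rewrite -lamE.
have KA : is_attractor (1 - b) (quad a b) (rect_points a b e) K.
  have ap x : Z x -> asymptotic_to (1 - b) (quad a b) x K.
    move=> Zx r r0; rewrite orbitE -(omega x Zx).
    apply: (compact_approaches_cluster cC) => // n.
    by apply: ZC; exact: (iter_invariant ZT).
  split.
  - apply: (subclosed_compact _ cC); first exact: cluster_closed.
    by apply: (@cluster_sub_closed _ _ _ 0) => // n _; apply/ZC/(iter_invariant ZT).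
  - by move=> x /rect_trapped; exact: ap.
  - by move=> x /rect_trapped Zx; rewrite /omega_limit orbitE omega.
have [_ _ /(_ x0 (inner_rect x0_inner)) h] := xgetPex set0 (ex_intro _ K KA).
have {}h : omega_limit (1 - b) (quad a b) x0 = K_ab a b e := h.
by rewrite -h /omega_limit orbitE.
Qed.

Lemma trapped_law : exists mu : probability plane R,
  [/\ invariant_law lam (quad a b) mu /\ mu (K_ab a b e) = 1%E,
      forall nu : probability plane R,
        invariant_law lam (quad a b) nu -> nu (K_ab a b e) = 1%E ->
        forall B : set plane, measurable B -> nu B = mu B &
      forall phi : plane -> R, continuous_outside (quad a b) phi ->
        forall x n, Z (iter n T x) ->
          time_averages_to lam (quad a b) x mu (K_ab a b e) phi].
Proof.
have [D HD] := Z_bounded; have [C [cC clC] [ZC CW]] := compact_box.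
have ZR : Z `<=` regular by move=> x [].
have RW x n : regular x -> (~` P°) (iter n T x) by exact: regular_outside.
have d0 : 0 < e ^+ 2 / 2 by rewrite divr_gt0 // exprn_gt0.
have mean := trapped_mean_integral ZT BD lam01 HD contract Zx0 RW cC clC ZC CW d0 nearK.
have [mu [smu muK uniq]] :=
  unique_stationary_law ZT BD lam01 HD contract Zx0 ZR RW cC clC ZC CW d0 nearK.
exists mu; rewrite attractorE; split => //.
move=> phi cphi x n Zn; have [L [meanL int]] := mean phi cphi.
rewrite /time_averages_to (int mu smu muK).
by apply: cvg_EFin; [exact: nearW|exact: (uniform_mean_cvg meanL Zn)].
Qed.

End Attractor.

Theorem theorem5 (R : realType) (a b lam : R)
    (ha : 0 < a < 1) (hb : 0 < b < 1) (hab : a + b <= 1)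
    (hlam : lam = 1 - b) (halam : a < 1 + lam - lam ^+ 3 - lam ^+ 4) :
  \forall eps \near (0 : R)^'+,
    exists mu : probability (R * R)%type R,
      [/\ invariant_law lam (quad a b) mu /\ mu (K_ab a b eps) = 1%E,
          forall nu : probability (R * R)%type R,
            invariant_law lam (quad a b) nu -> nu (K_ab a b eps) = 1%E ->
            forall B : set (R * R), measurable B -> nu B = mu B,
          forall phi : R * R -> R, continuous_outside (quad a b) phi ->
            forall x : R * R, rect_points a b eps x ->
              time_averages_to lam (quad a b) x mu (K_ab a b eps) phi &
          4 / 10 <= a <= 5 / 10 -> b = 4 / 10 ->
            forall phi : R * R -> R, continuous_outside (quad a b) phi ->
            forall x : R * R, regular_points lam (quad a b) x ->
              time_averages_to lam (quad a b) x mu (K_ab a b eps) phi].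
Proof.
apply: filterS (small_admissible ha hb hlam halam) => e [e0 e1 la3 adm adm'].
have lenE := rect_lengthE a hb hlam.
have e20 : 0 < 2 * e by rewrite mulr_gt0.
have eta0 : 0 < e ^+ 2 / 2 by rewrite divr_gt0 // exprn_gt0.
have [x0 Bx0] := regular_base_ex ha hb hlam halam lenE e20 adm' eta0.
have [mu [law uniq avg]] := trapped_law ha hb hlam halam e0 la3 adm adm' Bx0.
exists mu; split => //.
- move=> phi cphi x rx; apply: (avg phi cphi x 0%N).
  exact: (rect_trapped hlam e0 la3 rx).
- move=> ha' hb' phi cphi x Rx.
  have [n zn] := regular_captured e ha ha' hb' hlam lenE e1 (exprn_gt0 2 e0) la3 Rx.
  by apply: (avg phi cphi x n); split => //; exact: (regular_iter ha hb hlam).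
Qed.
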